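(* Let $\Gamma=PU(3;3)\cong G_2(2)'$. The joint spectral measure (over $\mathbb{T}^2$) for all embeddings of $\Gamma$ into the fundamental representations of $G_2$ is $$\mathrm{d}\varepsilon = \frac{1}{672\pi^4} J^2 \, \mathrm{d}_7 \times \mathrm{d}_7 + \frac{1}{144} (24-K) \, \mathrm{d}_4 \times \mathrm{d}_4 + \frac{1}{6} \, \mathrm{d}_3 \times \mathrm{d}_3 - \frac{1}{12} \, \mathrm{d}_2 \times \mathrm{d}_2 + \frac{1}{168} \, \mathrm{d}_1 \times \mathrm{d}_1 + \frac{1}{1152\pi^4} J^2 \, \mathrm{d}^{(4)} + \frac{1}{6} \, \mathrm{d}^{(2)} - \frac{1}{12} \, \mathrm{d}^{(1)} + \frac{1}{48} \sum_{g \in D_{12}} \delta_{g(\mu,-1)},$$ for $\mu$ a primitive 8-th root of unity, where $$K(\theta_1,\theta_2) = 4\big(\sin(2\pi(\theta_1+\theta_2))-\sin(2\pi(2\theta_1-\theta_2))-\sin(2\pi(2\theta_2-\theta_1))\big)^2 .$$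
   Context: $G_2$ is the compact simply connected simple Lie group of dimension 14, with fundamental representations $\rho_1$, $\rho_2$ of dimensions 7 and 14. Its maximal torus is identified with $\mathbb{T}^2$ so that, for $(\omega_1,\omega_2)=(e^{2\pi i\theta_1},e^{2\pi i\theta_2})\in\mathbb{T}^2$, $$\chi_{\rho_1} = 1 + \omega_1 + \omega_1^{-1} + \omega_2 + \omega_2^{-1} + \omega_1\omega_2^{-1} + \omega_1^{-1}\omega_2,$$ $$\chi_{\rho_2} = \chi_{\rho_1} + 1 + \omega_1\omega_2 + \omega_1^{-1}\omega_2^{-1} + \omega_1^2\omega_2^{-1} + \omega_1^{-2}\omega_2 + \omega_1\omega_2^{-2} + \omega_1^{-1}\omega_2^2 .$$ The Weyl group $D_{12}$ of $G_2$ (dihedral of order 12) is the subgroup of $GL(2,\mathbb{Z})$ generated by $T_2=\begin{pmatrix}0&-1\\-1&0\end{pmatrix}$ and $T_6=\begin{pmatrix}0&1\\-1&1\end{pmatrix}$, acting on $\mathbb{T}^2$ by $T(\omega_1,\omega_2)=(\omega_1^{a_{11}}\omega_2^{a_{12}},\omega_1^{a_{21}}\omega_2^{a_{22}})$ for $T=(a_{il})$. An embedding of a finite group $\Gamma$ in $G_2$ is an injective homomorphism $\iota:\Gamma\to G_2$; put $\varrho_j=\rho_j\circ\iota$, $j=1,2$. Let $\Delta_j$ be the adjacency matrix of the McKay graph of $\varrho_j$ (the matrix of tensoring with $\varrho_j$ on the irreducible representations of $\Gamma$), and $e_{\ast}$ the basis vector of the trivial representation. The joint spectral measure over $\mathbb{T}^2$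 of the embedding is the unique $D_{12}$-invariant probability measure $\varepsilon$ on $\mathbb{T}^2$ such that for all integers $m,n\geq 0$ $$\int_{\mathbb{T}^2}\chi_{\rho_1}^m\chi_{\rho_2}^n\,\mathrm{d}\varepsilon=\langle\Delta_1^m\Delta_2^n e_\ast,e_\ast\rangle=\sum_C\frac{|C|}{|\Gamma|}\chi_{\varrho_1}(C)^m\chi_{\varrho_2}(C)^n,$$ the sum being over the conjugacy classes $C$ of $\Gamma$. Notation for measures on $\mathbb{T}^2$: $\mathrm{d}_k$ is the uniform probability measure on the $k$-th roots of unity; $\mathrm{d}^{(n)}$ is the uniform probability measure on $\{(e^{2\pi i q_1/3n},e^{2\pi i q_2/3n}) : q_1,q_2\in\{0,1,\ldots,3n-1\},\ q_1+q_2\equiv 0 \bmod 3\}$; $\delta_x$ is the Dirac measure at $x$. A function multiplying a measure is a density, and functions on $\mathbb{T}^2$ are written in the coordinates $\theta_1,\theta_2$. The function $J$ is $$J = 8\pi^2\big(\cos 2\pi(2\theta_1+\theta_2)+\cos 2\pi(\theta_1-3\theta_2)+\cos 2\pi(3\theta_1-2\theta_2)-\cos 2\pi(\theta_1+2\theta_2)-\cos 2\pi(3\theta_1-\theta_2)-\cos 2\pi(2\theta_1-3\theta_2)\big).$$ $PU(3;3)\cong G_2(2)'$ is the simple group of order 6048, the projective unitary group of degree 3 for the extension $\mathbb{F}_9/\mathbb{F}_3$, isomorphic to the derived subgroup of $G_2(2)=G_2(\mathbb{F}_2)$. *)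

(* Defs.v *)
From HB Require Import structures.
From mathcomp Require Import all_boot all_order all_algebra all_fingroup.
From mathcomp Require Import all_solvable all_field all_character.
From mathcomp Require Import complex.
From mathcomp Require Import all_classical all_reals all_analysis.
From mathcomp Require Import ring.

Set Implicit Arguments.
Unset Strict Implicit.
Unset Printing Implicit Defensive.

Import Order.TTheory GRing.Theory Num.Theory.
Local Open Scope classical_set_scope.
Local Open Scope ring_scope.
Local Open Scope complex_scope.

(* F_9, and its conjugation x |-> x ^+ 3 over F_3. *)
Definition F9_spec := @pPrimePowerField 3 2 isT isT.
Definition F9 : finFieldType := s2val F9_spec.
Definition F9_pchar : 3%N \in [pchar F9] := s2valP F9_spec.
Definition F9_conj : F9 -> F9 := pFrobenius_aut F9_pchar.
HB.instance Definition _ :=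
  GRing.RMorphism.copy F9_conj (pFrobenius_aut F9_pchar).

Section ProjectiveUnitary.

Definition GU33_set : {set {'GL_3[F9]}} :=
  [set A : {'GL_3[F9]} | GLval A *m (map_mx F9_conj (GLval A))^T == 1%:M].

Lemma GU33_group_set : group_set GU33_set.
Proof.
apply/group_setP; split=> [|A B].
  by rewrite inE GL_1E map_mx1 trmx1 mulmx1.
rewrite !inE GL_ME => /eqP hA /eqP hB.
by rewrite map_mxM trmx_mul mulmxA -(mulmxA (GLval A)) hB mulmx1 hA.
Qed.
Canonical GU33 : {group {'GL_3[F9]}} := Group GU33_group_set.

Definition PU33 : {group coset_of 'Z(GU33)} := (GU33 / 'Z(GU33))%G.

End ProjectiveUnitary.

Section G2.
Variable R : realType.

(* The cross product of the imaginary octonions R^7, for the multiplication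
   table e_i e_(i+1) = e_(i+3), indices mod 7 (addition in 'I_7 is mod 7). *)
Definition cross (x y : 'rV[R]_7) : 'rV[R]_7 :=
  \row_(k < 7)
    (x 0 (k + 1)%R * y 0 (k + 3%:R)%R - x 0 (k + 3%:R)%R * y 0 (k + 1)%R
   + x 0 (k + 2%:R)%R * y 0 (k + 6%:R)%R - x 0 (k + 6%:R)%R * y 0 (k + 2%:R)%R
   + x 0 (k + 4%:R)%R * y 0 (k + 5%:R)%R - x 0 (k + 5%:R)%R * y 0 (k + 4%:R)%R).

Fact crossDl a x x' y : cross (a *: x + x') y = a *: cross x y + cross x' y.
Proof. by apply/rowP=> k; rewrite !mxE; ring. Qed.

Fact crossDr a x y y' : cross x (a *: y + y') = a *: cross x y + cross x y'.
Proof. by apply/rowP=> k; rewrite !mxE; ring. Qed.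

Definition crossr y x := cross x y.
HB.instance Definition _ x :=
  GRing.isLinear.Build R _ _ _ (cross x) (fun a => crossDr a x).
HB.instance Definition _ y :=
  GRing.isLinear.Build R _ _ _ (crossr y) (fun a x x' => crossDl a x x' y).

(* The compact group G_2 as the automorphism group of the octonions, acting on
   the imaginary ones; such a g is automatically orthogonal. *)
Definition G2 (g : 'M[R]_7) : Prop :=
  g \in unitmx /\ forall x y, cross x y *m g = cross (x *m g) (y *m g).

Definition leibniz (x y : 'rV[R]_7) (X : 'M[R]_7) : 'rV[R]_7 :=
  cross x y *m X - (cross (x *m X) y + cross x (y *m X)).

Fact leibniz_linear x y : linear (leibniz x y).
Proof.
move=> a X Y; rewrite /leibniz !mulmxDr -!scalemxAr crossDl crossDr.
by apply/rowP=> k; rewrite !mxE; ring.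
Qed.
HB.instance Definition _ x y :=
  GRing.isLinear.Build R _ _ _ (leibniz x y) (leibniz_linear x y).

(* The Lie algebra of G_2: the derivations of cross (see lieG2P). *)
Definition lieG2 : 'M[R]_(7 * 7) :=
  (\bigcap_(i < 7) \bigcap_(j < 7)
      kermx (lin_mx (leibniz (delta_mx 0 i) (delta_mx 0 j))))%MS.

Lemma lieG2P X : (mxvec X <= lieG2)%MS <-> forall x y, leibniz x y X = 0.
Proof.
split=> [/sub_bigcapmxP h x y|h]; last first.
  apply/sub_bigcapmxP=> i _; apply/sub_bigcapmxP=> j _.
  by apply/sub_kermxP; rewrite mul_vec_lin [X in mxvec X]h linear0.
have hd i j : leibniz (delta_mx 0 i) (delta_mx 0 j) X = 0.
  have /sub_bigcapmxP/(_ j isT)/sub_kermxP := h i isT.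
  by rewrite mul_vec_lin => /eqP; rewrite mxvec_eq0 => /eqP.
have hx i z : leibniz (delta_mx 0 i) z X = 0.
  rewrite (row_sum_delta z) /leibniz !linear_sum /= !mulmx_suml linear_sum /=.
  rewrite -big_split/= -sumrB big1 // => j _.
  by rewrite !linearZ/= -!scalemxAl linearZ/= -scalerDr -scalerBr [X in _ *: X]hd scaler0.
rewrite (row_sum_delta x) /leibniz !mulmx_suml.
rewrite -![cross _ y]/(crossr y _) -[cross _ (y *m X)]/(crossr (y *m X) _) !linear_sum /=.
rewrite !mulmx_suml -big_split/= -sumrB big1 // => i _.
by rewrite -!scalemxAl !linearZ/= -scalemxAl -scalerDr -scalerBr [X in _ *: X]hx scaler0.
Qed.

(* Matrices act on row vectors from the right, so Ad g is X |-> g^-1 X g. *)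
Definition Ad (g : 'M[R]_7) : 'M[R]_(7 * 7) :=
  lin_mx (mulmxr g \o mulmx (invmx g)).

Lemma AdM g h : g \in unitmx -> h \in unitmx -> Ad (g *m h) = Ad g *m Ad h.
Proof.
move=> ug uh; apply/row_matrixP=> i; rewrite !rowE mulmxA.
rewrite -[delta_mx 0 i]vec_mxK !mul_vec_lin /=; congr mxvec.
have -> : invmx (g *m h) = invmx h *m invmx g.
  have ugh : g *m h \in unitmx by rewrite unitmx_mul ug.
  by rewrite -[RHS](mulmxK ugh) !mulmxA (mulmxKV ug) mulVmx ?mul1mx.
by rewrite !mulmxA.
Qed.

Lemma Ad1 : Ad 1%:M = 1%:M.
Proof.
apply/row_matrixP=> i; rewrite !rowE -[delta_mx 0 i]vec_mxK mul_vec_lin /=.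
by rewrite invmx1 mul1mx !mulmx1.
Qed.

Lemma lieG2_stable g : G2 g -> (lieG2 *m Ad g <= lieG2)%MS.
Proof.
move=> [ug hg]; apply/row_subP=> i; rewrite row_mul -[row i _]vec_mxK.
have := row_sub i lieG2; rewrite -{1}[row i _]vec_mxK.
move: (vec_mx _) => X /lieG2P hX; rewrite mul_vec_lin; apply/lieG2P => x y /=.
have hgV u v : cross u v *m invmx g = cross (u *m invmx g) (v *m invmx g).
  by rewrite -[RHS](mulmxK ug) hg !mulmxKV.
have := hX (x *m invmx g) (y *m invmx g); rewrite /leibniz => /eqP.
rewrite subr_eq0 => /eqP e; apply/eqP; rewrite subr_eq0; apply/eqP.
by rewrite !mulmxA hgV e mulmxDl !hg !mulmxKV.
Qed.

Definition rho1 (g : 'M[R]_7) : 'M[R[i]]_7 := map_mx (real_complex R) g.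

(* The adjoint action on lieG2, complexified; \rank lieG2 is 14. *)
Definition rho2 (g : 'M[R]_7) : 'M[R[i]]_(\rank lieG2) :=
  map_mx (real_complex R)
    (in_submod lieG2 (val_submod (1%:M : 'M[R]_(\rank lieG2)) *m Ad g)).

Record G2_embedding (gT : finGroupType) (Gam : {group gT}) := G2Embedding {
  emb :> gT -> 'M[R]_7;
  emb_G2 : forall g, g \in Gam -> G2 (emb g);
  embM : {in Gam &, forall g h, emb (g * h)%g = emb g *m emb h};
  emb_inj : {in Gam &, injective emb}
}.

Fact mx_repr_proj (F : fieldType) (gT : finGroupType) (Gam : {group gT}) n
  (rG : mx_representation F Gam n) : mx_repr Gam rG.
Proof. by case: rG. Qed.

Section Representations.
Variables (gT : finGroupType) (Gam : {group gT}) (iota : G2_embedding Gam).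

Fact emb_repr : mx_repr Gam iota.
Proof.
split=> [|g h Gg Gh]; last exact: embM.
have [u1 _] := emb_G2 iota (group1 Gam).
by rewrite -[LHS](mulmxK u1) -embM ?group1// mulg1 mulmxV.
Qed.

Fact Ad_emb_repr : mx_repr Gam (fun g => Ad (iota g)).
Proof.
split=> [|g h Gg Gh]; first by rewrite emb_repr.1 Ad1.
by rewrite embM// AdM//; [have [] := emb_G2 iota Gg|have [] := emb_G2 iota Gh].
Qed.

Fact lieG2_mxmodule : mxmodule (MxRepresentation Ad_emb_repr) lieG2.
Proof. by apply/mxmoduleP=> g /(emb_G2 iota) /lieG2_stable. Qed.

Fact varrho1_repr : mx_repr Gam (fun g => rho1 (iota g)).
Proof.
exact: mx_repr_proj (map_repr (real_complex R) (MxRepresentation emb_repr)). Qed.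

Fact varrho2_repr : mx_repr Gam (fun g => rho2 (iota g)).
Proof. exact: mx_repr_proj (map_repr (real_complex R) (submod_repr lieG2_mxmodule)). Qed.

Definition varrho1 := MxRepresentation varrho1_repr.
Definition varrho2 := MxRepresentation varrho2_repr.
End Representations.

Section McKay.
Variables (gT : finGroupType) (Gam : {group gT}).

Definition irrs : irrType R[i] Gam := DecSocleType (regular_repr R[i] Gam).

Definition irr_mult n (rG : mx_representation R[i] Gam n) (k : irrs) : nat :=
  (\sum_(W : DecSocleType rG | irr_comp irrs (socle_repr W) == k)
     socle_mult W)%N.

Definition mckay n (rG : mx_representation R[i] Gam n) : 'M[R[i]]_#|irrs| :=
  \matrix_(i, k)
    (irr_mult (prod_repr (irr_repr (enum_val i)) rG) (enum_val k))%:R.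

Definition estar : 'cV[R[i]]_#|irrs| := delta_mx (enum_rank [1 irrs]%irr) 0.

Definition inner d (u v : 'cV[R[i]]_d) : R[i] := \sum_i u i 0 * (v i 0)^*.

Variable iota : G2_embedding Gam.

Definition mckay_moment (m n : nat) : R[i] :=
  inner (mckay (varrho1 iota) ^+ m *m mckay (varrho2 iota) ^+ n *m estar) estar.

Definition class_moment (m n : nat) : R[i] :=
  \sum_(C in classes Gam) #|C|%:R / #|Gam|%:R
     * (\tr (varrho1 iota (repr C))) ^+ m * (\tr (varrho2 iota (repr C))) ^+ n.
End McKay.
End G2.

Section Torus.
Variable R : realType.

Record circle := Circle { cval :> R[i]; cvalP : `|cval| == 1 }.
HB.instance Definition _ := [isSub for cval].
HB.instance Definition _ := [Choice of circle by <:].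

Fact circle1_subproof : `|1 : R[i]| == 1. Proof. by rewrite normr1. Qed.
Fact circleN1_subproof : `|-1 : R[i]| == 1. Proof. by rewrite normrN1. Qed.
Definition circleN1 : circle := Circle circleN1_subproof.
HB.instance Definition _ := isPointed.Build circle (Circle circle1_subproof).

(* The Borel sigma-algebra of the circle, as a subset of R^2. *)
Definition circle_coord (z : circle) : R * R :=
  (complex.Re (cval z), complex.Im (cval z)).
HB.instance Definition _ :=
  Measurable.copy circle (g_sigma_algebra_preimageType circle_coord).

Fact expi_subproof (t : R) :
  `|cos (2 * pi * t) +i* sin (2 * pi * t) : R[i]| == 1.
Proof. by rewrite normc_def /= cos2Dsin2 sqrtr1. Qed.
Definition expi (t : R) : circle := Circle (expi_subproof t).

(* The coordinate theta of a point e^{2 pi i theta}, in [0, 1). *)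
Definition theta (z : circle) : R :=
  let: (x, y) := circle_coord z in
  if 0 <= y then acos x / (2 * pi) else 1 - acos x / (2 * pi).

Lemma thetaK : cancel theta expi.
Proof.
case=> -[x y] h; apply: val_inj => /=; rewrite /theta /=.
have {h} hn : x ^+ 2 + y ^+ 2 = 1.
  have /eqP := h; rewrite normc_def /= => -[/(congr1 (fun r => r ^+ 2))].
  by rewrite sqr_sqrtr ?expr1n// addr_ge0// sqr_ge0.
have hx : -1 <= x <= 1.
  by rewrite -ler_norml -(@expr_le1 _ 2)// real_normK ?num_real// -hn lerDl sqr_ge0.
have pi0 : 2 * pi != 0 :> R by rewrite mulf_neq0 ?pnatr_eq0// gt_eqF// pi_gt0.
have hy : 1 - x ^+ 2 = y ^+ 2 by rewrite -hn; ring.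
case: ifPn => [y0|]; last rewrite -ltNge => y0.
  have -> : 2 * pi * (acos x / (2 * pi)) = acos x by rewrite mulrC divfK.
  by rewrite acosK ?in_itv//= sin_acos// hy sqrtr_sqr ger0_norm.
have -> : 2 * pi * (1 - acos x / (2 * pi)) = - acos x + pi *+ 2.
  by rewrite mulrBr mulr1 mulrCA mulfV// mulr1 addrC mulr_natl.
rewrite cosD2pi sinD2pi cosN sinN.
by rewrite acosK ?in_itv//= sin_acos// hy sqrtr_sqr ltr0_norm// opprK.
Qed.

Definition torus : Type := (circle * circle)%type.
HB.instance Definition _ := Measurable.on torus.

Fact torus_act_subproof (a b : int) (w : torus) :
  `|cval w.1 ^ a * cval w.2 ^ b| == 1.
Proof.
have h (z : R[i]) (n : int) : `|z| == 1 -> `|z ^ n| = 1.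
  by move=> /eqP z1; case: n => n; rewrite ?NegzE ?exprzN ?normfV normrX z1 expr1n ?invr1.
by rewrite normrM !h ?cvalP// mulr1.
Qed.
Definition torus_act (A : 'M[int]_2) (w : torus) : torus :=
  (Circle (torus_act_subproof (A 0 0) (A 0 1) w),
   Circle (torus_act_subproof (A 1 0) (A 1 1) w)).

Definition chi1 (w : torus) : R[i] :=
  let w1 := cval w.1 in let w2 := cval w.2 in
  1 + w1 + w1^-1 + w2 + w2^-1 + w1 * w2^-1 + w1^-1 * w2.

Definition chi2 (w : torus) : R[i] :=
  let w1 := cval w.1 in let w2 := cval w.2 in
  chi1 w + 1 + w1 * w2 + w1^-1 * w2^-1 + w1 ^+ 2 * w2^-1 + w1 ^- 2 * w2
    + w1 * w2 ^- 2 + w1^-1 * w2 ^+ 2.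

End Torus.

Definition T2mx : 'M[int]_2 :=
  \matrix_(i, j) nth 0 (nth [::] [:: [:: 0; -1]; [:: -1; 0]] i) j.
Definition T6mx : 'M[int]_2 :=
  \matrix_(i, j) nth 0 (nth [::] [:: [:: 0; 1]; [:: -1; 1]] i) j.

(* The subgroup of GL(2, Z) generated by T2mx and T6mx. *)
Inductive in_D12 : 'M[int]_2 -> Prop :=
| D12_T2 : in_D12 T2mx
| D12_T6 : in_D12 T6mx
| D12_1 : in_D12 1%:M
| D12_mul A B : in_D12 A -> in_D12 B -> in_D12 (A *m B)
| D12_inv A : in_D12 A -> in_D12 (invmx A).
Definition D12 : set 'M[int]_2 := in_D12.

Section Measures.
Variable R : realType.
Local Notation T2 := (torus R).

Section Uniform.
Context d (T : measurableType d).
Local Open Scope ereal_scope.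

(* The uniform probability measure on the points listed in s (if s is
   nonempty and without repetition). *)
Definition unif (s : seq T) : set T -> \bar R :=
  mscale ((size s)%:R^-1 : R)%:nng%R
    (msum (fun i => dirac (nth point s i) : {measure set T -> \bar R}) (size s)).

HB.instance Definition _ s := Measure.on (unif s).

Fact unif_fin s : fin_num_fun (unif s).
Proof.
move=> A mA; rewrite /unif /mscale/= fin_numM// /msum sum_fin_num.
by apply/allP => x /mapP[i _ ->]; rewrite /= diracE.
Qed.
HB.instance Definition _ s := Measure_isFinite.Build _ _ _ (unif s) (unif_fin s).
End Uniform.

Definition droots (k : nat) : {finite_measure set (circle R) -> \bar R} :=
  unif [seq expi (q%:R / k%:R) | q <- iota 0 k].

Definition dxd (k : nat) : {measure set T2 -> \bar R} :=
  (droots k \x droots k)%E.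

Definition dsup (n : nat) : {finite_measure set T2 -> \bar R} :=
  unif [seq (expi (q.1%:R / (3 * n)%:R), expi (q.2%:R / (3 * n)%:R))
       | q <- [seq (q1, q2) | q1 <- iota 0 (3 * n), q2 <- iota 0 (3 * n)]
       & (3 %| q.1 + q.2)%N].

Definition Jfun (t1 t2 : R) : R :=
  8 * pi ^+ 2 * (cos (2 * pi * (2 * t1 + t2)) + cos (2 * pi * (t1 - 3 * t2))
    + cos (2 * pi * (3 * t1 - 2 * t2)) - cos (2 * pi * (t1 + 2 * t2))
    - cos (2 * pi * (3 * t1 - t2)) - cos (2 * pi * (2 * t1 - 3 * t2))).

Definition Kfun (t1 t2 : R) : R :=
  4 * (sin (2 * pi * (t1 + t2)) - sin (2 * pi * (2 * t1 - t2))
       - sin (2 * pi * (2 * t2 - t1))) ^+ 2.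

Definition on_torus (f : R -> R -> R) (w : T2) : R := f (theta w.1) (theta w.2).

Definition integralC (mu : {measure set T2 -> \bar R}) (f : T2 -> R[i]) : R[i] :=
  Rintegral mu setT (fun w => complex.Re (f w))
    +i* Rintegral mu setT (fun w => complex.Im (f w)).

Section JointSpectralMeasure.
Variables (gT : finGroupType) (Gam : {group gT}) (iota : G2_embedding R Gam).

Definition D12_invariant (mu : probability T2 R) : Prop :=
  forall g, D12 g -> forall A, measurable A -> mu (torus_act g @^-1` A) = mu A.

Definition has_spectral_moments (mu : probability T2 R) : Prop :=
  forall m n : nat,
    integralC mu (fun w => chi1 w ^+ m * chi2 w ^+ n) = mckay_moment iota m n
    /\ mckay_moment iota m n = class_moment iota m n.

Definition joint_spectral_measure (mu : probability T2 R) : Prop :=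
  [/\ D12_invariant mu, has_spectral_moments mu
    & forall nu : probability T2 R, D12_invariant nu ->
        has_spectral_moments nu -> forall A, measurable A -> nu A = mu A].
End JointSpectralMeasure.

End Measures.

(* Main.v *)
From Stdlib Require Import ZArith FMapPositive.
Require Import Defs.
From HB Require Import structures.
From mathcomp Require Import all_boot all_order all_algebra all_fingroup.
From mathcomp Require Import all_solvable all_field all_character.
From mathcomp Require Import complex.
From mathcomp Require Import all_classical all_reals all_analysis.
From mathcomp Require Import measurable_realfun.
From mathcomp Require Import ring lra zify ssrZ.

(** An element of a compact group is determined up to conjugacy by its point in the
    maximal torus modulo the Weyl group, and for G2 the two fundamental
    characters separate the points of this quotient. So the joint spectral
    measure is the law of a random element of Gamma, seen through the pair of
    traces (chi1, chi2) and spread evenly over Weyl group orbits. The proof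
    determines these traces, exhibits the measure, and checks the formula and
    the uniqueness.

    Traces. Let V be the representation of G2 on R^7 and p_k the trace of g^k.
    The invariant 3-form gives an isomorphism between the third exterior power
    of V and the sum of S^2 V and V, hence the relation
      p_1^3 - 3 p_1 p_2 + 2 p_3 = 3 p_1^2 + 3 p_2 + 6 p_1
    of G2_trace_cube. The second exterior power is the sum of V and the Lie
    algebra, which gives the trace of rho2 (mxtrace_rho2). The group Gamma is
    identified with a list of 6048 explicit matrices of SU(3,3) over F_9
    (PU33_model), and its elements are sorted, up to conjugation and inversion,
    into ten classes. For each class, the trace on V is forced by the cubic
    relation and by the integrality of the dimensions of fixed spaces of
    subgroups (rep_traces). In particular the traces are the same for every
    embedding.

    Moments. The columns of the character table are joint eigenvectors of the
    McKay matrices, and their average is e_*. So both expressions for the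
    moments are averages over the group of tr7^m tr14^n (mckay_momentE,
    class_momentE).

    The measure. For each class there is a point of the torus with the right
    values of (chi1, chi2); its coordinates are 168-th roots of unity. The
    measure eps puts the proportion of each class uniformly on the orbit of its
    point. All terms of the formula are combinations of point masses at
    168-division points as well, and at the points concerned the functions J^2
    and K take values that are integers up to a power of pi. So the formula is
    an identity between integral combinations of finitely many points, settled
    by computation (formula_eps, joint_spectral_formula).

    Uniqueness. Let nu be invariant with the same moments. A nonnegative
    polynomial in (chi1, chi2) that vanishes exactly at the ten values has
    integral zero, so nu lives on the ten orbits, because (chi1, chi2) separates
    orbits (chi_separates_orbits). For invariant measures, the mass of any set
    is then the integral of an interpolation polynomial in chi1 and chi2, which
    the moments determine (measure_determined). *)

Set Implicit Arguments.
Unset Strict Implicit.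
Unset Printing Implicit Defensive.

Import Order.TTheory GRing.Theory Num.Theory.
Local Open Scope classical_set_scope.
Local Open Scope ring_scope.

(** * The structure constants of the cross product *)

(** By the cyclic symmetry of the multiplication table, the coefficient of e_k in
    the cross product of e_i and e_j depends on a = i - k and b = j - k only. It
    is an integer of Z, so that identities between tensors can be decided by
    computation and then transported by zr. *)
Definition s7 (a b : nat) : Z :=
  match a, b with
  | 1, 3 | 2, 6 | 4, 5 => Zpos 1
  | 3, 1 | 6, 2 | 5, 4 => Zneg 1
  | _, _ => Z0 end%N.
Definition ctab : seq (seq (seq Z)) := Eval vm_compute in
  [seq [seq [seq s7 ((i + 7 - k) %% 7) ((j + 7 - k) %% 7) | k <- iota 0 7]
       | j <- iota 0 7] | i <- iota 0 7].
Definition cT (i j k : nat) : Z := nth Z0 (nth [::] (nth [::] ctab i) j) k.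

Section ZR.
Variable R : realType.
(** The bridge between computed integers and the real field. *)
Definition zr (z : Z) : R := (int_of_Z z)%:~R.
Lemma zrE z : zr z = (int_of_Z z)%:~R.
Proof. by []. Qed.
Lemma zrD a b : zr (Z.add a b) = zr a + zr b.
Proof. by rewrite /zr -intrD -rmorphD. Qed.
Lemma zrM a b : zr (Z.mul a b) = zr a * zr b.
Proof. by rewrite /zr -intrM -rmorphM. Qed.
Lemma zrN a : zr (Z.opp a) = - zr a.
Proof. by rewrite /zr -intrN -rmorphN. Qed.
Definition cR (i j k : 'I_7) : R := zr (cT i j k).
Lemma crossE (x y : 'rV[R]_7) k :
  cross x y 0 k = \sum_i \sum_j cR i j k * x 0 i * y 0 j.
Proof.
pose X n := x 0 (inord n : 'I_7); pose Y n := y 0 (inord n : 'I_7).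
have xE i : x 0 i = X i by rewrite /X inord_val.
have yE i : y 0 i = Y i by rewrite /Y inord_val.
have -> : \sum_i \sum_j cR i j k * x 0 i * y 0 j =
   \sum_(i <- iota 0 7) \sum_(j <- iota 0 7) zr (cT i j k) * X i * Y j.
  transitivity (\sum_(i < 7) \sum_(j < 7) zr (cT i j k) * X i * Y j).
    by apply: eq_bigr => i _; apply: eq_bigr => j _; rewrite xE yE.
  rewrite -(big_mkord xpredT (fun i => \sum_(j < 7) zr (cT i j k) * X i * Y j)).
  by apply: eq_bigr => i _; rewrite -(big_mkord xpredT (fun j => zr (cT i j k) * X i * Y j)).
rewrite mxE !xE !yE.
have zr0 : zr Z0 = 0 by []; have zr1 : zr (Zpos 1) = 1 by [].
have zrN1 : zr (Zneg 1) = -1 by [].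
case: k => -[|[|[|[|[|[|[|k]]]]]]] //= _; rewrite !big_cons !big_nil /cT /= zr0 zr1 zrN1;
  ring.
Qed.
End ZR.

(** * Invariant maps between bilinear forms and trilinear forms *)

Definition zsum T (r : seq T) (f : T -> Z) : Z :=
  foldr (fun x s => Z.add (f x) s) Z0 r.
(** Only the nonzero coefficients are kept, so that the contractions below cost
    time proportional to the support of the sparse tensors c, D and E. *)
Definition sparse T (r : seq T) (D : T -> Z) : seq (T * Z) :=
  [seq t <- [seq (x, D x) | x <- r] | ~~ Z.eqb t.2 Z0].
Definition dot T (r : seq (T * Z)) (f : T -> Z) : Z :=
  zsum r (fun t => Z.mul t.2 (f t.1)).
Definition I2 : seq (nat * nat) := [seq (p, q) | p <- iota 0 7, q <- iota 0 7].
Definition I3 : seq (nat * nat * nat) := [seq (p, q) | p <- I2, q <- iota 0 7].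

Definition dT (i j : nat) : Z := if eqn i j then Zpos 1 else Z0.
(** ET and DT are the coefficients of two G2-equivariant maps, E from alternating
    3-tensors to 2-tensors and D from 2-tensors to alternating 3-tensors. They
    realise the decomposition of the third exterior power of V = R^7 as the sum
    of S^2 V and V: D E is 6 times the antisymmetrisation altT, and E D = QT is
    36 times the projection of 2-tensors onto S^2 V + V. *)
Definition ET (p q l m n : nat) : Z :=
  Z.add (if eqn p l then cT q m n else Z0)
    (Z.add (if eqn p m then cT q n l else Z0)
           (if eqn p n then cT q l m else Z0)).
Definition D0 (i j k p q : nat) : Z :=
  Z.add (if eqn i p then Z.mul (Zpos 2) (cT q j k) else Z0)
        (if eqn i q then cT p j k else Z0).
Definition DT (i j k p q : nat) : Z :=
  Z.add (Z.add (D0 i j k p q) (Z.add (D0 j k i p q) (D0 k i j p q)))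
        (if eqn p q then Z.opp (cT i j k) else Z0).
Definition altT (i j k l m n : nat) : Z :=
  let t a b c := (if eqn i a then if eqn j b then if eqn k c then Zpos 1
    else Z0 else Z0 else Z0) in
  Z.sub (Z.add (t l m n) (Z.add (t m n l) (t n l m)))
        (Z.add (t m l n) (Z.add (t l n m) (t n m l))).
Definition QT (p q r s : nat) : Z :=
  Z.add (Z.mul (Zpos 18) (Z.add (if eqn p r then dT q s else Z0)
                         (if eqn p s then dT q r else Z0)))
        (Z.mul (Zpos 6) (zsum (iota 0 7) (fun b => Z.mul (cT p q b) (cT r s b)))).

(** The cyclic symmetry of c allows the first index to be 0, which divides the
    number of cases by 7. *)
Lemma DE_check :
  all (fun jk : nat * nat =>
    let row := sparse I2 (fun x => DT 0 jk.1 jk.2 x.1 x.2) in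
    all (fun l : nat * nat * nat =>
      Z.eqb (dot row (fun x => ET x.1 x.2 l.1.1 l.1.2 l.2))
            (Z.mul (Zpos 6) (altT 0 jk.1 jk.2 l.1.1 l.1.2 l.2))) I3) I2.
Proof. by vm_compute. Qed.
Lemma ED_check :
  all (fun pq : nat * nat =>
    let row := sparse I3 (fun x => ET pq.1 pq.2 x.1.1 x.1.2 x.2) in
    all (fun rs : nat * nat =>
      Z.eqb (dot row (fun x => DT x.1.1 x.1.2 x.2 rs.1 rs.2))
            (QT pq.1 pq.2 rs.1 rs.2)) I2) I2.
Proof. by vm_compute. Qed.
Lemma shift_check :
  all (fun l : nat * nat * nat => Z.eqb (cT (l.1.1.+1 %% 7) (l.1.2.+1 %% 7) (l.2.+1 %% 7))
                                  (cT l.1.1 l.1.2 l.2)) I3.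
Proof. by vm_compute. Qed.
Lemma cyc_check :
  all (fun l : nat * nat * nat => Z.eqb (cT l.1.1 l.1.2 l.2) (cT l.1.2 l.2 l.1.1) &&
     Z.eqb (cT l.1.1 l.1.2 l.2) (Z.opp (cT l.1.2 l.1.1 l.2))) I3.
Proof. by vm_compute. Qed.
Lemma cc_check :
  all (fun l : nat * nat => Z.eqb (zsum I2 (fun x => Z.mul (cT x.1 x.2 l.1) (cT x.1 x.2 l.2)))
     (Z.mul (Zpos 6) (dT l.1 l.2))) I2.
Proof. by vm_compute. Qed.

Section Tensors.
Variable R : realType.
Local Notation zr := (@zr R).

Lemma zr0 : zr Z0 = 0. Proof. by []. Qed.
Lemma zr1 : zr (Zpos 1) = 1. Proof. by []. Qed.

Lemma zr_zsum T (r : seq T) f : zr (zsum r f) = \sum_(x <- r) zr (f x).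
Proof.
elim: r => [|x r IH]; first by rewrite big_nil.
by rewrite big_cons -IH /zsum /= zrD.
Qed.

Lemma zr_dot T (r : seq T) D f :
  zr (dot (sparse r D) f) = \sum_(x <- r) zr (D x) * zr (f x).
Proof.
rewrite /dot zr_zsum /sparse big_filter big_map [RHS](bigID (fun x => ~~ Z.eqb (D x) Z0)) /=.
rewrite [X in _ + X]big1 ?addr0 => [|x]; last by rewrite negbK => /Z.eqb_eq ->; rewrite zr0 mul0r.
by apply: eq_bigr => x _; rewrite zrM.
Qed.

Lemma sum_ord7 (F : nat -> R) : \sum_(p < 7) F p = \sum_(p <- iota 0 7) F p.
Proof. by rewrite -(big_mkord xpredT). Qed.

Lemma sum_I2 (F : nat -> nat -> R) :
  \sum_(p < 7) \sum_(q < 7) F p q = \sum_(x <- I2) F x.1 x.2.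
Proof.
rewrite /I2 big_allpairs /= (sum_ord7 (fun p => \sum_(q < 7) F p q)).
by apply: eq_bigr => p _; rewrite sum_ord7.
Qed.

Lemma sum_I3 (F : nat -> nat -> nat -> R) :
  \sum_(p < 7) \sum_(q < 7) \sum_(s < 7) F p q s = \sum_(x <- I3) F x.1.1 x.1.2 x.2.
Proof.
rewrite /I3 big_allpairs /= (sum_I2 (fun p q => \sum_(s < 7) F p q s)).
by apply: eq_bigr => p _; rewrite sum_ord7.
Qed.

Lemma I2_mem (i j : 'I_7) : (nat_of_ord i, nat_of_ord j) \in I2.
Proof. by apply/allpairs_f; rewrite mem_iota /= ltn_ord. Qed.
Lemma I3_mem (i j k : 'I_7) : (nat_of_ord i, nat_of_ord j, nat_of_ord k) \in I3.
Proof. by apply/allpairs_f; [exact: I2_mem|rewrite mem_iota /= ltn_ord]. Qed.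

Definition ER p q l m n : R := zr (ET p q l m n).
Definition DR i j k p q : R := zr (DT i j k p q).
Definition altR i j k l m n : R := zr (altT i j k l m n).
Definition QR p q r s : R := zr (QT p q r s).
Local Notation dl i j := ((i == j)%:R : R).
Local Notation c := (cR R).

Lemma cR_cyc i j k : c i j k = c j k i.
Proof.
have /allP /(_ _ (I3_mem i j k)) /= /andP[/Z.eqb_eq h _] := cyc_check.
by rewrite /cR h.
Qed.
Lemma cR_anti i j k : c i j k = - c j i k.
Proof.
have /allP /(_ _ (I3_mem i j k)) /= /andP[_ /Z.eqb_eq h] := cyc_check.
by rewrite /cR h zrN.
Qed.
Lemma cR_contract k l : \sum_i \sum_j c i j k * c i j l = 6 * dl k l.
Proof.
have h : zsum I2 (fun x => Z.mul (cT x.1 x.2 k) (cT x.1 x.2 l)) =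
    Z.mul (Zpos 6) (dT k l).
  by apply/Z.eqb_eq; exact: (allP cc_check _ (I2_mem k l)).
have -> : dl k l = zr (dT k l).
  by rewrite /dT -[eqn _ _]/(k == l); case: (k == l).
have -> : (6 : R) = zr (Zpos 6) by rewrite /zr; ring.
rewrite -zrM -h zr_zsum -(sum_I2 (fun a b => zr (Z.mul (cT a b k) (cT a b l)))).
by apply: eq_bigr => i _; apply: eq_bigr => j _; rewrite zrM.
Qed.

Lemma ER_E (p q l m n : 'I_7) :
  ER p q l m n = dl p l * c q m n + dl p m * c q n l + dl p n * c q l m.
Proof.
rewrite /ER /ET !zrD -![eqn _ _]/(_ == _ :> 'I_7) addrA.
by congr (_ + _ + _); case: ifP; rewrite ?mul1r ?mul0r.
Qed.

Lemma altR_E (i j k l m n : 'I_7) :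
  let t a b e := dl i a * dl j b * dl k e in
  altR i j k l m n = (t l m n + (t m n l + t n l m)) - (t m l n + (t l n m + t n m l)).
Proof.
rewrite /altR /altT /= /Z.sub zrD zrN !zrD -![eqn _ _]/(_ == _ :> 'I_7).
by congr (_ + (_ + _) - (_ + (_ + _)));
  do 3 (case: ifP => _; rewrite ?mul1r ?mul0r ?mulr0 ?mulr1 //).
Qed.

Lemma DR_E (i j k p q : 'I_7) :
  let t a b e := 2 * (dl a p * c q b e) + dl a q * c p b e in
  DR i j k p q = t i j k + t j k i + t k i j - dl p q * c i j k.
Proof.
have D0E (a b e : 'I_7) :
    zr (D0 a b e p q) = 2 * (dl a p * c q b e) + dl a q * c p b e.
  rewrite /D0 zrD -![eqn _ _]/(_ == _ :> 'I_7); congr (_ + _); case: ifP => _;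
    rewrite ?mul1r ?mul0r ?mulr0 // zrM /=; congr (_ * _); rewrite /zr; ring.
rewrite /DR /DT (zrD _ (Z.add _ _)) (zrD _ (D0 i j k p q)).
rewrite (zrD _ (D0 j k i p q)) !D0E /= -[eqn _ _]/(p == q) -!addrA; do !congr (_ + _).
by case: (p == q); rewrite ?mul1r ?mul0r ?oppr0 ?zrN.
Qed.

Lemma QR_E (p q r s : 'I_7) :
  QR p q r s = 18 * (dl p r * dl q s + dl p s * dl q r)
               + 6 * \sum_b c p q b * c r s b.
Proof.
have z n : zr (Zpos n) = (Pos.to_nat n)%:R by rewrite /zr /=.
have -> : \sum_b c p q b * c r s b =
    zr (zsum (iota 0 7) (fun b => Z.mul (cT p q b) (cT r s b))).
  rewrite zr_zsum -sum_ord7; by apply: eq_bigr => b _; rewrite zrM.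
rewrite /QR /QT zrD !zrM !z !zrD -![eqn _ _]/(_ == _ :> 'I_7) /dT.
rewrite -![eqn _ _]/(_ == _ :> 'I_7).
congr (_ * (_ + _) + _); by do 2 (case: ifP => _; rewrite ?mul1r ?mul0r ?mulr0 ?mulr1 //).
Qed.

Lemma cR_shift i j k s : c (i + s) (j + s) (k + s) = c i j k.
Proof.
have h1 a b e : c (a + 1) (b + 1) (e + 1) = c a b e.
  have /allP /(_ _ (I3_mem a b e)) /= /Z.eqb_eq h := shift_check.
  rewrite /cR -h; congr (zr (cT _ _ _)); by rewrite /= addn1.
have -> : s = (nat_of_ord s)%:R by rewrite natr_Zp.
elim: (nat_of_ord s) => [|n IH]; first by rewrite !addr0.
by rewrite -natr1 !addrA h1.
Qed.
End Tensors.

Section TensorIdentities.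
Variable R : realType.
Local Notation dl i j := ((i == j)%:R : R).
Local Notation c := (cR R).

Lemma sum_dl (T : finType) (F : T -> R) i : \sum_j (i == j)%:R * F j = F i.
Proof.
rewrite (bigD1 i) //= eqxx mul1r big1 ?addr0 // => j.
by rewrite eq_sym => /negbTE ->; rewrite mul0r.
Qed.

Lemma sum_dl' (T : finType) (F : T -> R) i : \sum_j (j == i)%:R * F j = F i.
Proof. by rewrite -[RHS]sum_dl; apply: eq_bigr => j _; rewrite eq_sym. Qed.

Lemma sum_shift (F : 'I_7 -> R) s : \sum_j F (j + s) = \sum_j F j.
Proof. by rewrite [RHS](reindex_inj (addIr s)). Qed.

(** Translating all indices by -i reduces to the case i = 0, which is DE_check. *)
Lemma sum_DE (i j k l m n : 'I_7) :
  \sum_(p < 7) \sum_(q < 7) DR R i j k p q * ER R p q l m n = 6 * altR R i j k l m n.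
Proof.
wlog: i j k l m n / i = 0 => [wl|i0].
  have := wl (i - i) (j - i) (k - i) (l - i) (m - i) (n - i) (subrr i).
  have shc a b e : c (a - i) (b - i) (e - i) = c a b e.
    by rewrite -(cR_shift _ a b e (- i)).
  have shE a b : (a - i == b - i) = (a == b) by rewrite (inj_eq (addIr _)).
  rewrite !altR_E !shE => <-.
  rewrite -[RHS](sum_shift _ (- i)); apply: eq_bigr => p _.
  rewrite -[RHS](sum_shift _ (- i)); apply: eq_bigr => q _.
  by rewrite !DR_E !ER_E !shE !shc.
rewrite {}i0 (sum_I2 (fun p q : nat => zr R (DT 0%N j k p q) * zr R (ET p q l m n))).
have h : dot (sparse I2 (fun x => DT 0%N j k x.1 x.2)) (fun x => ET x.1 x.2 l m n)
   = Z.mul (Zpos 6) (altT 0%N j k l m n).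
  by apply/Z.eqb_eq; exact: (allP (allP DE_check _ (I2_mem j k)) _ (I3_mem l m n)).
have -> : (6 : R) = zr R (Zpos 6) by rewrite /zr; ring.
by rewrite -zrM -h zr_dot.
Qed.

Lemma sum_ED (p q r s : 'I_7) :
  \sum_(l < 7) \sum_(m < 7) \sum_(n < 7) ER R p q l m n * DR R l m n r s = QR R p q r s.
Proof.
rewrite (sum_I3 (fun l m n : nat => zr R (ET p q l m n) * zr R (DT l m n r s))).
have h : dot (sparse I3 (fun x => ET p q x.1.1 x.1.2 x.2))
     (fun x => DT x.1.1 x.1.2 x.2 r s) = QT p q r s.
  by apply/Z.eqb_eq; exact: (allP (allP ED_check _ (I2_mem p q)) _ (I2_mem r s)).
by rewrite /QR -h zr_dot.
Qed.

Section Equivariance.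
Variable g : 'M[R]_7.
Hypothesis gorth : forall a b, \sum_i g i a * g i b = dl a b.
Hypothesis gorth' : forall a b, \sum_i g a i * g b i = dl a b.
Hypothesis gcross : forall i j l,
  \sum_k c i j k * g k l = \sum_a \sum_b g i a * g j b * c a b l.

(** The action of g on 3-tensors. *)
Definition T3 (X : 'I_7 -> 'I_7 -> 'I_7 -> R) i j k :=
  \sum_a \sum_b \sum_e g i a * g j b * g k e * X a b e.

Lemma sum_rot3 (F : 'I_7 -> 'I_7 -> 'I_7 -> R) :
  \sum_a \sum_b \sum_e F a b e = \sum_e \sum_a \sum_b F a b e.
Proof.
by rewrite [RHS]exchange_big; apply: eq_bigr => a _; rewrite exchange_big.
Qed.

Lemma T3_rot X i j k : T3 (fun a b e => X b e a) i j k = T3 X j k i.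
Proof.
rewrite /T3 exchange_big; apply: eq_bigr => b _; rewrite exchange_big /=.
by apply: eq_bigr => e _; apply: eq_bigr => a _; ring.
Qed.

Lemma T3_lin x y X Y i j k :
  T3 (fun a b e => x * X a b e + y * Y a b e) i j k = x * T3 X i j k + y * T3 Y i j k.
Proof.
rewrite /T3 !mulr_sumr -big_split; apply: eq_bigr => a _.
rewrite !mulr_sumr -big_split; apply: eq_bigr => b _.
rewrite !mulr_sumr -big_split; apply: eq_bigr => e _ /=; ring.
Qed.

Lemma T3_delta p (F : 'I_7 -> 'I_7 -> R) i j k :
  T3 (fun a b e => dl a p * F b e) i j k = g i p * \sum_b \sum_e g j b * g k e * F b e.
Proof.
rewrite /T3 -(sum_dl' (fun a => g i a * _)); apply: eq_bigr => a _.
rewrite !mulr_sumr; apply: eq_bigr => b _; rewrite !mulr_sumr.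
by apply: eq_bigr => e _; ring.
Qed.

Lemma T3_c i j k : T3 c i j k = c i j k.
Proof.
transitivity (\sum_e (\sum_a \sum_b g i a * g j b * c a b e) * g k e).
  rewrite /T3 sum_rot3; apply: eq_bigr => e _; rewrite mulr_suml.
  apply: eq_bigr => a _; rewrite mulr_suml; apply: eq_bigr => b _; ring.
under eq_bigr => e _ do rewrite -gcross mulr_suml.
rewrite exchange_big /= -[RHS](sum_dl (fun m => c i j m) k).
apply: eq_bigr => m _; rewrite eq_sym -gorth' mulr_suml.
by apply: eq_bigr => e _; ring.
Qed.

Lemma gcross' q j k : \sum_b \sum_e g j b * g k e * c q b e = \sum_s c s j k * g s q.
Proof.
under [RHS]eq_bigr => s _ do rewrite cR_cyc.
by rewrite gcross; apply: eq_bigr => b _; apply: eq_bigr => e _; rewrite cR_cyc.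
Qed.

(** D is built from Kronecker deltas and from c only, and g preserves both: gcross
    moves g across c, and orthogonality moves it across delta. *)
Lemma DR_equivariant (i j k p q : 'I_7) :
  \sum_(a < 7) \sum_(b < 7) \sum_(e < 7) g i a * g j b * g k e * DR R a b e p q =
  \sum_(r < 7) \sum_(s < 7) DR R i j k r s * (g r p * g s q).
Proof.
pose X a b e := 2 * (dl a p * c q b e) + 1 * (dl a q * c p b e).
have XE a b e : T3 X a b e = 2 * (g a p * \sum_s c s b e * g s q)
                           + g a q * \sum_s c s b e * g s p.
  by rewrite T3_lin !T3_delta !gcross' mul1r.
transitivity (T3 X i j k + T3 X j k i + T3 X k i j - dl p q * c i j k).
  have e1 := T3_rot X i j k.
  have e2 : T3 (fun a b e => X e a b) i j k = T3 X k i j :=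
    etrans (T3_rot (fun a b e => X b e a) i j k) (T3_rot X j k i).
  transitivity (T3 (fun a b e => 1 * (1 * (1 * X a b e + 1 * X b e a) +
      1 * X e a b) + (- dl p q) * c a b e) i j k).
    by apply: eq_bigr => a _; apply: eq_bigr => b _; apply: eq_bigr => e _;
       rewrite DR_E /X; ring.
  by rewrite (T3_lin 1) (T3_lin 1 1) (T3_lin 1 1) e1 e2 T3_c; ring.
pose Y a b e (r s : 'I_7) := 2 * (dl a r * c s b e) + dl a s * c r b e.
have YE a b e : \sum_r \sum_s Y a b e r s * (g r p * g s q) = T3 X a b e.
  rewrite XE mulrA.
  transitivity (\sum_r (dl a r * (2 * (g r p * (\sum_s c s b e * g s q))) +
      c r b e * g r p * g a q)).
    apply: eq_bigr => r _; rewrite !mulr_sumr.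
    rewrite -[X in _ + X](sum_dl (fun s => c r b e * g r p * g s q)) -big_split.
    by apply: eq_bigr => s _; rewrite /Y /=; ring.
  by rewrite big_split /= sum_dl -mulr_suml; ring.
rewrite -!YE -[_ * c i j k](_ : \sum_r \sum_s dl r s * c i j k * (g r p * g s q) = _).
  rewrite -!big_split -sumrB; apply: eq_bigr => r _.
  rewrite -!big_split -sumrB; apply: eq_bigr => s _ /=.
  by rewrite DR_E /Y; ring.
rewrite -gorth mulr_suml; apply: eq_bigr => r _.
transitivity (\sum_s dl r s * (c i j k * (g r p * g s q))).
  by apply: eq_bigr => s _; ring.
by rewrite sum_dl; ring.
Qed.
End Equivariance.
End TensorIdentities.

(** * Elements of G2: orthogonality and a relation between traces *)

Section SumExchange.
Variable R : realType.

Lemma exch12 (I J K : finType) (F : I -> J -> K -> R) :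
  \sum_k \sum_p \sum_q F k p q = \sum_p \sum_q \sum_k F k p q.
Proof. by rewrite exchange_big; apply: eq_bigr => p _; rewrite exchange_big. Qed.

Lemma exch32 (I J K L M : finType) (F : I -> J -> K -> L -> M -> R) :
  \sum_i \sum_j \sum_k \sum_p \sum_q F i j k p q =
  \sum_p \sum_q \sum_i \sum_j \sum_k F i j k p q.
Proof.
rewrite -[RHS]exch12; apply: eq_bigr => i _; rewrite -[RHS]exch12; apply: eq_bigr => j _.
exact: exch12.
Qed.
End SumExchange.

Section G2Elements.
Variable R : realType.
Local Notation dl i j := ((i == j)%:R : R).
Local Notation c := (cR R).

Definition admx (x : 'rV[R]_7) : 'M[R]_7 := \matrix_(j, k) \sum_i c i j k * x 0 i.

Lemma mul_admx x z : z *m admx x = cross x z.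
Proof.
apply/rowP => k; rewrite crossE mxE exchange_big /=; apply: eq_bigr => j _.
by rewrite mxE mulr_sumr; apply: eq_bigr => i _; ring.
Qed.

Lemma exch22 (I J K L : finType) (F : I -> J -> K -> L -> R) :
  \sum_i \sum_j \sum_p \sum_q F i j p q =
  \sum_p \sum_q \sum_i \sum_j F i j p q.
Proof. by rewrite -[RHS]exch12; apply: eq_bigr => i _; exact: exch12. Qed.

(** The scalar product is a trace form of the cross product. Hence whatever
    preserves the cross product preserves the scalar product. *)
Lemma mxtrace_admx (x y : 'rV[R]_7) : \tr (admx x *m admx y) = - 6 * (x *m y^T) 0 0.
Proof.
transitivity (\sum_j \sum_k \sum_i \sum_m (- (x 0 i * y 0 m)) * (c j k i * c j k m)).
  apply: eq_bigr => j _; rewrite mxE; apply: eq_bigr => k _.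
  rewrite !mxE mulr_suml; apply: eq_bigr => i _.
  rewrite mulr_sumr; apply: eq_bigr => m _.
  by rewrite cR_cyc (cR_anti _ m k j) (cR_cyc _ k m j) (cR_cyc _ m j k); ring.
rewrite exch22 mxE mulr_sumr; apply: eq_bigr => i _.
transitivity (\sum_m (i == m)%:R * (- 6 * (x 0 i * y 0 m))); last by rewrite sum_dl mxE.
apply: eq_bigr => m _.
under eq_bigr => j _ do rewrite -mulr_sumr.
by rewrite -mulr_sumr cR_contract; ring.
Qed.

Lemma dot_inj (A : 'M[R]_7) (B : 'M[R]_7) :
  (forall x y : 'rV[R]_7, (x *m A *m y^T) 0 0 = (x *m B *m y^T) 0 0) -> A = B.
Proof.
move=> h; apply/matrixP => i j; have := h (delta_mx 0 i) (delta_mx 0 j).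
by rewrite -!rowE !trmx_delta -!colE !mxE.
Qed.

Section Element.
Variables (g : 'M[R]_7) (Gg : G2 g).

Let ug : g \in unitmx := proj1 Gg.

Lemma admx_conj x : g *m admx (x *m g) = admx x *m g.
Proof.
apply/row_matrixP => i; rewrite !rowE !mulmxA !mul_admx.
by rewrite (proj2 Gg).
Qed.

Lemma G2_orthogonal : g *m g^T = 1%:M.
Proof.
apply: dot_inj => x y.
have -> : x *m (g *m g^T) *m y^T = (x *m g) *m (y *m g)^T by rewrite trmx_mul !mulmxA.
rewrite mulmx1; apply: (@mulfI _ (- 6)); first by rewrite oppr_eq0 pnatr_eq0.
rewrite -!mxtrace_admx.
have e z : admx (z *m g) = invmx g *m admx z *m g.
  by rewrite -mulmxA -admx_conj mulKmx.
rewrite !e -!mulmxA (mulKVmx ug) mxtrace_mulC -!mulmxA (mulmxV ug) mulmx1 //.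
Qed.

Lemma G2_orthogonal_tr : g^T *m g = 1%:M.
Proof. exact: (mulmx1C G2_orthogonal). Qed.

Lemma G2_invmx : invmx g = g^T.
Proof. by rewrite -[LHS]mulmx1 -G2_orthogonal mulKmx. Qed.

Lemma G2_sum_rows a b : \sum_i g a i * g b i = dl a b.
Proof.
have := congr1 (fun A : 'M[R]_7 => A a b) G2_orthogonal; rewrite !mxE => <-.
by apply: eq_bigr => i _; rewrite mxE.
Qed.
Lemma G2_sum_cols a b : \sum_i g i a * g i b = dl a b.
Proof.
have := congr1 (fun A : 'M[R]_7 => A a b) G2_orthogonal_tr; rewrite !mxE => <-.
by apply: eq_bigr => i _; rewrite mxE.
Qed.

Lemma cross_delta i j k : cross (delta_mx 0 i) (delta_mx 0 j) 0 k = c i j k.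
Proof.
rewrite crossE -[RHS](sum_dl (fun i => c i j k)); apply: eq_bigr => a _.
rewrite -(sum_dl (fun j => _ * c a j k)); apply: eq_bigr => b _.
by rewrite !mxE !eqxx (eq_sym i) (eq_sym j) /=; ring.
Qed.

Lemma G2_cross i j l :
  \sum_k c i j k * g k l = \sum_a \sum_b g i a * g j b * c a b l.
Proof.
have := congr1 (fun A : 'rV[R]_7 => A 0 l) (proj2 Gg (delta_mx 0 i) (delta_mx 0 j)).
rewrite mxE; under eq_bigr => k _ do rewrite cross_delta.
move=> ->; rewrite -!rowE crossE; apply: eq_bigr => a _; apply: eq_bigr => b _.
by rewrite !mxE; ring.
Qed.

Lemma sum_mul2 (A B : 'M[R]_7) : \sum_p \sum_q A p q * B q p = \tr (A *m B).
Proof. by apply: eq_bigr => p _; rewrite mxE. Qed.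

(** The trace of g on the sum of S^2 V and V, multiplied by 36. *)
Lemma trace_gg_QR :
  \sum_(p < 7) \sum_(q < 7) \sum_(r < 7) \sum_(s < 7) (g r p * g s q) * QR R p q r s
  = 18 * (\tr g ^+ 2 + \tr (g *m g)) + 36 * \tr g.
Proof.
transitivity (18 * \sum_(p < 7) \sum_(q < 7) (g p p * g q q + g q p * g p q) +
   6 * \sum_(r < 7) \sum_(s < 7) \sum_b c r s b * \sum_(k < 7) c r s k * g k b).
  transitivity (18 * \sum_(p < 7) \sum_(q < 7) \sum_(r < 7) \sum_(s < 7)
         (dl p r * (dl q s * (g r p * g s q)) + dl q r * (dl p s * (g r p * g s q)))
     + 6 * \sum_(p < 7) \sum_(q < 7) \sum_(r < 7) \sum_(s < 7)
         (g r p * g s q) * \sum_b c p q b * c r s b).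
    rewrite !mulr_sumr -big_split; apply: eq_bigr => p _.
    rewrite !mulr_sumr -big_split; apply: eq_bigr => q _.
    rewrite !mulr_sumr -big_split; apply: eq_bigr => r _.
    rewrite !mulr_sumr -big_split; apply: eq_bigr => s _ /=.
    by rewrite QR_E; ring.
  congr (_ * _ + _ * _).
    apply: eq_bigr => p _; apply: eq_bigr => q _.
    under eq_bigr => r _ do rewrite big_split /= -!mulr_sumr.
    by rewrite big_split /= !sum_dl.
  rewrite exch22; apply: eq_bigr => r _; apply: eq_bigr => s _.
  transitivity (\sum_p \sum_q \sum_b c r s b * (g r p * g s q * c p q b)).
    apply: eq_bigr => p _; apply: eq_bigr => q _; rewrite mulr_sumr.
    by apply: eq_bigr => b _; ring.
  rewrite -exch12; apply: eq_bigr => b _; rewrite G2_cross mulr_sumr.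
  by apply: eq_bigr => p _; rewrite mulr_sumr.
congr (_ * _ + _).
  under eq_bigr => p _ do rewrite big_split /= -mulr_sumr.
  rewrite big_split /= -mulr_suml expr2; congr (_ + _).
  by rewrite exchange_big sum_mul2.
transitivity (6 * \sum_b \sum_k g k b * \sum_(r < 7) \sum_(s < 7) c r s b * c r s k).
  congr (_ * _).
  transitivity (\sum_(r < 7) \sum_(s < 7) \sum_b \sum_k g k b * (c r s b * c r s k)).
    apply: eq_bigr => r _; apply: eq_bigr => s _; apply: eq_bigr => b _.
    by rewrite mulr_sumr; apply: eq_bigr => k _; ring.
  rewrite exch22; apply: eq_bigr => b _; apply: eq_bigr => k _; rewrite mulr_sumr.
  by apply: eq_bigr => r _; rewrite mulr_sumr.
rewrite (_ : 36 = 6 * 6); last by ring.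
rewrite -mulrA; congr (_ * _); rewrite /mxtrace mulr_sumr; apply: eq_bigr => b _.
transitivity (\sum_k dl b k * (6 * g k b)); last by rewrite sum_dl.
by apply: eq_bigr => k _; rewrite cR_contract; ring.
Qed.

(** Six times the trace of g on the third exterior power of V, by Newton's
    formula. *)
Lemma trace_ggg_alt :
  \sum_(i < 7) \sum_(j < 7) \sum_(k < 7) \sum_(a < 7) \sum_(b < 7) \sum_(e < 7)
     g i a * g j b * g k e * altR R a b e i j k
  = \tr g ^+ 3 - 3 * \tr g * \tr (g *m g) + 2 * \tr (g *m g *m g).
Proof.
have e (i j k x y z : 'I_7) : T3 g (fun a b d => dl a x * dl b y * dl d z) i j k
    = g i x * g j y * g k z.
  transitivity (T3 g (fun a b d => dl a x * (dl b y * dl d z)) i j k).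
    by apply: eq_bigr => ? _; apply: eq_bigr => ? _; apply: eq_bigr => ? _; rewrite -!mulrA.
  rewrite T3_delta -mulrA; congr (_ * _).
  transitivity (\sum_b \sum_d dl b y * (dl d z * (g j b * g k d))).
    by apply: eq_bigr => ? _; apply: eq_bigr => ? _; ring.
  under eq_bigr => b _ do rewrite -mulr_sumr.
  by rewrite sum_dl' sum_dl'.
transitivity (\sum_(i < 7) \sum_(j < 7) \sum_(k < 7)
  ((g i i * g j j * g k k + (g i j * g j k * g k i + g i k * g j i * g k j)) -
   (g i j * g j i * g k k + (g i i * g j k * g k j + g i k * g j j * g k i)))).
  apply: eq_bigr => i _; apply: eq_bigr => j _; apply: eq_bigr => k _.
  pose t (x y z a b d : 'I_7) := dl a x * dl b y * dl d z.
  transitivity (T3 g (fun a b d => 1 * (1 * t i j k a b d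
      + 1 * (1 * t j k i a b d + 1 * t k i j a b d))
      + (-1) * (1 * t j i k a b d + 1 * (1 * t i k j a b d + 1 * t k j i a b d))) i j k).
    by apply: eq_bigr => ? _; apply: eq_bigr => ? _; apply: eq_bigr => ? _; rewrite altR_E /t; ring.
  by rewrite !(T3_lin g) !e; ring.
have S3 (A : 'M[R]_7) : \sum_(i < 7) \sum_(j < 7) \sum_(k < 7) A i j * g j k * g k i = \tr (A *m g *m g).
  rewrite -mulmxA -sum_mul2; apply: eq_bigr => i _; apply: eq_bigr => j _.
  by rewrite mxE mulr_sumr; apply: eq_bigr => k _; rewrite mulrA.
have e1 : \sum_(i < 7) \sum_(j < 7) \sum_(k < 7) g i i * g j j * g k k = \tr g ^+ 3.
  rewrite !exprS expr0 mulr1 {1}/mxtrace mulr_suml; apply: eq_bigr => i _.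
  rewrite {1}/mxtrace mulr_suml mulr_sumr; apply: eq_bigr => j _.
  by rewrite !mulr_sumr; apply: eq_bigr => k _; ring.
have e2 : \sum_(i < 7) \sum_(j < 7) \sum_(k < 7) g i j * g j i * g k k = \tr g * \tr (g *m g).
  rewrite mulrC -sum_mul2 mulr_suml; apply: eq_bigr => i _.
  rewrite mulr_suml; apply: eq_bigr => j _; by rewrite mulr_sumr.
pose S F := \sum_(i < 7) \sum_(j < 7) \sum_(k < 7) F i j k : R.
have SD F G : S (fun i j k => F i j k + G i j k) = S F + S G.
  rewrite /S -big_split; apply: eq_bigr => i _; rewrite -big_split.
  by apply: eq_bigr => j _; rewrite -big_split.
have SN F : S (fun i j k => - F i j k) = - S F.
  rewrite /S -sumrN; apply: eq_bigr => i _; rewrite -sumrN.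
  by apply: eq_bigr => j _; rewrite -sumrN.
have e3 : S (fun i j k => g i k * g j i * g k j) = \tr (g *m g *m g).
  rewrite -S3 /S; apply: eq_bigr => i _; rewrite exchange_big.
  by apply: eq_bigr => j _; apply: eq_bigr => k _ /=; ring.
have e4 : S (fun i j k => g i i * g j k * g k j) = \tr g * \tr (g *m g).
  rewrite /S -sum_mul2 mulr_suml; apply: eq_bigr => i _.
  rewrite mulr_sumr; apply: eq_bigr => j _; rewrite mulr_sumr.
  by apply: eq_bigr => k _; rewrite mulrA.
have e5 : S (fun i j k => g i k * g j j * g k i) = \tr g * \tr (g *m g).
  rewrite -e2 /S; apply: eq_bigr => i _; rewrite exchange_big.
  by apply: eq_bigr => j _; apply: eq_bigr => k _ /=; ring.
transitivity (S (fun i j k => g i i * g j j * g k k) +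
    (S (fun i j k => g i j * g j k * g k i) + S (fun i j k => g i k * g j i * g k j))
  - (S (fun i j k => g i j * g j i * g k k) + (S (fun i j k => g i i * g j k * g k j)
     + S (fun i j k => g i k * g j j * g k i)))).
  by rewrite -!SD -SN -SD.
rewrite e3 e4 e5 /S e1 e2 S3; ring.
Qed.

(** Both sides are six times the trace of g on the third exterior power of V. On
    the right it is computed on S^2 V + V, where the equivariant maps E and D
    identify the two spaces. *)
Lemma G2_trace_cube :
  \tr g ^+ 3 - 3 * \tr g * \tr (g *m g) + 2 * \tr (g *m g *m g)
  = 3 * \tr g ^+ 2 + 3 * \tr (g *m g) + 6 * \tr g.
Proof.
apply: (@mulfI _ 6); first by rewrite pnatr_eq0.
rewrite -trace_ggg_alt.
transitivity (\sum_(i < 7) \sum_(j < 7) \sum_(k < 7) \sum_(p < 7) \sum_(q < 7)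
   ER R p q i j k * \sum_(r < 7) \sum_(s < 7) DR R i j k r s * (g r p * g s q)).
  rewrite mulr_sumr; apply: eq_bigr => i _; rewrite mulr_sumr; apply: eq_bigr => j _.
  rewrite mulr_sumr; apply: eq_bigr => k _.
  transitivity (\sum_(p < 7) \sum_(q < 7) \sum_(a < 7) \sum_(b < 7) \sum_(e < 7)
     ER R p q i j k * (g i a * g j b * g k e * DR R a b e p q)).
    rewrite -exch32 mulr_sumr; apply: eq_bigr => a _; rewrite mulr_sumr; apply: eq_bigr => b _.
    rewrite mulr_sumr; apply: eq_bigr => e _; rewrite mulrCA -sum_DE mulr_sumr.
    apply: eq_bigr => p _; rewrite mulr_sumr; apply: eq_bigr => q _; ring.
  apply: eq_bigr => p _; apply: eq_bigr => q _.
  rewrite -(DR_equivariant G2_sum_cols G2_sum_rows G2_cross) !mulr_sumr.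
  apply: eq_bigr => a _; rewrite !mulr_sumr; apply: eq_bigr => b _.
  by rewrite mulr_sumr.
rewrite exch32.
transitivity (\sum_(p < 7) \sum_(q < 7) \sum_(r < 7) \sum_(s < 7) (g r p * g s q) * QR R p q r s);
  last by rewrite trace_gg_QR; ring.
apply: eq_bigr => p _; apply: eq_bigr => q _.
transitivity (\sum_(i < 7) \sum_(j < 7) \sum_(k < 7) \sum_(r < 7) \sum_(s < 7)
  (g r p * g s q) * (ER R p q i j k * DR R i j k r s)).
  do 3 (apply: eq_bigr => ? _); rewrite mulr_sumr; apply: eq_bigr => r _.
  by rewrite mulr_sumr; apply: eq_bigr => s _; ring.
rewrite exch32; apply: eq_bigr => r _; apply: eq_bigr => s _.
rewrite -sum_ED !mulr_sumr; apply: eq_bigr => i _; rewrite mulr_sumr; apply: eq_bigr => j _.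
by rewrite mulr_sumr.
Qed.
End Element.
End G2Elements.

(** * The trace of an element of G2 on the Lie algebra *)

(** P is a projection onto the row space of U; the matrix of A on the subspace U and
    the product P A have the same trace, by cyclicity. *)
Lemma mxtrace_in_submod (F : fieldType) n (U P A : 'M[F]_n) :
    (P <= U)%MS -> U *m P = U -> (U *m A <= U)%MS ->
  \tr (in_submod U (val_submod (1%:M : 'M[F]_(\rank U)) *m A)) = \tr (P *m A).
Proof.
move=> sPU UP sUA; set B := val_submod _.
have fixP m (W : 'M[F]_(m, n)) : (W <= U)%MS -> W *m P = W.
  by case/submxP => D ->; rewrite -mulmxA UP.
have BU : (B <= U)%MS by rewrite val_submod1.
have PE : P = P *m in_submod U 1%:M *m B.
  by rewrite -in_submodE -val_submodE in_submodK.
have -> : P *m A = (P *m in_submod U 1%:M) *m (B *m A) by rewrite mulmxA -PE.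
rewrite in_submodE [RHS]mxtrace_mulC [in RHS]mulmxA fixP //.
by rewrite (submx_trans (submxMr _ BU)).
Qed.

Lemma mxtrace_lin_mx (R : comNzRingType) m n (f : {linear 'M[R]_(m, n) -> 'M[R]_(m, n)}) :
  \tr (lin_mx f) = \sum_i \sum_j f (delta_mx i j) i j.
Proof.
rewrite /mxtrace (reindex _ (curry_mxvec_bij m n)) /= pair_bigA.
apply: eq_bigr => -[i j] _ /=.
have := congr1 (fun v : 'rV[R]_(m * n) => v 0 (mxvec_index i j)) (mul_vec_lin f (delta_mx i j)).
by rewrite mxvecE mxvec_delta -rowE mxE.
Qed.

Section Sum3.
Variable R : realType.
Definition sum3 (F : 'I_7 -> 'I_7 -> 'I_7 -> R) : R :=
  \sum_(i < 7) \sum_(j < 7) \sum_(k < 7) F i j k.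
Lemma sum3D F G : sum3 (fun i j k => F i j k + G i j k) = sum3 F + sum3 G.
Proof.
rewrite /sum3 -big_split; apply: eq_bigr => i _; rewrite -big_split.
by apply: eq_bigr => j _; rewrite -big_split.
Qed.
Lemma sum3N F : sum3 (fun i j k => - F i j k) = - sum3 F.
Proof.
rewrite /sum3 -sumrN; apply: eq_bigr => i _; rewrite -sumrN.
by apply: eq_bigr => j _; rewrite -sumrN.
Qed.
Lemma eq_sum3 F G : (forall i j k, F i j k = G i j k) -> sum3 F = sum3 G.
Proof. by move=> e; do 3 (apply: eq_bigr => ? _). Qed.
End Sum3.

Section TraceAdjoint.
Variable R : realType.
Local Notation dl i j := ((i == j)%:R : R).
Local Notation c := (cR R).

Definition Dmap (X : 'M[R]_7) (i j k : 'I_7) : R :=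
  \sum_(r < 7) \sum_(s < 7) DR R i j k r s * X r s.
(** The projection E D / 36 of the 7 x 7 matrices onto S^2 V + V, whose kernel is the
    Lie algebra. *)
Definition Qmap (X : 'M[R]_7) : 'M[R]_7 :=
  \matrix_(p, q) (36^-1 * \sum_(r < 7) \sum_(s < 7) QR R p q r s * X r s).

Fact Qmap_linear : linear Qmap.
Proof.
move=> a X Y; apply/matrixP => p q; rewrite !mxE !mulr_sumr -big_split.
apply: eq_bigr => r _; rewrite !mulr_sumr -big_split; apply: eq_bigr => s _.
by rewrite !mxE /=; ring.
Qed.
HB.instance Definition _ := GRing.isLinear.Build R _ _ _ Qmap Qmap_linear.

Lemma QmapE X p q : Qmap X p q = 36^-1 *
  \sum_(l < 7) \sum_(m < 7) \sum_(n < 7) ER R p q l m n * Dmap X l m n.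
Proof.
rewrite mxE; congr (_ * _).
transitivity (\sum_(r < 7) \sum_(s < 7) \sum_(l < 7) \sum_(m < 7) \sum_(n < 7)
   ER R p q l m n * (DR R l m n r s * X r s)).
  apply: eq_bigr => r _; apply: eq_bigr => s _; rewrite -sum_ED mulr_suml.
  apply: eq_bigr => l _; rewrite mulr_suml; apply: eq_bigr => m _.
  by rewrite mulr_suml; apply: eq_bigr => n _; rewrite mulrA.
rewrite -exch32; do 3 (apply: eq_bigr => ? _); rewrite /Dmap mulr_sumr.
by apply: eq_bigr => ? _; rewrite mulr_sumr.
Qed.

Lemma altR_DR (i j k a b : 'I_7) :
  \sum_(l < 7) \sum_(m < 7) \sum_(n < 7) altR R i j k l m n * DR R l m n a b =
  6 * DR R i j k a b.
Proof.
pose D (x y z : 'I_7) := DR R x y z a b.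
have anti' (x y z : 'I_7) : c x y z = - c x z y by rewrite cR_cyc cR_anti (cR_cyc _ x z y) (cR_cyc _ z y x).
have cyc x y z : D x y z = D y z x.
  by rewrite /D !DR_E (cR_cyc _ x y z); ring.
have anti x y z : D y x z = - D x y z.
  rewrite /D !DR_E (anti' b x z) (anti' a x z) (anti' b z y) (anti' a z y).
  by rewrite (anti' b y x) (anti' a y x) (cR_anti _ y x z); ring.
have e x y z : \sum_(l < 7) \sum_(m < 7) \sum_(n < 7)
    dl x l * (dl y m * (dl z n * D l m n)) = D x y z.
  transitivity (\sum_(l < 7) dl x l * \sum_(m < 7) dl y m * D l m z).
    apply: eq_bigr => l _; rewrite mulr_sumr; apply: eq_bigr => m _.
    by rewrite -!mulr_sumr sum_dl.
  by rewrite !sum_dl.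
have e' (l m n : 'I_7) : altR R i j k l m n * D l m n =
   (dl i l * (dl j m * (dl k n * D l m n)) +
   (dl k l * (dl i m * (dl j n * D l m n)) + dl j l * (dl k m * (dl i n * D l m n)))) +
   - (dl j l * (dl i m * (dl k n * D l m n)) +
   (dl i l * (dl k m * (dl j n * D l m n)) + dl k l * (dl j m * (dl i n * D l m n)))).
  by rewrite altR_E; ring.
rewrite -/(sum3 (fun l m n => altR R i j k l m n * D l m n)) (eq_sum3 e').
rewrite sum3D sum3N !sum3D /sum3 !e.
rewrite -/(D i j k) (cyc i k j) (cyc k j i) (anti i j k) (cyc j k i) (cyc k i j).
ring.
Qed.

Lemma Dmap_Qmap X i j k : Dmap (Qmap X) i j k = Dmap X i j k.
Proof.
transitivity (\sum_(r < 7) \sum_(s < 7) \sum_(l < 7) \sum_(m < 7) \sum_(n < 7)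
   36^-1 * (DR R i j k r s * ER R r s l m n) * Dmap X l m n).
  apply: eq_bigr => r _; apply: eq_bigr => s _; rewrite QmapE mulrCA mulr_sumr mulr_sumr.
  apply: eq_bigr => l _; rewrite !mulr_sumr; apply: eq_bigr => m _.
  by rewrite !mulr_sumr; apply: eq_bigr => n _; ring.
rewrite -exch32.
transitivity (\sum_(l < 7) \sum_(m < 7) \sum_(n < 7)
   6^-1 * (altR R i j k l m n * Dmap X l m n)).
  apply: eq_bigr => l _; apply: eq_bigr => m _; apply: eq_bigr => n _.
  move: (Dmap X l m n) => d.
  transitivity (36^-1 * (\sum_(r < 7) \sum_(s < 7) DR R i j k r s * ER R r s l m n)
      * d); last by rewrite sum_DE; field.
  rewrite mulr_sumr mulr_suml; apply: eq_bigr => r _.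
  by rewrite mulr_sumr mulr_suml.
transitivity (\sum_(r < 7) \sum_(s < 7) \sum_(l < 7) \sum_(m < 7) \sum_(n < 7)
   6^-1 * X r s * (altR R i j k l m n * DR R l m n r s)).
  rewrite -exch32; do 3 (apply: eq_bigr => ? _); rewrite /Dmap !mulr_sumr.
  by apply: eq_bigr => ? _; rewrite !mulr_sumr; apply: eq_bigr => ? _; ring.
apply: eq_bigr => r _; apply: eq_bigr => s _.
transitivity (6^-1 * X r s * (6 * DR R i j k r s)); last by field.
rewrite -altR_DR mulr_sumr; apply: eq_bigr => l _; rewrite mulr_sumr.
by apply: eq_bigr => m _; rewrite mulr_sumr.
Qed.

Lemma Qmap_form X p q : Qmap X p q = 2^-1 * (X p q + X q p)
  + 6^-1 * \sum_(b < 7) c p q b * \sum_(r < 7) \sum_(s < 7) c r s b * X r s.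
Proof.
rewrite mxE.
transitivity (36^-1 * (\sum_(r < 7) \sum_(s < 7) (dl p r * (dl q s * (18 * X r s)) +
   dl q r * (dl p s * (18 * X r s))) + 6 * \sum_(r < 7) \sum_(s < 7) \sum_(b < 7)
     c p q b * (c r s b * X r s))).
  congr (_ * _); rewrite mulr_sumr -big_split; apply: eq_bigr => r _.
  rewrite mulr_sumr -big_split; apply: eq_bigr => s _ /=.
  rewrite QR_E mulrDl; congr (_ + _); first by ring.
  by rewrite -mulrA mulr_suml; congr (_ * _); apply: eq_bigr => b _; rewrite mulrA.
rewrite mulrDr; congr (_ + _).
  under eq_bigr => r _ do rewrite big_split /= -!mulr_sumr !sum_dl.
  by rewrite big_split /= !sum_dl; field.
rewrite mulrA; congr (_ * _); first by field.
rewrite -exch12; apply: eq_bigr => b _; rewrite mulr_sumr; apply: eq_bigr => r _.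
by rewrite mulr_sumr.
Qed.

(** For antisymmetric X, the derivation property of X is exactly D X = 0. *)
Lemma leibniz_Dmap (X : 'M[R]_7) i j l : X^T = - X ->
  leibniz (delta_mx 0 i) (delta_mx 0 j) X 0 l = - Dmap X i j l.
Proof.
move=> aX; have {}aX a b : X b a = - X a b.
  by have := congr1 (fun M : 'M[R]_7 => M a b) aX; rewrite !mxE.
have trX : \tr X = 0.
  apply: (@mulfI _ 2); rewrite ?pnatr_eq0 // mulr0 mulr_natl mulr2n /mxtrace -big_split.
  by apply: big1 => a _ /=; rewrite {2}aX subrr.
have DE : Dmap X i j l =
    \sum_a (X i a * c a j l + X j a * c a l i + X l a * c a i j).
  have one x y z : \sum_(r < 7) \sum_(s < 7)
      (2 * (dl x r * c s y z) + dl x s * c r y z) * X r s = \sum_a X x a * c a y z.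
    transitivity (\sum_(r < 7) (dl x r * (\sum_s 2 * (c s y z * X r s)) + c r y z * X r x)).
      apply: eq_bigr => r _; rewrite -(sum_dl (fun s => c r y z * X r s)) mulr_sumr -big_split.
      by apply: eq_bigr => s _ /=; ring.
    rewrite big_split /= sum_dl -big_split; apply: eq_bigr => a _ /=.
    by rewrite (aX x a); ring.
  rewrite !big_split /= -!one /Dmap.
  transitivity (\sum_(r < 7) \sum_(s < 7)
     (((2 * (dl i r * c s j l) + dl i s * c r j l) * X r s +
      (2 * (dl j r * c s l i) + dl j s * c r l i) * X r s +
      (2 * (dl l r * c s i j) + dl l s * c r i j) * X r s) + dl r s * (- c i j l * X r s))).
    by apply: eq_bigr => r _; apply: eq_bigr => s _; rewrite DR_E; ring.
  under eq_bigr => r _ do rewrite big_split /= sum_dl.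
  rewrite big_split /= -mulr_sumr -/(\tr X) trX mulr0 addr0.
  by rewrite -!big_split; apply: eq_bigr => r _; rewrite -!big_split.
have subE (A B C : 'rV[R]_7) : (A - (B + C)) 0 l = A 0 l - (B 0 l + C 0 l) by rewrite !mxE.
rewrite DE /leibniz subE -sumrN.
transitivity (\sum_k c i j k * X k l - (\sum_a X i a * c a j l + \sum_a X j a * c i a l)).
  congr (_ - (_ + _)).
  - by rewrite mxE; apply: eq_bigr => k _; rewrite cross_delta.
  - by rewrite -rowE crossE; apply: eq_bigr => a _;
      rewrite -(sum_dl' (fun b => X i a * c a b l)); apply: eq_bigr => b _;
      rewrite !mxE eqxx; ring.
  - rewrite -rowE crossE exchange_big; apply: eq_bigr => a _.
    by rewrite -(sum_dl' (fun b => X j a * c b a l)); apply: eq_bigr => b _;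
      rewrite !mxE eqxx /=; ring.
rewrite -big_split -sumrB; apply: eq_bigr => a _ /=.
rewrite (aX l a) (cR_cyc _ i j a) (cR_cyc _ j a i) (cR_cyc _ i a l).
ring.
Qed.

(** Y - Q Y is antisymmetric by the explicit form of Q and killed by D, since
    D Q = D. *)
Lemma lieG2_compl_Qmap (Y : 'M[R]_7) : (mxvec (Y - Qmap Y) <= lieG2 R)%MS.
Proof.
set X := Y - Qmap Y.
have aX : X^T = - X.
  have subE (A B : 'M[R]_7) a b : (A - B) a b = A a b - B a b by rewrite !mxE.
  have oppE (A : 'M[R]_7) a b : (- A) a b = - A a b by rewrite mxE.
  have trE (A : 'M[R]_7) a b : A^T a b = A b a by rewrite mxE.
  apply/matrixP => p q; rewrite trE oppE !subE !Qmap_form.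
  under eq_bigr => b _ do rewrite cR_anti mulNr.
  by rewrite sumrN; field.
have DX i j k : Dmap X i j k = 0.
  transitivity (Dmap Y i j k - Dmap (Qmap Y) i j k); last by rewrite Dmap_Qmap subrr.
  rewrite /Dmap -sumrB; apply: eq_bigr => r _; rewrite -sumrB; apply: eq_bigr => s _.
  by rewrite !mxE; ring.
rewrite /lieG2; apply/sub_bigcapmxP => i _; apply/sub_bigcapmxP => j _; apply/sub_kermxP.
rewrite mul_vec_lin [X in mxvec X](_ : _ = 0) ?linear0 //.
by apply/rowP => l; rewrite leibniz_Dmap // DX oppr0 mxE.
Qed.

(** An infinitesimal form of the orthogonality of G2: a derivation X acts on
    multiplication operators by commutators, so it is antisymmetric for the
    trace form of mxtrace_admx. *)
Lemma lieG2_anti (X : 'M[R]_7) : (mxvec X <= lieG2 R)%MS -> X^T = - X.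
Proof.
move/lieG2P => h; apply/eqP; rewrite -addr_eq0; apply/eqP; apply: dot_inj => x y.
have adX z : admx (z *m X) = admx z *m X - X *m admx z.
  apply/row_matrixP => i; rewrite !rowE mulmxBr !mulmxA !mul_admx.
  have := h z (delta_mx 0 i); rewrite /leibniz => /eqP; rewrite subr_eq0 => /eqP ->.
  by rewrite addrK.
rewrite mulmx0 mul0mx [in RHS]mxE; apply: (@mulfI _ (- 6)); first by rewrite oppr_eq0 pnatr_eq0.
have -> : x *m (X^T + X) *m y^T = (x *m X) *m y^T + x *m (y *m X)^T.
  by rewrite trmx_mul mulmxDr mulmxDl !mulmxA addrC.
rewrite mxE mulrDr -!mxtrace_admx mulr0 !adX mulmxBl mulmxBr !raddfB /= !mulmxA.
by rewrite -(mulmxA X) (mxtrace_mulC X) -addrA addKr subrr.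
Qed.

Lemma Qmap_lieG2 (X : 'M[R]_7) : (mxvec X <= lieG2 R)%MS -> Qmap X = 0.
Proof.
move=> hX; have aX := lieG2_anti hX; apply/matrixP => p q; rewrite QmapE [RHS]mxE.
rewrite big1 ?mulr0 // => l _; rewrite big1 // => m _; rewrite big1 // => n _.
rewrite -[Dmap _ _ _ _]opprK -leibniz_Dmap // ((lieG2P X).1 hX) mxE oppr0 mulr0 //.
Qed.

(** 1 - Q is the projection onto the Lie algebra. The trace of Ad g on all matrices
    is (tr g)^2, and Q takes away the traces on S^2 V and V. *)
Lemma mxtrace_rho2_aux (g : 'M[R]_7) : G2 g ->
  \tr (in_submod (lieG2 R) (val_submod (1%:M : 'M[R]_(\rank (lieG2 R))) *m Ad g))
  = (\tr g ^+ 2 - \tr (g *m g)) / 2 - \tr g.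
Proof.
move=> Gg; rewrite (mxtrace_in_submod (P := 1%:M - lin_mx Qmap)).
- pose AQ := (mulmxr g \o mulmx (invmx g)) \o Qmap.
  have -> : (1%:M - lin_mx Qmap) *m Ad g = Ad g - lin_mx AQ.
    rewrite mulmxBl mul1mx; congr (_ - _); apply/row_matrixP => i.
    rewrite !rowE mulmxA -[delta_mx 0 i]vec_mxK.
    by rewrite /Ad !mul_vec_lin.
  rewrite raddfB /= !mxtrace_lin_mx /=.
  have gd a b i j : (invmx g *m delta_mx a b *m g) i j = g a i * g b j :> R.
    rewrite G2_invmx // mxE (bigD1 b) //= big1 ?addr0 => [|k kb].
      rewrite mxE (bigD1 a) //= big1 ?addr0 => [|k ka]; first by rewrite !mxE !eqxx /= mulr1.
      by rewrite !mxE (negbTE ka) mulr0.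
    by rewrite mxE big1 ?mul0r // => l _; rewrite !mxE (negbTE kb) andbF mulr0.
  have -> : \sum_i \sum_j (invmx g *m delta_mx i j *m g) i j = \tr g ^+ 2.
    rewrite expr2 mulr_suml; apply: eq_bigr => i _; rewrite mulr_sumr.
    by apply: eq_bigr => j _; rewrite gd.
  have -> : \sum_i \sum_j (invmx g *m Qmap (delta_mx i j) *m g) i j =
     36^-1 * \sum_(p < 7) \sum_(q < 7) \sum_(r < 7) \sum_(s < 7) (g r p * g s q) * QR R p q r s.
    rewrite mulr_sumr; apply: eq_bigr => p _; rewrite mulr_sumr; apply: eq_bigr => q _.
    rewrite mxE exchange_big.
    transitivity (\sum_(k < 7) \sum_(l < 7) g l p * (Qmap (delta_mx p q) l k) * g k q).
      apply: eq_bigr => k _; rewrite mxE mulr_suml; apply: eq_bigr => l _.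
      by rewrite G2_invmx // mxE.
    rewrite mulr_sumr; apply: eq_bigr => k _; rewrite mulr_sumr; apply: eq_bigr => l _.
    rewrite mxE (bigD1 p) //= [X in _ + X]big1 ?addr0 => [|r rp]; last first.
      by rewrite big1 // => s _; rewrite mxE (negbTE rp) mulr0.
    rewrite (bigD1 q) //= [X in _ + X]big1 ?addr0 => [|s sq]; last first.
      by rewrite mxE (negbTE sq) andbF mulr0.
    have QRC (a b d e : 'I_7) : QR R a b d e = QR R d e a b.
      rewrite !QR_E !(eq_sym d) !(eq_sym e); congr (_ * _ + _ * _); first by ring.
      by apply: eq_bigr => x _; rewrite mulrC.
    by rewrite mxE !eqxx /= mulr1 (QRC l); ring.
  by rewrite trace_gg_QR //; field.
- apply/row_subP => i; rewrite rowE mulmxBr mulmx1 -[delta_mx 0 i]vec_mxK mul_vec_lin.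
  by rewrite -linearB; exact: lieG2_compl_Qmap.
- apply/row_matrixP => i; rewrite row_mul mulmxBr mulmx1 -[row i _]vec_mxK mul_vec_lin.
  have hq : Qmap (vec_mx (row i (lieG2 R))) = 0.
    by apply: Qmap_lieG2; rewrite vec_mxK row_sub.
  by rewrite [X in _ - mxvec X]hq linear0 subr0.
- exact: lieG2_stable.
Qed.

Lemma mxtrace_rho1 (g : 'M[R]_7) : \tr (rho1 g) = (\tr g)%:C%C.
Proof. by rewrite /rho1 trace_map_mx. Qed.

Lemma mxtrace_rho2 (g : 'M[R]_7) : G2 g ->
  \tr (rho2 g) = ((\tr g ^+ 2 - \tr (g *m g)) / 2 - \tr g)%:C%C.
Proof. by move=> Gg; rewrite /rho2 trace_map_mx mxtrace_rho2_aux. Qed.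
End TraceAdjoint.

(** * SU(3,3) as a list of matrices *)

(** The field with three elements, None being 0, Some true being 1 and Some false
    being -1. This encoding keeps the arithmetic, which runs over thousands of
    matrices, free of proofs and of divisions. *)
Definition f3 : Type := option bool.
Definition add3 (x y : f3) : f3 :=
  match x, y with
  | None, z | z, None => z
  | Some true, Some true => Some false
  | Some false, Some false => Some true
  | _, _ => None
  end.
Definition opp3 (x : f3) : f3 :=
  match x with None => None | Some b => Some (if b then false else true) end.
Definition mul3 (x y : f3) : f3 :=
  match x with None => None | Some true => y | Some false => opp3 y end.

(** The pair (a, b) stands for a + b i, where i^2 = -1. *)
Definition f9 : Type := (f3 * f3)%type.
Definition zero9 : f9 := (None, None).
Definition one9 : f9 := (Some true, None).
Definition add9 (x y : f9) : f9 :=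
  let: (a, b) := x in let: (c, d) := y in (add3 a c, add3 b d).
Definition opp9 (x : f9) : f9 := let: (a, b) := x in (opp3 a, opp3 b).
Definition mul9 (x y : f9) : f9 :=
  let: (a, b) := x in let: (c, d) := y in
  (add3 (mul3 a c) (opp3 (mul3 b d)), add3 (mul3 a d) (mul3 b c)).
Definition conj9 (x : f9) : f9 := let: (a, b) := x in (a, opp3 b).
Definition is_zero9 (x : f9) : bool := if x is (None, None) then true else false.
Definition is_one9 (x : f9) : bool := if x is (Some true, None) then true else false.

Definition vec : Type := (f9 * f9 * f9)%type.
Definition mat : Type := (vec * vec * vec)%type.
Definition dot9 (u v : vec) : f9 :=
  let: (a, b, c) := u in let: (d, e, f) := v in
  add9 (mul9 a d) (add9 (mul9 b e) (mul9 c f)).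
Definition conjv (u : vec) : vec := let: (a, b, c) := u in (conj9 a, conj9 b, conj9 c).
(** The last row of a special unitary matrix is the conjugate of the cross product
    of the other two, so SU needs an enumeration of orthonormal pairs only. *)
Definition crossv (u v : vec) : vec :=
  let: (a, b, c) := u in let: (d, e, f) := v in
  let sub x y := add9 x (opp9 y) in
  (sub (mul9 b f) (mul9 c e), sub (mul9 c d) (mul9 a f), sub (mul9 a e) (mul9 b d)).
Definition trmat (A : mat) : mat :=
  let: ((a, b, c), (d, e, f), (g, h, i)) := A in ((a, d, g), (b, e, h), (c, f, i)).
Definition mulmat (A B : mat) : mat :=
  let: (u, v, w) := A in let: (x, y, z) := trmat B in
  let r u := (dot9 u x, dot9 u y, dot9 u z) in (r u, r v, r w).
Definition adjmat (A : mat) : mat :=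
  trmat (let: (u, v, w) := A in (conjv u, conjv v, conjv w)).
Definition onemat : mat :=
  ((one9, zero9, zero9), (zero9, one9, zero9), (zero9, zero9, one9)).

Definition f3s : seq f3 := [:: None; Some true; Some false].
Definition f9s : seq f9 := [seq (a, b) | a <- f3s, b <- f3s].
Definition vecs : seq vec := [seq (p, c) | p <- [seq (a, b) | a <- f9s, b <- f9s], c <- f9s].
Definition units9 : seq vec := [seq u <- vecs | is_one9 (dot9 u (conjv u))].
Definition SU : seq mat :=
  [seq (u, v, conjv (crossv u v)) | u <- units9,
     v <- [seq v <- units9 | is_zero9 (dot9 u (conjv v))]].

Definition code3 (x : f3) (p : positive) : positive :=
  match x with
  | None => xO (xO p) | Some true => xO (xI p) | Some false => xI (xO p)
  end.
Definition code9 (x : f9) (p : positive) : positive :=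
  let: (a, b) := x in code3 a (code3 b p).
Definition codev (u : vec) (p : positive) : positive :=
  let: (a, b, c) := u in code9 a (code9 b (code9 c p)).
(** Digits are read off from the least significant bit, and every element of f3
    takes two bits, so codes of equal length determine the matrix. *)
Definition code (A : mat) : positive :=
  let: (u, v, w) := A in codev u (codev v (codev w xH)).

(** The closure of a worklist under conjugation by the generators gs, each new
    element being marked with t. The list fuel is a bound on the number of
    steps. *)
Fixpoint mark (fuel : seq mat) (gs : seq (mat * mat)) (t : nat) (todo : seq mat)
    (m : PositiveMap.t nat) : PositiveMap.t nat :=
  match fuel, todo with
  | _ :: fuel', A :: todo' =>
    let visit (s : seq mat * PositiveMap.t nat) (h : mat * mat) :=
      let B := mulmat (mulmat h.1 A) h.2 in
      match PositiveMap.find (code B) s.2 with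
      | Some _ => s
      | None => (B :: s.1, PositiveMap.add (code B) t s.2)
      end in
    let: (todo1, m1) := foldl visit (todo', m) gs in mark fuel' gs t todo1 m1
  | _, _ => m
  end.

(** The digits 0 to 8 of the literals below are a + 3 b for the element a + b i of
    F_9, with 2 for -1. *)
Definition digit (n : nat) : f9 :=
  let d k := match k with 0%N => None | 1%N => Some true | _ => Some false end in
  (d (n %% 3)%N, d (n %/ 3)%N).
Definition matrix9 (s : seq nat) : mat :=
  let e k := digit (nth 0%N s k) in
  ((e 0%N, e 1%N, e 2%N), (e 3%N, e 4%N, e 5%N), (e 6%N, e 7%N, e 8%N)).
Fixpoint powmat (A : mat) (n : nat) : mat :=
  if n is n'.+1 then mulmat A (powmat A n') else onemat.

(** The matrices r12, r8, r7, r4c and r3b have the orders 12, 8, 7, 4 and 3. Every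
    element is conjugate, up to inversion, to one of them or to a power of r12.
    The matrices h8, h7 and h3 conjugate r8, r7 and r3b as stated in
    rep_relations. *)
Definition r12 : mat := Eval vm_compute in matrix9 [:: 0; 0; 3; 4; 5; 0; 7; 8; 0]%N.
Definition r8 : mat := Eval vm_compute in matrix9 [:: 3; 6; 5; 5; 5; 0; 3; 6; 7]%N.
Definition r7 : mat := Eval vm_compute in matrix9 [:: 0; 0; 3; 4; 4; 0; 4; 8; 0]%N.
Definition r4c : mat := Eval vm_compute in matrix9 [:: 4; 7; 0; 3; 2; 7; 6; 1; 7]%N.
Definition r3b : mat := Eval vm_compute in matrix9 [:: 0; 0; 2; 1; 0; 0; 0; 2; 0]%N.
Definition h8 : mat := Eval vm_compute in matrix9 [:: 0; 5; 5; 8; 1; 2; 8; 2; 1]%N.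
Definition h7 : mat := Eval vm_compute in matrix9 [:: 6; 4; 2; 8; 0; 7; 2; 5; 3]%N.
Definition h3 : mat := Eval vm_compute in matrix9 [:: 0; 8; 7; 8; 3; 1; 7; 1; 6]%N.

Definition reps : seq mat := Eval vm_compute in
  [:: onemat; powmat r12 6; powmat r12 4; r3b; powmat r12 3; r4c; powmat r12 2;
      r7; r8; r12].
Definition class_sizes : seq nat := [:: 1; 63; 56; 672; 126; 378; 504; 1728; 1512; 1008]%N.
Definition gens : seq (mat * mat) := [seq (A, adjmat A) | A <- [:: r3b; r7]].
(** Each class is marked from a representative and from its inverse: g and its
    inverse have the same trace in the representations considered here. This
    leaves ten classes out of fourteen. *)
Definition marks : PositiveMap.t nat :=
  foldl (fun m t => let A := nth onemat reps t in
    mark SU gens t [:: A; adjmat A]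
      (PositiveMap.add (code (adjmat A)) t (PositiveMap.add (code A) t m)))
    (PositiveMap.empty nat) (iota 0 10).
Definition tags : seq (option nat) := [seq PositiveMap.find (code A) marks | A <- SU].

Lemma tags_check :
  [&& size SU == 6048, all (mem [seq Some t | t <- iota 0 10]) tags &
      [seq count_mem (Some t) tags | t <- iota 0 10] == class_sizes].
Proof. by vm_compute. Qed.
Lemma rep_relations :
  [&& powmat r12 12 == onemat, mulmat r8 r12 == mulmat (powmat r12 5) r8,
      powmat r8 2 == powmat r12 3, mulmat h8 r8 == mulmat (powmat r8 5) h8,
      powmat r7 7 == onemat, mulmat h7 r7 == mulmat (powmat r7 2) h7,
      powmat r4c 2 == powmat r12 6, powmat r3b 3 == onemat,
      mulmat r3b (powmat r12 4) == mulmat (powmat r12 4) r3b,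
      mulmat h3 r3b == mulmat (mulmat r3b (powmat r12 4)) h3 &
      (mulmat (powmat h3 2) r3b == mulmat (mulmat r3b (powmat r12 8)) (powmat h3 2))].
Proof. by vm_compute. Qed.
(** SU(3,3) has trivial centre, already for the commutation with the two generators. *)
Definition central_check (A : mat) :=
  (mulmat A r3b == mulmat r3b A) && (mulmat A r7 == mulmat r7 A) ==> (A == onemat).
Lemma SU_center : all central_check SU.
Proof. by vm_compute. Qed.

(** * The field with nine elements *)

Section FieldModel.
Local Open Scope nat_scope.

Lemma card_F9 : #|F9| = 9.
Proof. by rewrite /F9; case: F9_spec => F /= ? ->. Qed.
Local Open Scope ring_scope.

Lemma F9_three : 1 + 1 + 1 = 0 :> F9.
Proof. by have /andP[_ /eqP <-] := F9_pchar; rewrite -!natr1 mulr0n add0r. Qed.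

Lemma F9_conjE x : F9_conj x = x ^+ 3.
Proof. by []. Qed.

Lemma F9_conjK : involutive F9_conj.
Proof. by move=> x; rewrite !F9_conjE -exprM -{2}[x]expf_card card_F9. Qed.

(** X^4 - 1 cannot have all eight nonzero elements as roots; the square of an element
    that is not a root is a square root of -1, because x^8 = 1. *)
Lemma F9_sqrtN1 : exists i : F9, i ^+ 2 == -1.
Proof.
suff [x x0 x4] : exists2 x : F9, x != 0 & x ^+ 4 != 1.
  exists (x ^+ 2); have x8 : x ^+ 8 = 1.
    by apply: (mulfI x0); rewrite mulr1 -exprS -{2}[x]expf_card card_F9.
  have : (x ^+ 4 - 1) * (x ^+ 4 + 1) == 0 by rewrite -subr_sqr_1 -exprM x8 subrr.
  by rewrite mulf_eq0 subr_eq0 (negbTE x4) /= addr_eq0 -exprM.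
case: (pickP (fun x : F9 => (x != 0) && (x ^+ 4 != 1))) => [x /andP[]|h].
  by exists x.
pose p : {poly F9} := 'X^4 - 1%:P.
have sp : size p = 5%N by rewrite size_XnsubC.
have p0 : p != 0 by rewrite -size_poly_gt0 sp.
have rp : all (root p) [seq x <- enum F9 | x != 0].
  apply/allP => x; rewrite mem_filter => /andP[x0 _].
  rewrite /root !hornerE subr_eq0.
  by have := h x; rewrite x0 => /negbFE.
have := max_poly_roots p0 rp (filter_uniq _ (enum_uniq _)).
have e8 : count (predC (pred1 (0 : F9))) (enum F9) = 8%N.
  have := count_predC (pred1 (0 : F9)) (enum F9).
  by rewrite count_uniq_mem ?enum_uniq // mem_enum -cardE card_F9 add1n => -[].
by rewrite sp size_filter [X in (X < _)%N]e8.
Qed.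

Definition iF9 : F9 := xchoose F9_sqrtN1.
Lemma iF9_sq : iF9 ^+ 2 = -1.
Proof. exact/eqP/(xchooseP F9_sqrtN1). Qed.

Definition of3 (x : f3) : F9 :=
  match x with None => 0 | Some true => 1 | Some false => -1 end.
Definition of9 (x : f9) : F9 := of3 x.1 + of3 x.2 * iF9.

Lemma F9_11 : 1 + 1 = -1 :> F9.
Proof. by apply/eqP; rewrite -addr_eq0 F9_three. Qed.
Lemma of3D x y : of3 (add3 x y) = of3 x + of3 y.
Proof.
have h : -1 - 1 = 1 :> F9 by rewrite -opprD F9_11 opprK.
by case: x => [[]|]; case: y => [[]|]; rewrite /= ?addr0 ?add0r ?subrr ?addNr ?F9_11 ?h.
Qed.
Lemma of3N x : of3 (opp3 x) = - of3 x.
Proof. by case: x => [[]|] /=; rewrite ?oppr0 ?opprK. Qed.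
Lemma of3M x y : of3 (mul3 x y) = of3 x * of3 y.
Proof. by case: x => [[]|] /=; rewrite ?mul1r ?mul0r ?mulN1r ?of3N. Qed.
Lemma of9D x y : of9 (add9 x y) = of9 x + of9 y.
Proof. by case: x y => [a b] [c d]; rewrite /of9 /= !of3D; ring. Qed.
Lemma of9N x : of9 (opp9 x) = - of9 x.
Proof. by case: x => [a b]; rewrite /of9 /= !of3N; ring. Qed.
Lemma of9M x y : of9 (mul9 x y) = of9 x * of9 y.
Proof.
case: x y => [a b] [c d]; rewrite /of9 /= !of3D !of3N !of3M.
rewrite -[X in X + _]addr0 -(subrr (of3 b * of3 d)).
have h := iF9_sq; transitivity (of3 a * of3 c + of3 b * of3 d * iF9 ^+ 2 +
  (of3 a * of3 d + of3 b * of3 c) * iF9); [rewrite h|]; ring.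
Qed.
Lemma of9_conj x : of9 (conj9 x) = F9_conj (of9 x).
Proof.
have hD y z : F9_conj (y + z) = F9_conj y + F9_conj z := rmorphD _ y z.
have hM y z : F9_conj (y * z) = F9_conj y * F9_conj z := rmorphM _ y z.
case: x => [a b]; rewrite /of9 /= of3N hD hM.
have c3 y : F9_conj (of3 y) = of3 y.
  by case: y => [[]|] /=; rewrite ?rmorphN ?rmorph1 ?rmorph0.
by rewrite !c3 [F9_conj iF9]F9_conjE exprS iF9_sq; ring.
Qed.
Lemma of9_0 : of9 zero9 = 0. Proof. by rewrite /of9 /= mul0r addr0. Qed.
Lemma of9_1 : of9 one9 = 1. Proof. by rewrite /of9 /= mul0r addr0. Qed.

Lemma of9_inj : injective of9.
Proof.
have inj0 x : of9 x = 0 -> x = zero9.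
  move=> x0; have : of9 (mul9 x (conj9 x)) = 0 by rewrite of9M x0 mul0r.
  case: x {x0} => [[[]|] [[]|]]; rewrite /of9 /= ?mul0r ?addr0 ?mulN1r ?mul1r //;
  move/eqP; rewrite ?oppr_eq0 ?oner_eq0 //.
move=> x y e; have : of9 (add9 x (opp9 y)) = 0 by rewrite of9D of9N e subrr.
by move/inj0; case: x y {e} => [[[]|] [[]|]] [[[]|] [[]|]].
Qed.

Lemma of9_bij : bijective of9.
Proof. by apply: inj_card_bij of9_inj _; rewrite card_F9 card_prod card_option card_bool. Qed.
End FieldModel.

(** * Special unitary matrices over F_9 *)

Lemma det3 (R : comNzRingType) (M : 'M[R]_3) (m : nat -> nat -> R) :
  (forall i j : 'I_3, M i j = m i j) ->
  \det M = m 0%N 0%N * (m 1%N 1%N * m 2%N 2%N - m 1%N 2%N * m 2%N 1%N)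
         + m 0%N 1%N * (m 1%N 2%N * m 2%N 0%N - m 1%N 0%N * m 2%N 2%N)
         + m 0%N 2%N * (m 1%N 0%N * m 2%N 1%N - m 1%N 1%N * m 2%N 0%N).
Proof.
move=> ME.
rewrite (expand_det_row _ ord0) !big_ord_recl big_ord0 /cofactor.
rewrite !(expand_det_row _ ord0) !big_ord_recl !big_ord0 /cofactor !det_mx11 !mxE !ME.
rewrite /= /bump /= !addn0 !add0n !addn1 !expr0 !expr1 !exprS.
ring.
Qed.

Section MatrixModel.

Definition entry (A : mat) (i j : nat) : f9 :=
  let: (u, v, w) := A in
  let: (a, b, c) := nth u [:: u; v; w] i in nth a [:: a; b; c] j.
Definition toM (A : mat) : 'M[F9]_3 := \matrix_(i, j) of9 (entry A i j).

Lemma eqM3 (M N : 'M[F9]_3) :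
  (forall i j : nat, (i < 3)%N -> (j < 3)%N -> M (inord i) (inord j) = N (inord i) (inord j)) ->
  M = N.
Proof.
by move=> h; apply/matrixP => i j; have := h i j (ltn_ord i) (ltn_ord j); rewrite !inord_val.
Qed.

Lemma toME A i j : (i < 3)%N -> (j < 3)%N -> toM A (inord i) (inord j) = of9 (entry A i j).
Proof. by move=> hi hj; rewrite mxE !inordK. Qed.

Lemma sum_ord3 (F : 'I_3 -> F9) :
  \sum_i F i = F (inord 0) + F (inord 1) + F (inord 2).
Proof.
rewrite !big_ord_recl big_ord0 addr0 addrA; congr (F _ + F _ + F _);
  by apply: val_inj; rewrite /= inordK.
Qed.

Lemma forall3 (P : nat -> nat -> Prop) :
  P 0%N 0%N -> P 0%N 1%N -> P 0%N 2%N -> P 1%N 0%N -> P 1%N 1%N -> P 1%N 2%N ->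
  P 2%N 0%N -> P 2%N 1%N -> P 2%N 2%N ->
  forall i j, (i < 3)%N -> (j < 3)%N -> P i j.
Proof. by do 9 move=> ?; case=> [|[|[|?]]] // [|[|[|?]]]. Qed.

Lemma toM_mul A B : toM (mulmat A B) = toM A *m toM B.
Proof.
apply: eqM3 => i j hi hj; rewrite toME // mxE sum_ord3 !toME //; move: i j hi hj.
case: A => [[[[a1 a2] a3] [[a4 a5] a6]] [[a7 a8] a9]].
case: B => [[[[b1 b2] b3] [[b4 b5] b6]] [[b7 b8] b9]].
by apply: forall3; rewrite /= !of9D !of9M addrA.
Qed.

Lemma toM_one : toM onemat = 1%:M.
Proof.
apply: eqM3 => i j hi hj; rewrite toME // mxE -val_eqE /= !inordK //; move: i j hi hj.
by apply: forall3; rewrite /= ?of9_0 ?of9_1.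
Qed.

Lemma toM_adj A : toM (adjmat A) = (map_mx F9_conj (toM A))^T.
Proof.
apply: eqM3 => i j hi hj; rewrite toME // !mxE !inordK //; move: i j hi hj.
case: A => [[[[a1 a2] a3] [[a4 a5] a6]] [[a7 a8] a9]].
by apply: forall3; rewrite /= of9_conj.
Qed.

Lemma toM_inj : injective toM.
Proof.
move=> A B e; have h i j : (i < 3)%N -> (j < 3)%N -> entry A i j = entry B i j.
  by move=> hi hj; apply: of9_inj; rewrite -!toME // e.
case: A h {e} => [[[[a1 a2] a3] [[a4 a5] a6]] [[a7 a8] a9]].
case: B => [[[[b1 b2] b3] [[b4 b5] b6]] [[b7 b8] b9]] h.
by congr (_, _, _, (_, _, _), (_, _, _));
  [exact: (h 0%N 0%N)|exact: (h 0%N 1%N)|exact: (h 0%N 2%N)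
  |exact: (h 1%N 0%N)|exact: (h 1%N 1%N)|exact: (h 1%N 2%N)
  |exact: (h 2%N 0%N)|exact: (h 2%N 1%N)|exact: (h 2%N 2%N)].
Qed.

Lemma toM_surj M : exists A, toM A = M.
Proof.
have [g gK hK] := of9_bij; pose e i j := g (M (inord i) (inord j)).
exists ((e 0%N 0%N, e 0%N 1%N, e 0%N 2%N), (e 1%N 0%N, e 1%N 1%N, e 1%N 2%N),
  (e 2%N 0%N, e 2%N 1%N, e 2%N 2%N)).
apply: eqM3 => i j hi hj; rewrite toME //; move: i j hi hj.
by apply: forall3; rewrite /= hK.
Qed.

Definition isSU (M : 'M[F9]_3) : Prop :=
  M *m (map_mx F9_conj M)^T = 1%:M /\ \det M = 1.

Lemma isSU_mul M N : isSU M -> isSU N -> isSU (M *m N).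
Proof.
move=> [hM dM] [hN dN]; split; last by rewrite det_mulmx dM dN mulr1.
by rewrite map_mxM trmx_mul mulmxA -(mulmxA M) hN mulmx1 hM.
Qed.

Lemma mem_vecs u : u \in vecs.
Proof.
have m9 (x : f9) : x \in f9s by case: x => [[[]|] [[]|]].
case: u => [[a b] c]; apply/allpairsP; exists (a, b, c); split=> //.
by apply/allpairsP; exists (a, b).
Qed.

Lemma is_one9P x : is_one9 x = (of9 x == 1).
Proof. by rewrite -of9_1 (inj_eq of9_inj); case: x => [[[]|] [[]|]]. Qed.
Lemma is_zero9P x : is_zero9 x = (of9 x == 0).
Proof. by rewrite -of9_0 (inj_eq of9_inj); case: x => [[[]|] [[]|]]. Qed.

Lemma conj_dot (R : comNzRingType) (f : {rmorphism R -> R}) (x1 x2 x3 y1 y2 y3 : R) :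
  involutive f -> x1 * f y1 + (x2 * f y2 + x3 * f y3) = 0 ->
  y1 * f x1 + (y2 * f x2 + y3 * f x3) = 0.
Proof.
by move=> fK /(congr1 f); rewrite !rmorphD !rmorphM !fK rmorph0 => <-; ring.
Qed.

Lemma conj_minor x1 x2 y1 y2 : F9_conj (x1 * y2 - x2 * y1) =
  F9_conj x1 * F9_conj y2 - F9_conj x2 * F9_conj y1.
Proof.
have cB x y : F9_conj (x - y) = F9_conj x - F9_conj y := rmorphB _ x y.
have cM x y : F9_conj (x * y) = F9_conj x * F9_conj y := rmorphM _ x y.
by rewrite cB (cM x1) (cM x2).
Qed.

(** The two orthonormality conditions on the first two rows are those of the
    enumeration. Given these, Laplace expansion identifies the third row with
    the conjugate cross product, from its orthogonality to the other rows and
    from the determinant. *)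
Lemma SU_P A : isSU (toM A) <-> A \in SU.
Proof.
have herm i j : (i < 3)%N -> (j < 3)%N ->
    (toM A *m (map_mx F9_conj (toM A))^T) (inord i) (inord j) =
    of9 (entry A i 0) * F9_conj (of9 (entry A j 0)) +
    of9 (entry A i 1) * F9_conj (of9 (entry A j 1)) +
    of9 (entry A i 2) * F9_conj (of9 (entry A j 2)).
  by move=> hi hj; rewrite mxE sum_ord3 !mxE !inordK.
have cM x y : F9_conj (x * y) = F9_conj x * F9_conj y := rmorphM _ x y.
have cB x y : F9_conj (x - y) = F9_conj x - F9_conj y := rmorphB _ x y.
have cK := F9_conjK.
have onE i j : (i < 3)%N -> (j < 3)%N -> (1%:M : 'M[F9]_3) (inord i) (inord j) = (i == j)%:R.
  by move=> hi hj; rewrite mxE -val_eqE /= !inordK.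
split=> [[hU]|].
  have hU' i j (hi : (i < 3)%N) (hj : (j < 3)%N) := etrans (esym (herm i j hi hj))
    (etrans (congr1 (fun M : 'M[F9]_3 => M (inord i) (inord j)) hU) (onE i j hi hj)).
  move: {hU herm onE} hU'.
  rewrite (det3 (m := fun i j => of9 (entry A i j))) => [|i j]; last by rewrite mxE.
  case: A => [[[[a1 a2] a3] [[a4 a5] a6]] [[a7 a8] a9]] /= hU hdet.
  have /= h00 := hU 0%N 0%N isT isT; have /= h11 := hU 1%N 1%N isT isT.
  have /= h01 := hU 0%N 1%N isT isT; have /= h22 := hU 2%N 2%N isT isT.
  have /= h02 := hU 0%N 2%N isT isT; have /= h12 := hU 1%N 2%N isT isT.
  have dotE (u v : vec) : of9 (dot9 u v) = of9 u.1.1 * of9 v.1.1 + of9 u.1.2 * of9 v.1.2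
      + of9 u.2 * of9 v.2.
    by case: u v => [[? ?] ?] [[? ?] ?]; rewrite /= !of9D !of9M addrA.
  have u1 : (a1, a2, a3) \in units9.
    by rewrite mem_filter mem_vecs andbT is_one9P dotE /= !of9_conj h00.
  have u2 : (a4, a5, a6) \in units9.
    by rewrite mem_filter mem_vecs andbT is_one9P dotE /= !of9_conj h11.
  have -> : (a7, a8, a9) = conjv (crossv (a1, a2, a3) (a4, a5, a6)).
    move: h02 h12 h22 hdet => /=.
    set x1 := of9 a1; set x2 := of9 a2; set x3 := of9 a3; set x4 := of9 a4.
    set x5 := of9 a5; set x6 := of9 a6; set y7 := F9_conj (of9 a7).
    set y8 := F9_conj (of9 a8); set y9 := F9_conj (of9 a9).
    set x7 := of9 a7; set x8 := of9 a8; set x9 := of9 a9.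
    move=> h02 h12 h22 hdet.
    congr (_, _, _); apply: of9_inj; rewrite of9_conj of9D of9N !of9M -[LHS]cK;
      congr (F9_conj _); rewrite -?/x1 -?/x2 -?/x3 -?/x4 -?/x5 -?/x6 -?/x7 -?/x8 -?/x9
      -?/y7 -?/y8 -?/y9 -[LHS]mulr1 -hdet -[RHS]mulr1 -[X in _ = _ * X]h22.
    - transitivity ((x2 * x6 - x3 * x5) * (x7 * y7 + x8 * y8 + x9 * y9)
        + (x8 * x3 - x9 * x2) * (x4 * y7 + x5 * y8 + x6 * y9)
        - (x8 * x6 - x9 * x5) * (x1 * y7 + x2 * y8 + x3 * y9)); first by ring.
      by rewrite h02 h12; ring.
    - transitivity ((x3 * x4 - x1 * x6) * (x7 * y7 + x8 * y8 + x9 * y9)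
        + (x9 * x1 - x7 * x3) * (x4 * y7 + x5 * y8 + x6 * y9)
        - (x9 * x4 - x7 * x6) * (x1 * y7 + x2 * y8 + x3 * y9)); first by ring.
      by rewrite h02 h12; ring.
    - transitivity ((x1 * x5 - x2 * x4) * (x7 * y7 + x8 * y8 + x9 * y9)
        + (x7 * x2 - x8 * x1) * (x4 * y7 + x5 * y8 + x6 * y9)
        - (x7 * x5 - x8 * x4) * (x1 * y7 + x2 * y8 + x3 * y9)); first by ring.
      by rewrite h02 h12; ring.
  apply/allpairsPdep; exists (a1, a2, a3), (a4, a5, a6); split=> //.
  by rewrite mem_filter u2 andbT is_zero9P dotE /= !of9_conj h01.
case/allpairsPdep => u [v []]; rewrite !mem_filter mem_vecs is_one9P is_zero9P is_one9P.
case: u v => [[a1 a2] a3] [[a4 a5] a6].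
rewrite /= !of9D !of9M !of9_conj andbT => /eqP h00 /and3P[/eqP h01 /eqP h11 _] eA.
move: herm; rewrite {}eA => herm.
have h10 : of9 a4 * F9_conj (of9 a1) + (of9 a5 * F9_conj (of9 a2) + of9 a6 * F9_conj (of9 a3)) = 0.
  exact: (conj_dot F9_conjK h01).
have h22 : F9_conj (of9 a2 * of9 a6 - of9 a3 * of9 a5) * (of9 a2 * of9 a6 - of9 a3 * of9 a5)
  + F9_conj (of9 a3 * of9 a4 - of9 a1 * of9 a6) * (of9 a3 * of9 a4 - of9 a1 * of9 a6)
  + F9_conj (of9 a1 * of9 a5 - of9 a2 * of9 a4) * (of9 a1 * of9 a5 - of9 a2 * of9 a4) = 1.
  rewrite !conj_minor.
  transitivity ((of9 a1 * F9_conj (of9 a1) + (of9 a2 * F9_conj (of9 a2) + of9 a3 * F9_conj (of9 a3)))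
    * (of9 a4 * F9_conj (of9 a4) + (of9 a5 * F9_conj (of9 a5) + of9 a6 * F9_conj (of9 a6)))
    - (of9 a1 * F9_conj (of9 a4) + (of9 a2 * F9_conj (of9 a5) + of9 a3 * F9_conj (of9 a6)))
    * (of9 a4 * F9_conj (of9 a1) + (of9 a5 * F9_conj (of9 a2) + of9 a6 * F9_conj (of9 a3)))).
    by ring.
  by rewrite h00 h11 h01 h10; ring.
split.
  apply: eqM3 => i j hi hj; rewrite herm // onE //; move: i j hi hj {herm}.
  apply: forall3; rewrite /entry [nth _ _ _]/= ?[nth _ _ _]/=
    ?(of9_conj, of9D, of9N, of9M) ?(of9_conj, of9D, of9N, of9M)
    ?(of9_conj, of9D, of9N, of9M) ?(of9_conj, of9D, of9N, of9M);
    do ?[rewrite of9_conj | rewrite of9D | rewrite of9N | rewrite of9M]; rewrite ?F9_conjK.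
  - by rewrite -addrA.
  - by rewrite -addrA.
  - by rewrite /=; ring.
  - by rewrite -addrA.
  - by rewrite -addrA.
  - by rewrite /=; ring.
  - by rewrite /= !conj_minor; ring.
  - by rewrite /= !conj_minor; ring.
  - exact: h22.
rewrite (det3 (m := fun i j => of9 (entry
  ((a1, a2, a3), (a4, a5, a6), conjv (crossv (a1, a2, a3) (a4, a5, a6))) i j))) => [|i j].
  by rewrite /= !of9_conj !of9D !of9N !of9M -h22; ring.
by rewrite mxE.
Qed.

Lemma mulmat_SU A B : A \in SU -> B \in SU -> mulmat A B \in SU.
Proof. by move=> /SU_P hA /SU_P hB; apply/SU_P; rewrite toM_mul; apply: isSU_mul. Qed.

Lemma adjmat_SU A : A \in SU -> adjmat A \in SU.
Proof.
move=> /SU_P[hA dA]; have hA' := mulmx1C hA; apply/SU_P; rewrite toM_adj; split.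
  have -> : (map_mx F9_conj ((map_mx F9_conj (toM A))^T))^T = toM A.
    by apply/matrixP => i j; rewrite !mxE F9_conjK.
  exact: hA'.
by rewrite -[LHS]mulr1 -dA -det_mulmx hA' det1.
Qed.

Lemma mulmat_adj A : A \in SU -> mulmat (adjmat A) A = onemat.
Proof.
move=> /SU_P[hA _]; apply: toM_inj; rewrite toM_mul toM_adj toM_one.
exact: mulmx1C.
Qed.

Lemma onemat_SU : onemat \in SU.
Proof.
by apply/SU_P; rewrite toM_one; split; rewrite ?det1 // map_mx1 trmx1 mulmx1.
Qed.
End MatrixModel.

(** * The projective unitary group is SU(3,3) *)

Section CenterCosets.
Variables (gT : finGroupType) (G : {group gT}).
Local Notation Z := 'Z(G)%g.
Let nZ x : x \in G -> x \in 'N(Z)%g.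
Proof. by apply: fintype.subsetP; apply: normal_norm; exact: center_normal. Qed.

Lemma coset_centerM x y : x \in G -> y \in G ->
  coset Z (x * y)%g = (coset Z x * coset Z y)%g.
Proof. by move=> Gx Gy; rewrite morphM ?nZ. Qed.
Lemma coset_center_eq x y : x \in G -> y \in G ->
  coset Z x = coset Z y -> (x^-1 * y)%g \in Z.
Proof.
move=> Gx Gy e; apply: coset_idr; first by rewrite groupM ?groupV ?nZ.
by rewrite morphM ?groupV ?nZ // morphV ?nZ //= e mulVg.
Qed.
Lemma mem_coset_center x : x \in G -> coset Z x \in (G / Z)%g.
Proof. exact: mem_quotient. Qed.
Lemma mem_quotient_center y : y \in (G / Z)%g -> exists2 x, x \in G & y = coset Z x.
Proof. by case/morphimP => x _ xG ->; exists x. Qed.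
Lemma center_commute x y : x \in Z -> y \in G -> (x * y = y * x)%g.
Proof. by case/centerP => _; exact. Qed.
End CenterCosets.

Section GroupModel.
Local Notation Z := 'Z(GU33)%g.

Definition toGL (A : mat) : {'GL_3[F9]} := insubd (1%g : {'GL_3[F9]}) (toM A).

Lemma toGLK A : A \in SU -> GLval (toGL A) = toM A.
Proof.
case/SU_P => _ dA; rewrite -[GLval _]/(\val _) /toGL insubdK //.
by rewrite -[_ \in _]/(toM A \in unitmx) unitmxE dA unitr1.
Qed.

Lemma toGL_GU33 A : A \in SU -> toGL A \in GU33.
Proof. by move=> sA; rewrite inE toGLK //; have [/eqP] := (SU_P A).2 sA. Qed.

Lemma toGL_mul A B : A \in SU -> B \in SU -> toGL (mulmat A B) = (toGL A * toGL B)%g.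
Proof.
move=> sA sB; apply: val_inj; rewrite -[LHS]/(GLval _) toGLK ?mulmat_SU // toM_mul.
by rewrite -(toGLK sA) -(toGLK sB) -[RHS]/(GLval _) GL_ME.
Qed.

Lemma toGL_comm A B : A \in SU -> B \in SU ->
  (toGL A * toGL B)%g = (toGL B * toGL A)%g -> mulmat A B = mulmat B A.
Proof.
move=> sA sB; rewrite -(toGL_mul sA sB) -(toGL_mul sB sA) => /(congr1 GLval) h.
by apply: toM_inj; move: h; rewrite (toGLK (mulmat_SU sA sB)) (toGLK (mulmat_SU sB sA)).
Qed.

Lemma toGL_one : toGL onemat = 1%g.
Proof.
apply: val_inj; rewrite -[LHS]/(GLval _) toGLK ?onemat_SU // toM_one; symmetry; exact: GL_1E.
Qed.

(** If d is the determinant of x, of norm 1, then d x is special unitary: its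
    determinant is d^3 d = d^4 = d * conj d = 1. The scalar d is central. *)
Lemma GU33_decomp (x : {'GL_3[F9]}) : x \in GU33 ->
  exists2 A, A \in SU & coset Z x = coset Z (toGL A).
Proof.
move=> xG; have /[!inE]/eqP hx := xG; pose M := GLval x; pose d := \det M.
have cM y z : F9_conj (y * z) = F9_conj y * F9_conj z := rmorphM _ y z.
have d1 : d * F9_conj d = 1.
  have := congr1 determinant hx; rewrite det_mulmx det_tr det1 => <-.
  by rewrite -[in RHS]/M det_map_mx.
have d4 : d ^+ 4 = 1 by rewrite exprS -F9_conjE.
have d0 : d != 0 by apply/eqP => e; move: d1; rewrite e mul0r => /esym/eqP; rewrite oner_eq0.
have [A AM] := toM_surj (d *: M).
have sA : A \in SU.
  apply/SU_P; rewrite AM; split; last by rewrite detZ -/d -exprSr.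
  have -> : map_mx F9_conj (d *: M) = F9_conj d *: map_mx F9_conj M.
    by apply/matrixP => i j; rewrite !mxE cM.
  by rewrite linearZ /= -scalemxAl -scalemxAr scalerA d1 scale1r.
exists A => //.
have ud : (d%:M : 'M[F9]_3) \in unitmx by rewrite unitmxE det_scalar unitfE expf_neq0.
pose s : {'GL_3[F9]} := insubd (1%g : {'GL_3[F9]}) (d%:M : 'M[F9]_3).
have sE : GLval s = d%:M by rewrite -[GLval _]/(\val _) /s insubdK.
have AE : toGL A = (s * x)%g.
  apply: val_inj; rewrite -[LHS]/(GLval _) toGLK // AM -[RHS]/(GLval (s * x)%g) GL_ME sE.
  by rewrite -mul_scalar_mx.
have sG : s \in GU33.
  rewrite inE sE (map_scalar_mx F9_conj) tr_scalar_mx.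
  by rewrite -scalar_mxM [X in X%:M]d1.
have sZ : s \in Z.
  apply/centerP; split=> // y _; apply: val_inj.
  rewrite -[LHS]/(GLval (s * y)%g) -[RHS]/(GLval (y * s)%g) !GL_ME sE.
  exact: (esym (scalar_mxC d (GLval y))).
by rewrite AE coset_kerl.
Qed.

Lemma r3b_SU : r3b \in SU. Proof. by vm_compute. Qed.
Lemma r7_SU : r7 \in SU. Proof. by vm_compute. Qed.
Lemma r12_SU : r12 \in SU. Proof. by vm_compute. Qed.
Lemma r8_SU : r8 \in SU. Proof. by vm_compute. Qed.
Lemma r4c_SU : r4c \in SU. Proof. by vm_compute. Qed.
Lemma h8_SU : h8 \in SU. Proof. by vm_compute. Qed.
Lemma h7_SU : h7 \in SU. Proof. by vm_compute. Qed.
Lemma h3_SU : h3 \in SU. Proof. by vm_compute. Qed.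

(** Matrices of SU with the same image differ by a central element of SU, and
    these are trivial. *)
Lemma toGL_inj A B : A \in SU -> B \in SU ->
  coset Z (toGL A) = coset Z (toGL B) -> A = B.
Proof.
move=> sA sB e; have sC : mulmat (adjmat B) A \in SU by rewrite mulmat_SU ?adjmat_SU.
have hC : toGL (mulmat (adjmat B) A) \in Z.
  have BV : toGL (adjmat B) = (toGL B)^-1%g.
    by apply: (mulIg (toGL B)); rewrite mulVg -toGL_mul ?adjmat_SU // mulmat_adj // toGL_one.
  rewrite toGL_mul ?adjmat_SU // BV.
  exact: (coset_center_eq (toGL_GU33 sB) (toGL_GU33 sA) (esym e)).
have C1 : mulmat (adjmat B) A = onemat.
  have com D : D \in SU -> mulmat (mulmat (adjmat B) A) D == mulmat D (mulmat (adjmat B) A).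
    move=> sD; apply/eqP.
    exact: (toGL_comm sC sD (center_commute hC (toGL_GU33 sD))).
  have /implyP h := allP SU_center _ sC.
  by apply/eqP/h; rewrite (com _ r3b_SU) (com _ r7_SU).
have := congr1 (mulmat B) C1.
move=> h; apply: toM_inj; have := congr1 toM h; rewrite !toM_mul mulmxA toM_adj.
by have [-> _] := (SU_P B).2 sB; rewrite mul1mx toM_one mulmx1.
Qed.

Variables (gT : finGroupType) (Gam : {group gT}).

(** From here on, computation in the group is computation with the matrices of SU. *)
Lemma PU33_model : Gam \isog PU33 -> exists E : mat -> gT,
  [/\ {in SU, forall A, E A \in Gam},
      {in SU &, forall A B, E (mulmat A B) = (E A * E B)%g},
      {in SU &, injective E} &
      forall g, g \in Gam -> exists2 A, A \in SU & g = E A].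
Proof.
rewrite isog_sym => /isogP[f injf fG].
have inP A : A \in SU -> coset Z (toGL A) \in PU33.
  by move=> sA; exact: (mem_coset_center (toGL_GU33 sA)).
exists (fun A => f (coset Z (toGL A))); split.
- by move=> A sA; rewrite -fG; apply: mem_morphim; exact: inP.
- move=> A B sA sB; rewrite toGL_mul //.
  rewrite [X in f X](coset_centerM (toGL_GU33 sA) (toGL_GU33 sB)).
  exact: (morphM f (inP _ sA) (inP _ sB)).
- move=> A B sA sB e; apply: toGL_inj => //.
  exact: (injmP injf _ _ (inP _ sA) (inP _ sB) e).
- move=> g; rewrite -fG => /morphimP[y _ yG ->].
  have [x xG ->] := mem_quotient_center yG.
  by have [A sA ->] := GU33_decomp xG; exists A.
Qed.
End GroupModel.

(** * Traces constrained by dimensions of fixed spaces *)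

Section Numerics.
Variable R : realFieldType.
Implicit Types p q : R.

(** The relation G2_trace_cube, between the traces of a, a^2 and a^3. *)
Definition cubic p q r : Prop :=
  p ^+ 3 - 3 * p * q + 2 * r = 3 * p ^+ 2 + 3 * q + 6 * p.

(* A fixed space of dimension m gives a linear equation for the unknown trace p;
   only the few values of m below 8 that satisfy the cubic relation survive. *)
Ltac by_dimension m p e :=
  let hm := fresh "hm" in let h := fresh "h" in
  move=> hm h; (have -> : p = e by lra);
  move: {h} m hm => [|[|[|[|[|[|[|[|?]]]]]]]] // _; rewrite /cubic.

Lemma cubic_order2 p (m : nat) : (m <= 7)%N -> 7 + p = 2 * m%:R ->
  cubic p 7 p -> p != 7 -> p = -1 \/ p = -3.
Proof.
by_dimension m p (2 * m%:R - 7 : R) => c /eqP n;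
  first [by left; lra|by right; lra|by exfalso; lra|by exfalso; apply: n; lra].
Qed.

Lemma cubic_order3 p (m : nat) : (m <= 7)%N -> 7 + 2 * p = 3 * m%:R ->
  cubic p p 7 -> p != 7 -> p = 1 \/ p = -2.
Proof.
by_dimension m p ((3 * m%:R - 7) / 2 : R) => c /eqP n;
  first [by left; lra|by right; lra|by exfalso; lra|by exfalso; apply: n; lra].
Qed.

Lemma cubic_order4 p6 p (m : nat) : p6 = -1 \/ p6 = -3 -> (m <= 7)%N ->
  7 + p6 + 2 * p = 4 * m%:R -> cubic p p6 p -> p6 = -1 /\ [\/ p = 3, p = 1 | p = -1].
Proof.
move=> h6; by_dimension m p ((4 * m%:R - 7 - p6) / 2 : R) => c;
  case: h6 c => -> c;
  first [by exfalso; lra|by split=> //; first [by constructor 1; lra|by constructor 2; lra|by constructor 3; lra]].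
Qed.

Lemma cubic_order8 p3 p (m : nat) : [\/ p3 = 3, p3 = 1 | p3 = -1] -> (m <= 7)%N ->
  6 + 2 * p3 + 4 * p = 8 * m%:R -> cubic p p3 p -> (p3 = 3 /\ p = -1) \/ p3 = -1.
Proof.
move=> h3; by_dimension m p ((8 * m%:R - 6 - 2 * p3) / 4 : R) => c;
  case: h3 c => -> c; first [by right|by exfalso; lra|by left; split=> //; lra].
Qed.

Lemma cubic_order6 p (m : nat) : (m <= 7)%N -> 2 + 2 * p = 6 * m%:R ->
  cubic p (-2) (-1) -> p = 2 \/ p = -1.
Proof.
by_dimension m p ((6 * m%:R - 2) / 2 : R) => c;
  first [by left; lra|by right; lra|by exfalso; lra].
Qed.

(** The fixed space on R^7 alone leaves p = p3 = -1, p2 = 2 open; there the dimension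
    n on the adjoint representation would be 30 / 12. *)
Lemma cubic_order12 p2 p3 p (m n : nat) : p2 = 2 \/ p2 = -1 -> p3 = 3 \/ p3 = -1 ->
  (m <= 7)%N -> 2 + 2 * p3 + 2 * p2 + 4 * p = 12 * m%:R -> cubic p p2 p3 ->
  let x2 a b := (a ^+ 2 - b) / 2 - a in
  14 + x2 (-1) 7 + 2 * x2 (-2) (-2) + 2 * x2 p3 (-1) + 2 * x2 p2 (-2) + 4 * x2 p p2 = 12 * n%:R ->
  [/\ p2 = 2, p3 = 3 & p = 0].
Proof.
move=> h2 h3; by_dimension m p ((12 * m%:R - 2 - 2 * p3 - 2 * p2) / 4 : R);
  case: h2 => ->; case: h3 => -> c; try (by exfalso; lra).
- move=> hn; exfalso.
  have : 30 = (12 * n)%:R :> R by rewrite natrM -hn; field.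
  by move/eqP; rewrite eqr_nat; lia.
- by split=> //; lra.
Qed.

Lemma cubic_order7 p (m : nat) : (m <= 7)%N -> 7 + 6 * p = 7 * m%:R ->
  cubic p p p -> p != 7 -> p = 0.
Proof.
by_dimension m p ((7 * m%:R - 7) / 6 : R) => c /eqP n;
  first [by lra|by exfalso; lra|by exfalso; apply: n; lra].
Qed.

(** The fixed space of the group of order 9 generated by v and z, both of order 3,
    where the two elements z and z^-1 have trace p and the six others trace q. *)
Lemma order9 p q (m : nat) : p = 1 \/ p = -2 -> q = 1 \/ q = -2 ->
  7 + 2 * p + 6 * q = 9 * m%:R -> p = -2 /\ q = 1.
Proof.
move=> hp hq h; have m3 : (m < 3)%N.
  by rewrite -(ltr_nat R); case: hp h => ->; case: hq => -> h; lra.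
by case: m m3 h => [|[|[|m]]] // _; case: hp => ->; case: hq => -> h; split=> //; exfalso; lra.
Qed.
(** For the number q of invariants of the whole group, the values 3 and 1 of the last
    trace p give the fractions 1512 / 6048 and 756 / 6048. *)
Lemma order_count p q : p = 3 \/ p = 1 -> q = 0 \/ 1 <= q -> 378 + 378 * p <> 6048 * q.
Proof. by move=> [] -> [-> h1|h1 h2]; lra. Qed.
End Numerics.

Section FixedDimension.
Variables (F : numFieldType) (n : nat).

Lemma mxtrace_idempotent (e : 'M[F]_n) : e *m e = e -> \tr e = (\rank e)%:R.
Proof.
move=> ee; have h : row_base e *m col_base e = 1%:M.
  have h2 : (col_base e *m row_base e) *m (col_base e *m row_base e) =
      col_base e *m row_base e by rewrite mulmx_base.
  have /row_freeP[B hB] : row_free (row_base e) by rewrite row_base_free.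
  have /row_fullP[C hC] : row_full (col_base e) by rewrite col_base_full.
  move: (row_base e) (col_base e) h2 hB hC => r c h2 hB hC.
  have /= := congr1 (fun M : 'M[F]_n => C *m M *m B) h2.
  by rewrite -!mulmxA hB mulmx1 !mulmxA hC !mul1mx.
by rewrite -{1}(mulmx_base e) mxtrace_mulC h mxtrace1.
Qed.

Definition average N (h : nat -> 'M[F]_n) : 'M[F]_n := N%:R^-1 *: \sum_(k < N) h k.

Lemma average_idem N (h : nat -> 'M[F]_n) : (0 < N)%N -> h 0%N = 1%:M -> h N = 1%:M ->
  (forall a b, h (a + b)%N = h a *m h b) -> average N h *m average N h = average N h.
Proof.
move=> N0 h0 hN hD; have step : h 1%N *m (\sum_(k < N) h k) = \sum_(k < N) h k.
  apply: (addrI (h 0%N)); rewrite mulmx_sumr.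
  under eq_bigr => k _ do rewrite -hD add1n.
  rewrite -(big_ord_recl N (fun k : 'I_N.+1 => h k)).
  by rewrite big_ord_recr /= hN -h0 addrC.
have fixS k : h k *m (\sum_(k < N) h k) = \sum_(k < N) h k.
  elim: k => [|k IH]; first by rewrite h0 mul1mx.
  by rewrite -addn1 hD -mulmxA step.
rewrite /average -scalemxAl -scalemxAr mulmx_suml.
under eq_bigr => k _ do rewrite fixS.
rewrite sumr_const card_ord -scaler_nat [X in _ *: X]scalerA mulVf ?scale1r //.
by rewrite pnatr_eq0 -lt0n.
Qed.

Lemma sum_trace_idem N (S : 'M[F]_n) : (0 < N)%N ->
  let e := N%:R^-1 *: S in e *m e = e -> exists2 m, (m <= n)%N & \tr S = N%:R * m%:R.
Proof.
move=> N0 e /mxtrace_idempotent h; exists (\rank e); first exact: rank_leq_row.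
by rewrite -h mxtraceZ mulrA mulfV ?mul1r // pnatr_eq0 -lt0n.
Qed.

(** The average over a cyclic group is an idempotent, whose trace is the dimension
    of the fixed space. *)
Lemma sum_trace_periodic N (h : nat -> 'M[F]_n) : (0 < N)%N -> h 0%N = 1%:M -> h N = 1%:M ->
  (forall a b, h (a + b)%N = h a *m h b) ->
  exists2 m, (m <= n)%N & \sum_(k < N) \tr (h k) = N%:R * m%:R.
Proof.
move=> N0 h0 hN hD; have [m mn e] := sum_trace_idem N0 (average_idem N0 h0 hN hD).
by exists m => //; rewrite -e raddf_sum.
Qed.

Lemma sum_trace_periodic2 N (h h' : nat -> 'M[F]_n) : (0 < N)%N ->
  h 0%N = 1%:M -> h N = 1%:M -> (forall a b, h (a + b)%N = h a *m h b) ->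
  h' 0%N = 1%:M -> h' N = 1%:M -> (forall a b, h' (a + b)%N = h' a *m h' b) ->
  (forall a b, h a *m h' b = h' b *m h a) ->
  exists m, \sum_(j < N) \sum_(k < N) \tr (h j *m h' k) = (N * N)%:R * m%:R.
Proof.
move=> N0 h0 hN hD h0' hN' hD' hC.
have e1 := average_idem N0 h0 hN hD; have e2 := average_idem N0 h0' hN' hD'.
set S := \sum_(j < N) \sum_(k < N) (h j *m h' k).
have SE : (N * N)%:R^-1 *: S = average N h *m average N h'.
  rewrite /average -scalemxAl -scalemxAr scalerA natrM invfM mulmx_suml.
  by congr (_ *: _); apply: eq_bigr => j _; rewrite mulmx_sumr.
have comm : average N h *m average N h' = average N h' *m average N h.
  rewrite /average -!scalemxAl -!scalemxAr; congr (_ *: (_ *: _)).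
  rewrite mulmx_suml mulmx_sumr; apply: eq_bigr => j _.
  by rewrite mulmx_sumr mulmx_suml; apply: eq_bigr => k _.
have NN : (0 < N * N)%N by rewrite muln_gt0 N0.
have [|m _ e] := @sum_trace_idem (N * N) S NN.
  rewrite SE -!mulmxA [X in _ *m X]mulmxA -comm -[X in _ *m X]mulmxA e2.
  by rewrite mulmxA e1.
by exists m; rewrite -e raddf_sum; apply: eq_bigr => j _; rewrite raddf_sum.
Qed.

Lemma sum_trace_group (gT : finGroupType) (G : {group gT}) (rG : mx_representation F G n) :
  exists m, \sum_(g in G) \tr (rG g) = #|G|%:R * m%:R.
Proof.
set S := \sum_(g in G) rG g.
have fixS x : x \in G -> rG x *m S = S.
  move=> Gx; rewrite /S mulmx_sumr [RHS](reindex_inj (mulgI x)) /=.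
  apply: eq_big => g; first by rewrite groupMl.
  by move=> Gg; rewrite repr_mxM.
have G0 : #|G|%:R != 0 :> F by rewrite pnatr_eq0 -lt0n cardG_gt0.
have [|m _ e] := @sum_trace_idem #|G| S (cardG_gt0 G).
  rewrite -scalemxAl -scalemxAr mulmx_suml (eq_bigr (fun=> S)) //.
  by rewrite sumr_const -scaler_nat [X in _ *: X]scalerA mulVf ?scale1r.
by exists m; rewrite -e raddf_sum.
Qed.
End FixedDimension.

(** * Traces of an embedded group *)

Section EmbeddingTraces.
Variables (R : realType) (gT : finGroupType) (Gam : {group gT}) (iota : G2_embedding R Gam).

Definition tr7 (g : gT) : R := \tr (iota g).
(** The trace on the Lie algebra, in the form of mxtrace_rho2. *)
Definition tr14 (g : gT) : R := (tr7 g ^+ 2 - tr7 (g ^+ 2)%g) / 2 - tr7 g.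

Lemma emb1 : iota 1%g = 1%:M.
Proof. by have [-> _] := emb_repr iota. Qed.

Lemma tr7_1 : tr7 1%g = 7.
Proof. by rewrite /tr7 emb1 mxtrace1. Qed.

Lemma tr7_sqr g : g \in Gam -> tr7 (g ^+ 2)%g = \tr (iota g *m iota g).
Proof. by move=> Gg; rewrite /tr7 expgS expg1 embM. Qed.

Lemma tr7_cubic g : g \in Gam -> cubic (tr7 g) (tr7 (g ^+ 2)%g) (tr7 (g ^+ 3)%g).
Proof.
move=> Gg; have := G2_trace_cube (emb_G2 iota Gg); rewrite /cubic tr7_sqr //.
have -> : tr7 (g ^+ 3)%g = \tr (iota g *m iota g *m iota g).
  by rewrite /tr7 !expgS expg0 mulg1 !embM ?groupM // mulmxA.
done.
Qed.

Lemma tr7_conj g h k : g \in Gam -> h \in Gam -> k \in Gam ->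
  (h * g = k * h)%g -> tr7 g = tr7 k.
Proof.
move=> Gg Gh Gk e; have {e} : k = (h * g * h^-1)%g by rewrite e mulgK.
move=> ->; rewrite /tr7 !embM ?groupM ?groupV // mxtrace_mulC mulmxA -embM ?groupV //.
by rewrite mulVg emb1 mul1mx.
Qed.

Lemma tr7_inv g : g \in Gam -> tr7 g^-1%g = tr7 g.
Proof.
move=> Gg; rewrite /tr7 -[RHS]mxtrace_tr -(G2_invmx (emb_G2 iota Gg)); congr (\tr _).
have [ug _] := emb_G2 iota Gg.
rewrite -[LHS](mulmxK ug) -embM ?groupV // mulVg. by rewrite emb1 mul1mx.
Qed.

(** For an orthogonal matrix G the squared norm of G - 1 is 14 - 2 tr G. *)
Lemma tr7_faithful g : g \in Gam -> tr7 g = 7 -> g = 1%g.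
Proof.
move=> Gg t7; apply: (@emb_inj _ _ _ iota _ _ Gg (group1 Gam)); rewrite emb1.
set G := iota g; have GG := G2_orthogonal (emb_G2 iota Gg); rewrite -/G in GG.
have s0 : \sum_i \sum_j (G - 1%:M) i j ^+ 2 = 0.
  have -> : \sum_i \sum_j (G - 1%:M) i j ^+ 2 = \tr ((G - 1%:M) *m (G - 1%:M)^T).
    by apply: eq_bigr => i _; rewrite mxE; apply: eq_bigr => j _; rewrite !mxE expr2.
  rewrite linearB /= trmx1 mulmxBr mulmx1 mulmxBl mul1mx GG !raddfB /= mxtrace1 mxtrace_tr.
  by rewrite -[\tr G]/(tr7 g) t7; ring.
apply/eqP; rewrite -subr_eq0; apply/eqP/matrixP => i j; rewrite [RHS]mxE.
have := s0 => /eqP; rewrite psumr_eq0 => [/allP /(_ i (mem_index_enum i)) /= |k _]; last first.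
  by apply: sumr_ge0 => l _; exact: sqr_ge0.
rewrite psumr_eq0 => [/allP /(_ j (mem_index_enum j)) /=|l _]; last exact: sqr_ge0.
by rewrite sqrf_eq0 => /eqP.
Qed.

Lemma tr7_fixed g N : g \in Gam -> (0 < N)%N -> (g ^+ N = 1)%g ->
  exists2 m, (m <= 7)%N & \sum_(k < N) tr7 (g ^+ k)%g = N%:R * m%:R.
Proof.
move=> Gg N0 gN; apply: (@sum_trace_periodic _ _ N (fun k => iota (g ^+ k)%g)) => //.
- by rewrite expg0 emb1.
- by rewrite gN emb1.
- by move=> a b; rewrite expgD embM ?groupX.
Qed.

Lemma tr7_fixed2 g h N : g \in Gam -> h \in Gam -> (0 < N)%N ->
  (g ^+ N = 1)%g -> (h ^+ N = 1)%g -> (g * h = h * g)%g ->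
  exists m, \sum_(j < N) \sum_(k < N) tr7 (g ^+ j * h ^+ k)%g = (N * N)%:R * m%:R.
Proof.
move=> Gg Gh N0 gN hN gh.
have [||a b|||a b|a b|m e] := @sum_trace_periodic2 _ _ N (fun k => iota (g ^+ k)%g) (fun k => iota (h ^+ k)%g) N0.
- by rewrite expg0 emb1.
- by rewrite gN emb1.
- by rewrite expgD embM ?groupX.
- by rewrite expg0 emb1.
- by rewrite hN emb1.
- by rewrite expgD embM ?groupX.
- rewrite -!embM ?groupX //; congr (iota _).
  exact: (commuteX2 a b (gh : commute g h)).
exists m; rewrite -e; apply: eq_bigr => j _; apply: eq_bigr => k _.
by rewrite /tr7 embM ?groupX.
Qed.

Definition lie_repr := submod_repr (lieG2_mxmodule iota).
Lemma tr14E g : g \in Gam -> \tr (lie_repr g) = tr14 g.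
Proof.
move=> Gg; rewrite /tr14 tr7_sqr //; apply: (mxtrace_rho2_aux (emb_G2 iota Gg)).
Qed.

Lemma tr14_fixed g N : g \in Gam -> (0 < N)%N -> (g ^+ N = 1)%g ->
  exists m, \sum_(k < N) tr14 (g ^+ k)%g = N%:R * m%:R.
Proof.
move=> Gg N0 gN; have [||a b|m _ e] := @sum_trace_periodic _ _ N (fun k => lie_repr (g ^+ k)%g) N0.
- by rewrite expg0 repr_mx1.
- by rewrite gN repr_mx1.
- by rewrite expgD repr_mxM ?groupX.
by exists m; rewrite -e; apply: eq_bigr => k _; rewrite tr14E ?groupX.
Qed.

Lemma tr7_group : exists m, \sum_(g in Gam) tr7 g = #|Gam|%:R * m%:R.
Proof. exact: (sum_trace_group (MxRepresentation (emb_repr iota))). Qed.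

Lemma tr14_conj g h k : g \in Gam -> h \in Gam -> k \in Gam ->
  (h * g = k * h)%g -> tr14 g = tr14 k.
Proof.
move=> Gg Gh Gk e; rewrite /tr14 (tr7_conj Gg Gh Gk e).
rewrite (@tr7_conj (g ^+ 2)%g h (k ^+ 2)%g) ?groupX //.
by rewrite !expgS !expg0 !mulg1 mulgA e -mulgA e mulgA.
Qed.

Lemma tr14_inv g : g \in Gam -> tr14 g^-1%g = tr14 g.
Proof. by move=> Gg; rewrite /tr14 expVgn !tr7_inv ?groupX. Qed.

Lemma tr_varrho1 g : \tr (varrho1 iota g) = (tr7 g)%:C%C.
Proof. exact: mxtrace_rho1. Qed.
Lemma tr_varrho2 g : g \in Gam -> \tr (varrho2 iota g) = (tr14 g)%:C%C.
Proof.
by move=> Gg; rewrite /tr14 tr7_sqr //; exact: (mxtrace_rho2 (emb_G2 iota Gg)).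
Qed.
End EmbeddingTraces.

(** * Sums over the group as sums over ten classes *)

Section Marks.

Lemma code3_inj x y p q : code3 x p = code3 y q -> x = y /\ p = q.
Proof. by case: x y => [[]|] [[]|] //= []. Qed.
Lemma code9_inj x y p q : code9 x p = code9 y q -> x = y /\ p = q.
Proof. by case: x y => [a b] [c d] /= /code3_inj[-> /code3_inj[-> ->]]. Qed.
Lemma codev_inj x y p q : codev x p = codev y q -> x = y /\ p = q.
Proof.
by case: x y => [[a b] c] [[d e] f] /= /code9_inj[-> /code9_inj[-> /code9_inj[-> ->]]].
Qed.
Lemma code_inj : injective code.
Proof.
by move=> [[u v] w] [[x y] z] /= /codev_inj[-> /codev_inj[-> /codev_inj[-> _]]].
Qed.

Variable Q : nat -> mat -> Prop.
(** An invariant of the marking: if Q t holds at the representatives and is stable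
    under conjugation by the generators, then it holds at every matrix marked t. *)
Definition marked_by (m : PositiveMap.t nat) : Prop :=
  forall t A, PositiveMap.find (code A) m = Some t -> Q t A.

Lemma marked_by_add m t A : Q t A -> marked_by m ->
  marked_by (PositiveMap.add (code A) t m).
Proof.
move=> QA mQ s B; case: (Pos.eq_dec (code B) (code A)) => [/code_inj ->|ne].
  by rewrite PositiveMap.gss => -[<-].
by rewrite PositiveMap.gso; first exact: mQ.
Qed.

Lemma mark_marked_by gs t fuel todo m :
  (forall A h, h \in gs -> Q t A -> Q t (mulmat (mulmat h.1 A) h.2)) ->
  (forall A, A \in todo -> Q t A) -> marked_by m -> marked_by (mark fuel gs t todo m).
Proof.
move=> stab; elim: fuel todo m => [|_ fuel IH] [|A todo] //= m hT mQ.
have QA : Q t A by apply: hT; rewrite mem_head.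
set visit := (fun s h => _); case E : (foldl _ _ _) => [todo1 m1].
suff [h1 h2] : (forall B, B \in todo1 -> Q t B) /\ marked_by m1 by exact: IH.
have hT' B : B \in todo -> Q t B by move=> Bt; apply: hT; rewrite inE Bt orbT.
have {hT} : forall h, h \in gs -> Q t (mulmat (mulmat h.1 A) h.2) by move=> h hg; exact: stab.
clear IH stab; elim: gs todo m hT' mQ E => [|h gs IHg] todo' m' hT mQ /=.
  by case=> <- <-.
rewrite {2}/visit /=; set B := mulmat (mulmat h.1 A) h.2.
case: (PositiveMap.find _ _) => [_|] E hg.
  by apply: (IHg _ _ hT mQ E) => k kg; apply: hg; rewrite inE kg orbT.
have QB : Q t B by apply: hg; rewrite mem_head.
apply: (IHg _ _ _ _ E) => [C|s C|k kg]; last by apply: hg; rewrite inE kg orbT.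
  by rewrite inE => /orP[/eqP ->|/hT].
exact: (marked_by_add QB mQ).
Qed.

Definition mark_class (m : PositiveMap.t nat) (t : nat) : PositiveMap.t nat :=
  let A := nth onemat reps t in
  mark SU gens t [:: A; adjmat A]
    (PositiveMap.add (code (adjmat A)) t (PositiveMap.add (code A) t m)).

Lemma marks_marked_by :
  (forall t, (t < 10)%N -> Q t (nth onemat reps t) /\ Q t (adjmat (nth onemat reps t))) ->
  (forall t A h, h \in gens -> Q t A -> Q t (mulmat (mulmat h.1 A) h.2)) ->
  marked_by marks.
Proof.
move=> hr stab; suff h s m : all (fun t => (t < 10)%N) s -> marked_by m ->
    marked_by (foldl mark_class m s).
  by apply: (h (iota 0 10)) => // t A; rewrite PositiveMap.gempty.
elim: s m => [|t s IH] m //= /andP[t10 s10] mQ; apply: IH => //.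
have [Q1 Q2] := hr t t10; apply: mark_marked_by; first exact: stab.
  by move=> A; rewrite !inE => /orP[/eqP ->|/eqP ->].
by apply: marked_by_add => //; exact: marked_by_add.
Qed.
End Marks.

Lemma uniq_SU : uniq SU.
Proof.
apply: allpairs_uniq_dep => [|u _|].
- by vm_compute.
- by rewrite filter_uniq //; vm_compute.
- by move=> [u v] [x y] _ _ /= [-> e]; move: e => /= -[->].
Qed.

Lemma reps_SU t : (t < 10)%N -> nth onemat reps t \in SU.
Proof.
have : all (fun A => A \in SU) reps by vm_compute.
by move/allP => h t10; apply: h; rewrite mem_nth.
Qed.

Lemma big_count_mem (T : eqType) (V : nmodType) (S s : seq T) (f : T -> V) :
  uniq S -> all (mem S) s ->
  \sum_(x <- s) f x = \sum_(y <- S) f y *+ count_mem y s.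
Proof.
move=> uS; elim: s => [_|x s IH /= /andP[xS sS]].
  by rewrite big_nil big1.
rewrite big_cons IH //; under [RHS]eq_bigr do rewrite mulrnDr.
rewrite big_split /=; congr (_ + _); rewrite (bigD1_seq x) //= eqxx mulr1n big1 ?addr0 //.
by move=> y; rewrite eq_sym => /negbTE ->.
Qed.

Lemma sum_tags (V : nmodType) (f : option nat -> V) (s : seq (option nat)) :
  all (mem [seq Some t | t <- iota 0 10]) s ->
  [seq count_mem (Some t) s | t <- iota 0 10] = class_sizes ->
  \sum_(x <- s) f x = \sum_(t < 10) f (Some (t : nat)) *+ nth 0%N class_sizes t.
Proof.
have uS : uniq [seq Some t | t <- iota 0 10] by [].
move=> hall cnt; rewrite (big_count_mem _ uS hall).
rewrite big_map -[RHS](big_mkord xpredT (fun t => f (Some t) *+ nth 0%N class_sizes t)).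
rewrite !big_seq; apply: eq_bigr => t; rewrite mem_iota => /andP[_ t10].
by rewrite -cnt (nth_map 0%N) ?size_iota // nth_iota.
Qed.

Lemma tags_range A : A \in SU ->
  exists2 t, (t < 10)%N & PositiveMap.find (code A) marks = Some t.
Proof.
have /and3P[_ /allP h _] := tags_check.
move=> sA; have /mapP[t] := h _ (map_f (fun A => PositiveMap.find (code A) marks) sA).
by rewrite mem_iota => /andP[_ t10] ->; exists t.
Qed.

Lemma sum_SU_tags (V : nmodType) (f : option nat -> V) :
  \sum_(A <- SU) f (PositiveMap.find (code A) marks) =
  \sum_(t < 10) f (Some (t : nat)) *+ nth 0%N class_sizes t.
Proof.
have /and3P[_ hall /eqP cnt] := tags_check.
exact: etrans (esym (big_map (fun A => PositiveMap.find (code A) marks) xpredT f))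
              (sum_tags f hall cnt).
Qed.

Section ClassSums.
Variables (R : realType) (gT : finGroupType) (Gam : {group gT}) (iota : G2_embedding R Gam).
Variable E : mat -> gT.
Hypothesis E_Gam : {in SU, forall A, E A \in Gam}.
Hypothesis EM : {in SU &, forall A B, E (mulmat A B) = (E A * E B)%g}.
Hypothesis E_inj : {in SU &, injective E}.
Hypothesis E_surj : forall g, g \in Gam -> exists2 A, A \in SU & g = E A.

Local Notation tr7 := (tr7 iota).
Local Notation tr14 := (tr14 iota).

Lemma E1 : E onemat = 1%g.
Proof.
by apply: (mulgI (E onemat)); rewrite mulg1 -EM ?onemat_SU.
Qed.
Lemma E_adj A : A \in SU -> E (adjmat A) = (E A)^-1%g.
Proof.
by move=> sA; apply: (mulIg (E A)); rewrite mulVg -EM ?adjmat_SU // mulmat_adj // E1.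
Qed.
Lemma powmat_SU A n : A \in SU -> powmat A n \in SU.
Proof. by move=> sA; elim: n => [|n IH]; [exact: onemat_SU|exact: mulmat_SU]. Qed.
Lemma EX A n : A \in SU -> E (powmat A n) = (E A ^+ n)%g.
Proof.
by move=> sA; elim: n => [|n IH]; [exact: E1|rewrite /= EM ?powmat_SU // IH expgS].
Qed.

Lemma sum_Gam_SU (V : nmodType) (F : gT -> V) :
  \sum_(g in Gam) F g = \sum_(A <- SU) F (E A).
Proof.
rewrite -(big_map E xpredT) -big_enum; apply: perm_big; apply: uniq_perm.
- exact: enum_uniq.
- by rewrite map_inj_in_uniq ?uniq_SU.
move=> g; rewrite mem_enum; apply/idP/mapP => [/E_surj[A sA ->]|[A sA ->]].
  by exists A.
exact: E_Gam.
Qed.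

Lemma card_Gam : #|Gam| = 6048.
Proof.
have := sum_Gam_SU (fun=> 1%N); rewrite sum1_card => ->.
by rewrite sum1_size; have /andP[/eqP] := tags_check.
Qed.

(** Conjugation and inversion do not change the two traces. *)
Lemma tr_marks A : A \in SU -> forall t, PositiveMap.find (code A) marks = Some t ->
  let r := E (nth onemat reps t) in tr7 (E A) = tr7 r /\ tr14 (E A) = tr14 r.
Proof.
move=> sA t; pose Q t A := A \in SU /\ let r := E (nth onemat reps t) in
  tr7 (E A) = tr7 r /\ tr14 (E A) = tr14 r.
suff : marked_by Q marks by move=> h /h [].
apply: marks_marked_by => [s s10|s B h hg [sB [e1 e2]]].
  have sr := reps_SU s10; split; split; rewrite ?adjmat_SU // /= E_adj //.
  by rewrite tr7_inv ?tr14_inv ?E_Gam.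
have [sh eh] : h.1 \in SU /\ h.2 = adjmat h.1.
  have /mapP[C hC ->] := hg; split; last by [].
  have [->|->] : C = r3b \/ C = r7; last exact: r7_SU; last exact: r3b_SU.
  by move: hC; rewrite !inE => /orP[/eqP ->|/eqP ->]; [left|right].
have sh2 : h.2 \in SU by rewrite eh adjmat_SU.
split; first by rewrite !mulmat_SU.
have e : (E h.1 * E B = E (mulmat (mulmat h.1 B) h.2) * E h.1)%g.
  by rewrite !EM ?mulmat_SU // eh E_adj // mulgKV.
have sC : mulmat (mulmat h.1 B) h.2 \in SU by rewrite !mulmat_SU.
split; [rewrite -(tr7_conj iota _ _ _ e)|rewrite -(tr14_conj iota _ _ _ e)]; rewrite ?E_Gam //.
Qed.

Lemma sum_Gam_classes (V : nmodType) (F : R -> R -> V) :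
  \sum_(g in Gam) F (tr7 g) (tr14 g) =
  \sum_(t < 10) F (tr7 (E (nth onemat reps t))) (tr14 (E (nth onemat reps t)))
                 *+ nth 0%N class_sizes t.
Proof.
rewrite sum_Gam_SU.
pose f (x : option nat) := if x is Some t then
  F (tr7 (E (nth onemat reps t))) (tr14 (E (nth onemat reps t))) else 0.
rewrite -(sum_SU_tags f) !big_seq; apply: eq_bigr => A sA.
have [t t10 e] := tags_range sA.
by rewrite e /f; have [-> ->] := tr_marks sA e.
Qed.

(** In the order of reps. *)
Definition vals7 : seq R := [:: 7; -1; -2; 1; 3; -1; 2; 0; -1; 0].
Definition vals14 : seq R := [:: 14; -2; 5; -1; 2; 2; 1; 0; 0; -1].
End ClassSums.

(** * The traces do not depend on the embedding *)

Section RepresentativeTraces.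
Variables (R : realType) (gT : finGroupType) (Gam : {group gT}) (iota : G2_embedding R Gam).
Variable E : mat -> gT.
Hypothesis E_Gam : {in SU, forall A, E A \in Gam}.
Hypothesis EM : {in SU &, forall A B, E (mulmat A B) = (E A * E B)%g}.
Hypothesis E_inj : {in SU &, injective E}.
Hypothesis E_surj : forall g, g \in Gam -> exists2 A, A \in SU & g = E A.
Local Notation tr7 := (tr7 iota).
Local Notation tr14 := (tr14 iota).
Local Notation E1 := (E1 EM).
Local Notation EX := (EX EM).

Lemma reps_E (x := E r12) :
  [seq E A | A <- reps] = [:: 1; x ^+ 6; x ^+ 4; E r3b; x ^+ 3; E r4c; x ^+ 2; E r7; E r8; x]%g.
Proof.
have -> : reps = [:: onemat; powmat r12 6; powmat r12 4; r3b; powmat r12 3; r4c; powmat r12 2;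
      r7; r8; r12] by vm_compute.
by rewrite !map_cons (EX 6 r12_SU) (EX 4 r12_SU) (EX 3 r12_SU) (EX 2 r12_SU) E1.
Qed.

Lemma tr7_expN g N k : g \in Gam -> (g ^+ N = 1)%g -> (k <= N)%N ->
  tr7 (g ^+ (N - k))%g = tr7 (g ^+ k)%g.
Proof.
move=> Gg gN kN; rewrite -[RHS](tr7_inv iota) ?groupX //; congr (tr7 _).
by apply: (mulIg (g ^+ k)%g); rewrite -expgD subnK // gN mulVg.
Qed.

Lemma rep_relations_E (x := E r12) (y := E r8) (w := E r7) (u := E r4c) (v := E r3b) :
  [/\ x ^+ 12 = 1, y * x = x ^+ 5 * y, y ^+ 2 = x ^+ 3, E h8 * y = y ^+ 5 * E h8 &
   [/\ w ^+ 7 = 1, E h7 * w = w ^+ 2 * E h7, u ^+ 2 = x ^+ 6, v ^+ 3 = 1 &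
   [/\ v * x ^+ 4 = x ^+ 4 * v, E h3 * v = (v * x ^+ 4) * E h3 &
       E h3 ^+ 2 * v = (v * x ^+ 8) * E h3 ^+ 2]]]%g.
Proof.
have X n A : A \in SU -> powmat A n \in SU by exact: powmat_SU.
have L n A B (sA : A \in SU) (sB : B \in SU) : E (mulmat (powmat A n) B) = (E A ^+ n * E B)%g.
  by rewrite (EM (X n A sA) sB) (EX n sA).
have N n A B (sA : A \in SU) (sB : B \in SU) : E (mulmat B (powmat A n)) = (E B * E A ^+ n)%g.
  by rewrite (EM sB (X n A sA)) (EX n sA).
have tw A B a b : A == B -> E A = a -> E B = b -> a = b by move=> /eqP -> -> ->.
have := rep_relations; case/and5P => e1 e2 e3 e4 /and5P[e5 e6 e7 e8 /and3P[e9 e10 e11]].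
have s4 := mulmat_SU r3b_SU (X 4%N _ r12_SU); have s8 := mulmat_SU r3b_SU (X 8%N _ r12_SU).
split.
- exact: tw e1 (EX _ r12_SU) E1.
- exact: tw e2 (EM r8_SU r12_SU) (L _ _ _ r12_SU r8_SU).
- exact: tw e3 (EX _ r8_SU) (EX _ r12_SU).
- exact: tw e4 (EM h8_SU r8_SU) (L _ _ _ r8_SU h8_SU).
split.
- exact: tw e5 (EX _ r7_SU) E1.
- exact: tw e6 (EM h7_SU r7_SU) (L _ _ _ r7_SU h7_SU).
- exact: tw e7 (EX _ r4c_SU) (EX _ r12_SU).
- exact: tw e8 (EX _ r3b_SU) E1.
split.
- exact: tw e9 (N _ _ _ r12_SU r3b_SU) (L _ _ _ r12_SU r3b_SU).
- apply: tw e10 (EM h3_SU r3b_SU) _.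
  by rewrite (EM s4 h3_SU) (N 4%N _ _ r12_SU r3b_SU).
apply: tw e11 (L 2%N _ _ h3_SU r3b_SU) _.
by rewrite (N 2%N _ _ h3_SU s8) (N 8%N _ _ r12_SU r3b_SU).
Qed.

Lemma E_neq1 A : A \in SU -> A != onemat -> (E A != 1)%g.
Proof. by move=> sA; apply: contraNN => /eqP e; apply/eqP/E_inj; rewrite ?onemat_SU // E1. Qed.

Lemma tr7_neq7 A : A \in SU -> A != onemat -> tr7 (E A) != 7.
Proof.
move=> sA nA; apply: contraNneq (E_neq1 sA nA) => /(tr7_faithful (E_Gam sA)) ->.
exact: eqxx.
Qed.

Lemma sum_ord_nat (V : nmodType) n (F : nat -> V) : \sum_(k < n) F k = \sum_(0 <= k < n) F k.
Proof. by rewrite big_mkord. Qed.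

(** All values follow from three facts: multiplicities of the trivial
    representation are natural numbers, the cubic relation holds, and
    conjugate or inverse elements have the same trace. The embedding does not
    enter otherwise. *)
Lemma rep_traces : map (fun A => tr7 (E A)) reps = vals7 R /\
  map (fun A => tr14 (E A)) reps = vals14 R.
Proof.
rewrite !(map_comp _ E reps) reps_E.
set x := E r12; set y := E r8; set w := E r7; set u := E r4c; set v := E r3b.
have [x12 yx yy h8y [w7 h7w uu v3 [vx h3v h3v2]]] := rep_relations_E.
rewrite -/x -/y -/w -/u -/v in x12 yx yy h8y w7 h7w uu v3 vx h3v h3v2.
have Gx : x \in Gam by apply/E_Gam/r12_SU.
have Gy : y \in Gam by apply/E_Gam/r8_SU.
have Gw : w \in Gam by apply/E_Gam/r7_SU.
have Gu : u \in Gam by apply/E_Gam/r4c_SU.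
have Gv : v \in Gam by apply/E_Gam/r3b_SU.
have Gh3 : E h3 \in Gam by apply/E_Gam/h3_SU.
have Gh7 : E h7 \in Gam by apply/E_Gam/h7_SU.
have Gh8 : E h8 \in Gam by apply/E_Gam/h8_SU.
pose p k := tr7 (x ^+ k)%g.
have p0 : p 0%N = 7 by rewrite /p expg0 tr7_1.
have p1 : p 1%N = tr7 x by rewrite /p expg1.
have pmod k : p k = p (k %% 12)%N by rewrite /p expg_mod.
have pN k : (k <= 12)%N -> p (12 - k)%N = p k by exact: tr7_expN.
have p5 : p 5%N = p 1%N by rewrite p1 (tr7_conj iota Gx Gy _ yx) ?groupX.
have p7 : p 7%N = p 1%N by rewrite -p5 -(pN 5%N).
have p11 := pN 1%N isT; have p10 := pN 2%N isT; have p9 := pN 3%N isT; have p8 := pN 4%N isT.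
rewrite /= in p11 p10 p9 p8.
have cub k : cubic (p k) (p (k * 2)%N) (p (k * 3)%N).
  by rewrite /p !expgM; apply: tr7_cubic; rewrite groupX.
have fixed n k : (0 < n)%N -> (k * n %% 12 = 0)%N -> exists2 m, (m <= 7)%N &
    \sum_(0 <= j < n) p (k * j)%N = n%:R * m%:R.
  move=> n0 kn; have [|m m7 e] := tr7_fixed iota (groupX k Gx) n0.
    by rewrite -expgM -(expg_mod _ x12) kn expg0.
  by exists m => //; rewrite -e big_mkord; apply: eq_bigr => j _; rewrite /p expgM.
have n6 : p 6%N != 7.
  rewrite /p -(EX 6%N r12_SU); apply: tr7_neq7; first exact: powmat_SU r12_SU.
  by vm_compute.
have n4 : p 4%N != 7.
  rewrite /p -(EX 4%N r12_SU); apply: tr7_neq7; first exact: powmat_SU r12_SU.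
  by vm_compute.
have nv : tr7 v != 7 by apply: tr7_neq7; [exact: r3b_SU|vm_compute].
have nw : tr7 w != 7 by apply: tr7_neq7; [exact: r7_SU|vm_compute].
(* In order 2 and 3 the fixed space and the cubic relation leave two values. The
   choice between them comes from elements of order 4 and from a group of
   order 9. *)
have c6 : p 6%N = -1 \/ p 6%N = -3.
  have [m m7] := fixed 2%N 6%N isT erefl; rewrite !big_nat_recr //= big_geq // add0r p0 => h.
  apply: (cubic_order2 m7 h _ n6); have := cub 6%N.
  by rewrite (pmod (6 * 2)%N) (pmod (6 * 3)%N) p0.
have c4 : p 4%N = 1 \/ p 4%N = -2.
  have [m m7] := fixed 3%N 4%N isT erefl; rewrite !big_nat_recr //= big_geq // add0r p0 p8 => h.
  apply: (cubic_order3 m7 _ _ n4); first by rewrite -h; ring.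
  by have := cub 4%N; rewrite (pmod (4 * 3)%N) p0 p8.
have cv : tr7 v = 1 \/ tr7 v = -2.
  have v2 : tr7 (v ^+ 2)%g = tr7 v by rewrite (tr7_expN (k := 1) Gv v3).
  have [//|m m7] := tr7_fixed iota Gv _ v3; rewrite (sum_ord_nat 3 (fun k => tr7 (v ^+ k)%g)).
  rewrite !big_nat_recr //= big_geq // add0r expg0 expg1 tr7_1 v2 => h.
  apply: (cubic_order3 m7 _ _ nv); first by rewrite -h; ring.
  by have := tr7_cubic iota Gv; rewrite v2 v3 tr7_1.
have [e4 ev] : p 4%N = -2 /\ tr7 v = 1.
  have z3 : ((x ^+ 4) ^+ 3 = 1)%g by rewrite -expgM.
  have v3z : (v ^+ 3 = 1)%g := v3.
  have [//|m] := tr7_fixed2 iota Gv (groupX 4 Gx) _ v3 z3 vx.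
  rewrite (sum_ord_nat 3 (fun j => \sum_(k < 3) tr7 (v ^+ j * (x ^+ 4) ^+ k)%g)).
  under eq_bigr => j _ do rewrite (sum_ord_nat 3 (fun k => tr7 (v ^+ j * (x ^+ 4) ^+ k)%g)).
  rewrite !big_nat_recr //= !big_geq // !add0r.
  rewrite !expg0 !expg1 !mulg1 !mul1g tr7_1 -!expgM -![tr7 (x ^+ _)%g]/(p _) p8.
  have t1 : tr7 (v * x ^+ 4)%g = tr7 v.
    by rewrite -(tr7_conj iota Gv Gh3 _ h3v) // groupM ?groupX.
  have t2 : tr7 (v * x ^+ 8)%g = tr7 v.
    by rewrite -(tr7_conj iota Gv _ _ h3v2) ?groupM ?groupX.
  have v2 : (v ^+ 2 = v^-1)%g by apply: (mulIg v); rewrite mulVg -expgSr.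
  have x8 : (x ^+ 8 = (x ^+ 4)^-1)%g by apply: (mulIg (x ^+ 4)%g); rewrite mulVg -expgD.
  have vx' : (v^-1 * (x ^+ 4)^-1 = (x ^+ 4)^-1 * v^-1)%g by rewrite -!invMg vx.
  have vx8 : (v * x ^+ 8 = x ^+ 8 * v)%g.
    by rewrite x8; exact: (commuteV (vx : commute v (x ^+ 4)%g)).
  have t3 : tr7 (v ^+ 2 * x ^+ 4)%g = tr7 v.
    have -> : (v ^+ 2 * x ^+ 4 = (v * x ^+ 8)^-1)%g by rewrite vx8 invMg v2 x8 invgK.
    by rewrite tr7_inv ?groupM ?groupX.
  have t4 : tr7 (v ^+ 2 * x ^+ 8)%g = tr7 v.
    have -> : (v ^+ 2 * x ^+ 8 = (v * x ^+ 4)^-1)%g by rewrite invMg v2 x8 vx'.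
    by rewrite tr7_inv ?groupM ?groupX.
  rewrite t1 t2 t3 t4 v2 tr7_inv // => h; apply: (order9 (m := m) c4 cv).
  by rewrite -h; ring.
(* r8 is conjugate to its fifth power and r8^2 = r12^3, so that the fixed space of
   r8 relates its trace to that of r12^3. *)
have [e6 c3] : p 6%N = -1 /\ [\/ p 3%N = 3, p 3%N = 1 | p 3%N = -1].
  have [m m7] := fixed 4%N 3%N isT erefl; rewrite !big_nat_recr //= big_geq // add0r p0 p9 => h.
  apply: (cubic_order4 c6 m7); first by rewrite -h; ring.
  by have := cub 3%N; rewrite p9.
have y8 : (y ^+ 8 = 1)%g by rewrite (expgM y 2 4) yy -expgM.
have y5 : tr7 (y ^+ 5)%g = tr7 y by rewrite (tr7_conj iota Gy Gh8 _ h8y) ?groupX.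
have y3 : tr7 (y ^+ 3)%g = tr7 y by rewrite (tr7_expN (k := 5) Gy y8).
have y7 : tr7 (y ^+ 7)%g = tr7 y by rewrite (tr7_expN (k := 1) Gy y8).
have yE j : tr7 (y ^+ (2 * j))%g = p (3 * j)%N by rewrite expgM yy -expgM.
have c8 : (p 3%N = 3 /\ tr7 y = -1) \/ p 3%N = -1.
  have [//|m m7] := tr7_fixed iota Gy _ y8; rewrite (sum_ord_nat 8 (fun k => tr7 (y ^+ k)%g)).
  rewrite !big_nat_recr //= big_geq // add0r expg0 expg1 tr7_1 y3 y5 y7.
  rewrite (yE 1%N) (yE 2%N) (yE 3%N) /= p9 e6 => h.
  apply: (cubic_order8 c3 m7); first by rewrite -h; ring.
  by have := tr7_cubic iota Gy; rewrite y3 (yE 1%N).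
have c2 : p 2%N = 2 \/ p 2%N = -1.
  have [m m7] := fixed 6%N 2%N isT erefl.
  rewrite !big_nat_recr //= big_geq // add0r p0 p8 p10 e4 e6 => h.
  apply: (cubic_order6 m7); first by rewrite -h; ring.
  by have := cub 2%N; rewrite e4 e6.
have p14 k : tr14 (x ^+ k)%g = (p k ^+ 2 - p (k * 2)%N) / 2 - p k by rewrite /p expgM.
have [e2 e3 e1] : [/\ p 2%N = 2, p 3%N = 3 & p 1%N = 0].
  have [m m7] := fixed 12%N 1%N isT erefl.
  rewrite !big_nat_recr //= big_geq // add0r p0 p5 p7 p8 p9 p10 p11 e4 e6 => h.
  have [//|n] := tr14_fixed iota Gx _ x12; rewrite (sum_ord_nat 12 (fun k => tr14 (x ^+ k)%g)).
  rewrite !big_nat_recr //= big_geq // add0r !p14.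
  rewrite (pmod (6 * 2)%N) (pmod (7 * 2)%N) (pmod (8 * 2)%N) (pmod (9 * 2)%N) (pmod (10 * 2)%N).
  rewrite (pmod (11 * 2)%N) /= p0 p5 p7 p8 p9 p10 p11 e4 e6 => h14.
  have c3' : p 3%N = 3 \/ p 3%N = -1 by case: c8 => [[-> _]|->]; [left|right].
  apply: (cubic_order12 (m := m) (n := n) c2 c3' m7); first by rewrite -h; ring.
    exact: (cub 1%N).
  by rewrite -h14; field.
have ey : tr7 y = -1 by case: c8 => [[]//|]; rewrite e3 => /eqP; lra.
(* r7 is conjugate to its square, so its nontrivial powers have the same trace. *)
have wconj k : tr7 (w ^+ (2 * k))%g = tr7 (w ^+ k)%g.
  rewrite (tr7_conj iota (groupX k Gw) Gh7 (groupX (2 * k) Gw)) //.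
  elim: k => [|k IH]; first by rewrite !expg0 mulg1 mul1g.
  by rewrite mulnS expgS mulgA h7w -mulgA IH mulgA -expgD.
have w2 := wconj 1%N; have w4 := wconj 2%N; rewrite /= expg1 in w2; rewrite /= w2 in w4.
have wN k : (k <= 7)%N -> tr7 (w ^+ (7 - k))%g = tr7 (w ^+ k)%g by exact: tr7_expN.
have w6 := wN 1%N isT; have w5 := wN 2%N isT; have w3 := wN 4%N isT.
rewrite /= ?expg1 ?w2 ?w4 in w6 w5 w3.
have ew : tr7 w = 0.
  have [//|m m7] := tr7_fixed iota Gw _ w7; rewrite (sum_ord_nat 7 (fun k => tr7 (w ^+ k)%g)).
  rewrite !big_nat_recr //= big_geq // add0r expg0 expg1 tr7_1 w2 w3 w4 w5 w6 => h.
  apply: (cubic_order7 m7 _ _ nw); first by rewrite -h; ring.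
  by have := tr7_cubic iota Gw; rewrite w2 w3.
(* For r4c the fixed space leaves three values; the fixed space of the whole group
   decides between them. *)
have u4 : (u ^+ 4 = 1)%g by rewrite (expgM u 2 2) uu -expgM.
have u2 : tr7 (u ^+ 2)%g = -1 by rewrite uu.
have u3 : tr7 (u ^+ 3)%g = tr7 u by rewrite (tr7_expN (k := 1) Gu u4).
have eu : tr7 u = -1.
  have cu : [\/ tr7 u = 3, tr7 u = 1 | tr7 u = -1].
    have [//|m m7] := tr7_fixed iota Gu _ u4; rewrite (sum_ord_nat 4 (fun k => tr7 (u ^+ k)%g)).
    rewrite !big_nat_recr //= big_geq // add0r expg0 expg1 tr7_1 u3 u2 => h.
    have [] := @cubic_order4 R (-1) (tr7 u) m _ m7; [by left|by rewrite -h; ring| |by []].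
    by have := tr7_cubic iota Gu; rewrite u2 u3.
  have [m] := tr7_group iota.
  have -> : \sum_(g in Gam) tr7 g =
      \sum_(t < 10) tr7 (E (nth onemat reps t)) *+ nth 0%N class_sizes t.
    exact: (sum_Gam_classes iota E_Gam EM E_inj E_surj (fun a b => a)).
  rewrite (card_Gam E_Gam E_inj E_surj).
  have nr t : E (nth onemat reps t) = nth (E onemat) (map E reps) t.
    have [t10|t10] := ltnP t 10; first by rewrite (nth_map onemat).
    by rewrite !nth_default.
  under eq_bigr => t _ do rewrite nr.
  rewrite reps_E -/x -/y -/w -/u -/v !big_ord_recl big_ord0 /=.
  rewrite -/(p 6%N) -/(p 4%N) -/(p 3%N) -/(p 2%N) tr7_1 -p1 e1 e2 e3 e4 e6 ev ew ey => h.
  have : 378 + 378 * tr7 u = 6048 * m%:R by rewrite -h; ring.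
  have m0 : m%:R = 0 :> R \/ 1 <= m%:R :> R by case: (m) => [|k]; [left|right; rewrite ler1n].
  by case: cu => // e h1; exfalso; apply: order_count h1 => //; [left|right].
split; rewrite [map _ _]/=.
  by rewrite -/(p 6%N) -/(p 4%N) -/(p 3%N) -/(p 2%N) tr7_1 -p1 e1 e2 e3 e4 e6 ev ew ey eu.
rewrite !p14 (pmod (6 * 2)%N) /= p0 p8 e6 e4 e3 e2.
have -> : tr14 x = -1 by have := p14 1%N; rewrite expg1 e1 e2 => ->; field.
rewrite /tr14 w2 ew ey eu u2 (yE 1%N) e3 expg1n tr7_1 ev.
have -> : tr7 (v ^+ 2)%g = tr7 v by rewrite (tr7_expN (k := 1) Gv v3).
by rewrite ev /vals14; congr [:: _; _; _; _; _; _; _; _; _; _]; field.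
Qed.
End RepresentativeTraces.

Section GamValues.
Variables (R : realType) (gT : finGroupType) (Gam : {group gT}) (iota : G2_embedding R Gam).
Hypothesis hGam : Gam \isog PU33.

Lemma card_PU33_isog : #|Gam| = 6048.
Proof. by have [E [EG _ Ei Es]] := PU33_model hGam; exact: card_Gam EG Ei Es. Qed.

Lemma sum_Gam_values (V : nmodType) (F : R -> R -> V) :
  \sum_(g in Gam) F (tr7 iota g) (tr14 iota g) =
  \sum_(t < 10) F (nth 0 (vals7 R) t) (nth 0 (vals14 R) t) *+ nth 0%N class_sizes t.
Proof.
have [E [EG EM Ei Es]] := PU33_model hGam.
have [t7 t14] := rep_traces iota EG EM Ei Es.
rewrite (sum_Gam_classes iota EG EM Ei Es); apply: eq_bigr => t _.
rewrite -t7 -t14 !(nth_map onemat) //; exact: ltn_ord.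
Qed.
End GamValues.

(** * The moments of the McKay graphs *)

Section McKayMoments.
Variables (R : realType) (gT : finGroupType) (Gam : {group gT}).
Local Notation F := R[i]%C.
Local Notation sG := (Defs.irrs R Gam).

Lemma pchar_complex_group : ([pchar F]^'.-group Gam)%g.
Proof. by apply: sub_pgroup (pgroup_pi Gam) => p _; rewrite inE /= pchar_num. Qed.

Lemma sum_irr_mult n (rG : mx_representation F Gam n) g : g \in Gam ->
  \sum_(k : sG) (irr_mult rG k)%:R * \tr (irr_repr k g) = \tr (rG g).
Proof.
move=> Gg; have cG := pchar_complex_group; set sr := DecSocleType rG.
have sE : (Socle sr :=: 1%:M)%MS.
  by rewrite (reducible_Socle1 sr (mx_Maschke_pchar rG cG)).
rewrite -(mxtrace_submod1 (Socle_module sr) sE Gg) (mxtrace_Socle sr Gg).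
rewrite [RHS](partition_big (fun W : sr => irr_comp sG (socle_repr W)) xpredT) //=.
apply: eq_bigr => k _; rewrite /irr_mult natr_sum mulr_suml.
apply: eq_bigr => W /eqP Wk; rewrite mulr_natl; congr (_ *+ _).
by rewrite (mxtrace_rsim (rsim_irr_comp_pchar sG cG (socle_irr W)) Gg) Wk.
Qed.

Lemma irr_mult_tensor n (rG : mx_representation F Gam n) (i : sG) g : g \in Gam ->
  \sum_(k : sG) (irr_mult (prod_repr (irr_repr i) rG) k)%:R * \tr (irr_repr k g)
  = \tr (irr_repr i g) * \tr (rG g).
Proof. by move=> Gg; rewrite sum_irr_mult // mxtrace_prod. Qed.

(** The sum of the matrices of a nontrivial irreducible representation has its image
    in the fixed space, which is zero by irreducibility. *)
Lemma sum_irr_trace (k : sG) :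
  \sum_(g in Gam) \tr (irr_repr k g) = #|Gam|%:R * (k == [1 sG]%irr)%:R.
Proof.
have cG := pchar_complex_group.
have [->|k1] := eqVneq k; rewrite ?mulr1 ?mulr0.
  rewrite (eq_bigr (fun=> 1)) => [|g Gg]; last by rewrite irr1_repr // mxtrace1 degree_irr1.
  by rewrite sumr_const.
rewrite -raddf_sum /=; set S := \sum_(g in Gam) irr_repr k g.
suff -> : S = 0 by rewrite mxtrace0.
apply/eqP; apply: contraNT k1 => S0.
have fixS x : x \in Gam -> S *m irr_repr k x = S.
  move=> Gx; rewrite /S mulmx_suml [RHS](reindex_inj (mulIg x)) /=.
  apply: eq_big => g; first by rewrite groupMr.
  by move=> Gg; rewrite repr_mxM.
have /mx_irrP[d0 irrk] := socle_irr k.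
pose V := rfix_mx (irr_repr k) Gam.
have V0 : V != 0.
  apply: contraNneq S0 => V0; rewrite -submx0 -V0.
  by apply/rfix_mxP.
have /row_fullP[D DV] := irrk V (rfix_mx_module _) V0.
have triv x : x \in Gam -> irr_repr k x = 1%:M.
  by move=> Gx; rewrite -[LHS]mul1mx -DV -mulmxA rfix_mx_id.
have d1 : irr_degree k = 1%N.
  pose U := <<row (Ordinal d0) 1%:M>>%MS : 'M[F]_(irr_degree k).
  have rU : \rank U = 1%N by rewrite genmxE rowE mulmx1 mxrank_delta.
  have /eqP h : \rank U == irr_degree k.
    apply: irrk; first by apply/mxmoduleP => x Gx; rewrite triv // mulmx1.
    by rewrite -mxrank_eq0 rU.
  by rewrite -h rU.
rewrite -(irr_reprK_pchar cG k) -(irr_reprK_pchar cG [1 sG]%irr); apply/eqP.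
apply: irr_comp_rsim_pchar => //.
have e1 : irr_degree k = irr_degree [1 sG]%irr by rewrite d1 degree_irr1.
apply: (MxReprSim (B := castmx (erefl, e1) 1%:M)) => //.
  suff h n (e : irr_degree k = n) :
      row_free (castmx (erefl, e) (1%:M : 'M[F]_(irr_degree k))) by exact: h.
  by case: n / e; rewrite castmx_id /row_free mxrank1.
move=> x Gx; rewrite triv // irr1_repr // mul1mx mulmx1 //.
Qed.

Definition trace_col g : 'cV[F]_#|sG| := \col_k \tr (irr_repr (enum_val k) g).

(** The columns of the character table are joint eigenvectors of all the matrices of
    tensor products. *)
Lemma mckay_trace n (rG : mx_representation F Gam n) g : g \in Gam ->
  Defs.mckay rG *m trace_col g = \tr (rG g) *: trace_col g.
Proof.
move=> Gg; apply/colP => i; rewrite !mxE mulrC -irr_mult_tensor //.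
rewrite (reindex (@enum_val _ (mem sG))); last first.
  by exists enum_rank => x _; rewrite ?enum_valK ?enum_rankK.
by apply: eq_bigr => k _; rewrite !mxE.
Qed.

Lemma inner_estar (v : 'cV[F]_#|sG|) : inner v (estar R Gam) = v (enum_rank [1 sG]%irr) 0.
Proof.
rewrite /inner (bigD1 (enum_rank [1 sG]%irr)) //= big1 ?addr0 => [|i ni].
  by rewrite mxE !eqxx /= rmorph1 mulr1.
by rewrite mxE (negbTE ni) /= rmorph0 mulr0.
Qed.

(** This writes e_* in terms of eigenvectors of the McKay matrices. *)
Lemma sum_trace_col : \sum_(g in Gam) trace_col g = #|Gam|%:R *: estar R Gam.
Proof.
apply/colP => i; rewrite summxE !mxE; under eq_bigr => g _ do rewrite mxE.
by rewrite sum_irr_trace -(inj_eq enum_rank_inj) enum_valK eqxx andbT.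
Qed.

Lemma mckay_power n1 n2 (r1 : mx_representation F Gam n1) (r2 : mx_representation F Gam n2) m n :
  inner (Defs.mckay r1 ^+ m *m Defs.mckay r2 ^+ n *m estar R Gam) (estar R Gam) =
  #|Gam|%:R^-1 * \sum_(g in Gam) \tr (r1 g) ^+ m * \tr (r2 g) ^+ n.
Proof.
have pw k (r : mx_representation F Gam k) j g : g \in Gam ->
    Defs.mckay r ^+ j *m trace_col g = \tr (r g) ^+ j *: trace_col g.
  move=> Gg; elim: j => [|j IH]; first by rewrite !expr0 mul1mx scale1r.
  by rewrite exprSr -mulmxA mckay_trace // -scalemxAr IH scalerA exprS.
have G0 : #|Gam|%:R != 0 :> F by rewrite pnatr_eq0 -lt0n cardG_gt0.
rewrite inner_estar.
have -> : estar R Gam = #|Gam|%:R^-1 *: \sum_(g in Gam) trace_col g.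
  by rewrite sum_trace_col scalerA mulVf ?scale1r.
rewrite -scalemxAr mulmx_sumr mxE summxE; congr (_ * _); apply: eq_bigr => g Gg.
rewrite -mulmxA pw // -scalemxAr pw // scalerA !mxE enum_rankK irr1_repr //.
by rewrite mxtrace1 degree_irr1 mulr1 mulrC.
Qed.

Variable iota : G2_embedding R Gam.

Lemma mckay_momentE m n : mckay_moment iota m n =
  #|Gam|%:R^-1 * \sum_(g in Gam) (tr7 iota g)%:C%C ^+ m * (tr14 iota g)%:C%C ^+ n.
Proof.
rewrite /mckay_moment mckay_power; congr (_ * _); apply: eq_bigr => g Gg.
by rewrite tr_varrho1 tr_varrho2.
Qed.

Lemma class_momentE m n : class_moment iota m n =
  #|Gam|%:R^-1 * \sum_(g in Gam) (tr7 iota g)%:C%C ^+ m * (tr14 iota g)%:C%C ^+ n.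
Proof.
pose f g := (tr7 iota g)%:C%C ^+ m * (tr14 iota g)%:C%C ^+ n.
rewrite (sum_by_classes (F := f)) => [|g h Gg Gh]; last first.
  have e : (h * (g ^ h) = g * h)%g by rewrite -conjgC.
  by rewrite /f (tr7_conj iota _ Gh Gg e) ?(tr14_conj iota _ Gh Gg e) ?groupJ.
rewrite /class_moment mulr_sumr; apply: eq_bigr => C /repr_classesP[GC _].
by rewrite tr_varrho1 tr_varrho2 // /f [RHS]mulrCA !mulrA.
Qed.
End McKayMoments.

(** * Cosines of multiples of 2 pi / 168 *)

Section Cosines.
Variable R : realType.
Local Notation zr := (@zr R).

Lemma zrB a b : zr (Z.sub a b) = zr a - zr b.
Proof. by rewrite -zrN -zrD. Qed.
Lemma zr_pos n : zr (Zpos n) = (Pos.to_nat n)%:R.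
Proof. by []. Qed.
Lemma zr_nat (n : nat) : zr (Z.of_nat n) = n%:R.
Proof. by case: n => [|n] //=; rewrite zr_pos SuccNat2Pos.id_succ. Qed.

Lemma zr84 : zr (Zpos 84) = 84%:R. Proof. by []. Qed.
Lemma zr168 : zr (Zpos 168) = 168%:R. Proof. by []. Qed.

(** All points of the torus that carry mass have coordinates that are 168-th roots of
    unity, 168 being the least common multiple of 1, 2, 3, 4, 6, 7, 8 and 12. *)
Definition ang (m : Z) : R := 2 * pi * (zr m / 168).
Definition cs m := cos (ang m).
Definition sn m := sin (ang m).

Lemma angD a b : ang (Z.add a b) = ang a + ang b.
Proof. by rewrite /ang zrD; field. Qed.
Lemma angN a : ang (Z.opp a) = - ang a.
Proof. by rewrite /ang zrN; field. Qed.
Lemma ang84 : ang (Zpos 84) = pi.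
Proof. by rewrite /ang zr84; field. Qed.
Lemma ang168 : ang (Zpos 168) = pi *+ 2.
Proof. by rewrite /ang zr168 mulr2n; field. Qed.

Lemma ang_period m q : ang (Z.add m (Z.mul (Zpos 168) q)) = ang m + (pi *+ 2) * zr q.
Proof. by rewrite angD /ang zrM zr168 mulr2n; field. Qed.

Lemma cos_period x q : cos (x + (pi *+ 2) * zr q) = cos x :> R.
Proof.
have h n y : cos (y + (pi *+ 2) * n%:R) = cos y :> R.
  by rewrite mulr_natr; apply: periodicn; exact: cosD2pi.
case: q => [|q|q]; first by rewrite mulr0 addr0.
  by rewrite zr_pos h.
rewrite -[RHS](h (Pos.to_nat q)) -[Zneg q]/(Z.opp (Zpos q)) zrN zr_pos mulrN.
by rewrite -[in LHS](h (Pos.to_nat q)) subrK h.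
Qed.
Lemma sin_period x q : sin (x + (pi *+ 2) * zr q) = sin x :> R.
Proof.
have h n y : sin (y + (pi *+ 2) * n%:R) = sin y :> R.
  by rewrite mulr_natr; apply: periodicn; exact: sinD2pi.
case: q => [|q|q]; first by rewrite mulr0 addr0.
  by rewrite zr_pos h.
rewrite -[RHS](h (Pos.to_nat q)) -[Zneg q]/(Z.opp (Zpos q)) zrN zr_pos mulrN.
by rewrite -[in LHS](h (Pos.to_nat q)) subrK h.
Qed.

Lemma cs_mod m : cs (Z.modulo m (Zpos 168)) = cs m.
Proof.
rewrite [in RHS](Z.div_mod m (Zpos 168)) // Z.add_comm /cs ang_period.
by rewrite cos_period.
Qed.

Lemma cs_opp m : cs (Z.sub (Zpos 168) m) = cs m.
Proof. by rewrite /cs /Z.sub angD angN ang168 addrC cosD2pi cosN. Qed.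

Lemma cs_half m : cs (Z.sub (Zpos 84) m) = - cs m.
Proof. by rewrite /cs /Z.sub angD angN ang84 addrC cosDpi cosN. Qed.

(** Sums of cosines in arithmetic progression telescope after multiplication by a
    nonzero sine. This gives the relations cs56 and cs72. *)
Lemma sin_cos_telescope k m : 2 * sn k * cs m = sn (Z.add m k) - sn (Z.sub m k).
Proof. by rewrite /sn /cs /Z.sub !angD angN sinD sinB; ring. Qed.

Lemma sn_gt0 (n : positive) : (Pos.to_nat n < 84)%N -> sn (Zpos n) != 0.
Proof.
move=> n84; rewrite gt_eqF // sin_gt0_pi // -ang84 /ang !zr_pos /=.
have n0 : (0 : R) < (Pos.to_nat n)%:R by rewrite ltr0n; lia.
have n1 : (Pos.to_nat n)%:R < 84%:R :> R by rewrite ltr_nat.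
have p0 := pi_gt0 R; apply/andP; split; first by rewrite !mulr_gt0 ?invr_gt0.
by rewrite ltr_pM2l ?mulr_gt0 // ltr_pM2r ?invr_gt0.
Qed.

Lemma sn84 : sn (Zpos 84) = 0.
Proof. by rewrite /sn ang84 sinpi. Qed.

Lemma cs56 : cs (Zpos 56) = - 2^-1.
Proof.
have n0 : sn (Zpos 28) != 0 by apply: sn_gt0.
apply: (mulfI n0); have := sin_cos_telescope (Zpos 28) (Zpos 56).
rewrite -[Z.add _ _]/(Zpos 84) -[Z.sub _ _]/(Zpos 28) sn84 => h.
by lra.
Qed.

Lemma cs72 : cs (Zpos 72) = - 2^-1 - cs (Zpos 24) - cs (Zpos 48).
Proof.
have n0 : sn (Zpos 12) != 0 by apply: sn_gt0.
apply: (mulfI n0).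
have := sin_cos_telescope (Zpos 12) (Zpos 24).
have := sin_cos_telescope (Zpos 12) (Zpos 48).
have := sin_cos_telescope (Zpos 12) (Zpos 72).
rewrite -[Z.add (Zpos 72) _]/(Zpos 84) -[Z.sub (Zpos 72) _]/(Zpos 60) sn84.
rewrite -[Z.add (Zpos 48) _]/(Zpos 60) -[Z.sub (Zpos 48) _]/(Zpos 36).
rewrite -[Z.add (Zpos 24) _]/(Zpos 36) -[Z.sub (Zpos 24) _]/(Zpos 12) => h1 h2 h3.
by rewrite !mulrBr mulrN; lra.
Qed.

(** The values 2 cos (2 pi m / 168), for m a multiple of 14, 21 or 24, as integral
   combinations of 1, sqrt 2, sqrt 3, 2 cos (2 pi / 7) and 2 cos (4 pi / 7). *)
Definition vec5 : Type := (Z * Z * Z * Z * Z)%type.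
Definition val5 (v : vec5) : R :=
  let: (a, b, c, d, e) := v in
  zr a + zr b * (2 * cs (Zpos 21)) + zr c * (2 * cs (Zpos 14))
  + zr d * (2 * cs (Zpos 24)) + zr e * (2 * cs (Zpos 48)).
Definition add5 (v w : vec5) : vec5 :=
  let: (a, b, c, d, e) := v in let: (a', b', c', d', e') := w in
  (Z.add a a', Z.add b b', Z.add c c', Z.add d d', Z.add e e').
Definition scale5 (k : Z) (v : vec5) : vec5 :=
  let: (a, b, c, d, e) := v in (Z.mul k a, Z.mul k b, Z.mul k c, Z.mul k d, Z.mul k e).

Lemma val5D v w : val5 (add5 v w) = val5 v + val5 w.
Proof.
by case: v w => [[[[a b] c] d] e] [[[[a' b'] c'] d'] e'] /=; rewrite !zrD; ring.
Qed.
Lemma val5Z k v : val5 (scale5 k v) = zr k * val5 v.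
Proof. by case: v => [[[[a b] c] d] e] /=; rewrite !zrM; ring. Qed.
End Cosines.

Definition cos_table : seq (Z * vec5) :=
  let z := Z0 in let u := Zpos 1 in let n := Zneg 1 in
  [:: (Z0, (Zpos 2, z, z, z, z)); (Zpos 84, (Zneg 2, z, z, z, z)); (Zpos 42, (z, z, z, z, z));
      (Zpos 28, (u, z, z, z, z)); (Zpos 56, (n, z, z, z, z));
      (Zpos 14, (z, z, u, z, z)); (Zpos 70, (z, z, n, z, z));
      (Zpos 21, (z, u, z, z, z)); (Zpos 63, (z, n, z, z, z));
      (Zpos 24, (z, z, z, u, z)); (Zpos 48, (z, z, z, z, u)); (Zpos 72, (n, z, z, n, n))].
Definition fold_angle (m : Z) : Z :=
  let r := Z.modulo m (Zpos 168) in if Z.leb r (Zpos 84) then r else Z.sub (Zpos 168) r.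
Definition cosv (m : Z) : option vec5 :=
  let r := fold_angle m in
  ohead [seq t.2 | t <- cos_table & Z.eqb t.1 r].

(** The list l stands for the sum of k * 2 cos (2 pi m / 168) over its pairs (k, m);
    there is no value when an angle is missing from cos_table. *)
Fixpoint cos_comb (l : seq (Z * Z)) : option vec5 :=
  if l is (k, m) :: l' then
    match cosv m, cos_comb l' with
    | Some v, Some w => Some (add5 (scale5 k v) w)
    | _, _ => None
    end
  else Some (Z0, Z0, Z0, Z0, Z0).

Section CosineValues.
Variable R : realType.
Local Notation zr := (@zr R).
Local Notation cs := (cs R).

Lemma cos_tableP t : t \in cos_table -> 2 * cs t.1 = val5 R t.2.
Proof.
have e28 : cs (Zpos 28) = 2^-1 by rewrite (cs_half R (Zpos 56)) cs56 opprK.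
have z1 : zr (Zpos 1) = 1 by []. have z0 : zr Z0 = 0 by [].
have zn : zr (Zneg 1) = -1 by []. have z2 : zr (Zpos 2) = 2 by [].
have zn2 : zr (Zneg 2) = -2 by [].
have e84 : cs (Zpos 84) = -1 by rewrite /cs ang84 cospi.
have e42 : cs (Zpos 42) = 0 by have := cs_half R (Zpos 42); rewrite -[Z.sub _ _]/(Zpos 42); lra.
have e70 : cs (Zpos 70) = - cs (Zpos 14) := cs_half R (Zpos 14).
have e63 : cs (Zpos 63) = - cs (Zpos 21) := cs_half R (Zpos 21).
have e0 : cs Z0 = 1.
  by rewrite -[Z0]/(Z.sub (Zpos 84) (Zpos 84)) cs_half e84 opprK.
rewrite !inE; repeat case/orP; move=> /eqP ->;
  by rewrite /= ?z0 ?z1 ?zn ?z2 ?zn2 ?e0 ?e84 ?e42 ?e28 ?(cs56 R) ?e70 ?e63 ?(cs72 R); field.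
Qed.

Lemma cosvP m v : cosv m = Some v -> 2 * cs m = val5 R v.
Proof.
rewrite /cosv => h; have -> : cs m = cs (fold_angle m).
  by rewrite /fold_angle; case: ifP => _; rewrite ?cs_opp cs_mod.
case E : [seq t <- cos_table | Z.eqb t.1 (fold_angle m)] h => [//|t s] /= [<-].
have : t \in [seq t <- cos_table | Z.eqb t.1 (fold_angle m)] by rewrite E mem_head.
by rewrite mem_filter => /andP[/Z.eqb_eq <- /cos_tableP].
Qed.

Lemma cos_combP l v : cos_comb l = Some v ->
  \sum_(t <- l) zr t.1 * (2 * cs t.2) = val5 R v.
Proof.
elim: l v => [v [<-]|[k m] l IH v /=]; first by rewrite big_nil /= !mul0r !addr0.
case E : (cosv m) => [w|//]; case E' : (cos_comb l) => [w'|//] [<-].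
by rewrite big_cons val5D val5Z (IH _ E') (cosvP E).
Qed.

Lemma cs14_sq : (2 * cs (Zpos 14)) ^+ 2 = 3.
Proof.
have e28 : cs (Zpos 28) = 2^-1 by rewrite (cs_half R (Zpos 56)) cs56 opprK.
have : cs (Zpos 28) = cs (Zpos 14) ^+ 2 *+ 2 - 1.
  rewrite -cos_mulr2n /cs; congr (cos _).
  by rewrite -[Zpos 28]/(Z.add (Zpos 14) (Zpos 14)) angD mulr2n.
rewrite e28; nra.
Qed.
End CosineValues.

(** * Discrete measures *)

Section DiscreteMeasures.
Context d (T : measurableType d) (R : realType).
Local Open Scope ereal_scope.
Implicit Types (m : {measure set T -> \bar R}) (s : seq (R * T)).

(** Mass t.1 at the point t.2, for t in s. The equation is required on measurable
    sets only, so that products of discrete measures are included. *)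
Definition discrete_on (m : set T -> \bar R) s : Prop :=
  all (fun t => 0 <= t.1)%R s /\
  forall A, measurable A -> m A = (\sum_(t <- s) t.1 * \1_A t.2)%R%:E.

(** The absolute values make this a measure for every s. *)
Definition weighted s : set T -> \bar R :=
  msum (fun i => mscale (NngNum (normr_ge0 (nth (0%R, point) s i).1))
    (dirac (nth (0%R, point) s i).2 : {measure set T -> \bar R})) (size s).
HB.instance Definition _ s := Measure.on (weighted s).

Lemma weighted_discrete s : all (fun t => 0 <= t.1)%R s -> discrete_on (weighted s) s.
Proof.
move=> s0; split=> // A mA.
rewrite /weighted /msum /= /mscale /= (big_nth (0%R, point)) big_mkord -sumEFin.
apply: eq_bigr => i _; rewrite -[in RHS](@ger0_norm _ (nth (0%R, point) s i).1) ?EFinM //.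
by apply: (allP s0); apply: mem_nth.
Qed.

Lemma ge0_integral_discrete m s (D : set T) (f : T -> \bar R) :
    discrete_on m s -> measurable D -> measurable_fun D f -> (forall x, D x -> 0 <= f x) ->
  \int[m]_(x in D) f x = \sum_(t <- s) (t.1 * \1_D t.2)%R%:E * f t.2.
Proof.
move=> [s0 ms] mD mf f0.
rewrite (eq_measure_integral (weighted s)) => [|A mA _]; last first.
  by rewrite [LHS]ms //; apply/esym; apply: (weighted_discrete s0).2.
rewrite /weighted ge0_integral_measure_sum // (big_nth (0%R, point)) big_mkord.
apply: eq_bigr => i _; rewrite ge0_integral_mscale // integral_dirac //.
rewrite -[in RHS](@ger0_norm _ (nth (0%R, point) s i).1) ?EFinM -?muleA //.
by apply: (allP s0); apply: mem_nth.
Qed.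

Lemma integral_discrete m s (D : set T) (f : T -> R) :
    discrete_on m s -> measurable D -> measurable_fun D f ->
  \int[m]_(x in D) (f x)%:E = (\sum_(t <- s) t.1 * \1_D t.2 * f t.2)%R%:E.
Proof.
move=> ms mD mf; have mf' : measurable_fun D (EFin \o f) by exact/measurable_EFinP.
rewrite integralE !(ge0_integral_discrete ms) //; try exact: measurable_funepos;
  try exact: measurable_funeneg.
pose pos t := (t.1 * \1_D t.2 * Num.max (f t.2) 0)%R.
pose neg t := (t.1 * \1_D t.2 * Num.max (- f t.2) 0)%R.
transitivity ((\sum_(t <- s) pos t)%R%:E - (\sum_(t <- s) neg t)%R%:E).
  rewrite -!sumEFin; congr (_ - _); apply: eq_bigr => t _.
    by rewrite /pos !EFinM funeposE EFin_max.
  by rewrite /neg !EFinM funenegE EFin_max EFinN.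
rewrite -EFinB -sumrB; congr EFin; apply: eq_bigr => t _.
rewrite /pos /neg -mulrBr; congr (_ * _)%R.
by case: (leP (f t.2) 0%R) => h; case: (leP (- f t.2)%R 0%R) => h' //; lra.
Qed.

Lemma weighted_prob s : all (fun t => 0 <= t.1)%R s -> (\sum_(t <- s) t.1 = 1)%R ->
  exists mu : probability T R, discrete_on mu s.
Proof.
move=> s0 s1; have ws := weighted_discrete s0.
have w1 : weighted s setT = 1.
  by rewrite ws.2 // -[in RHS]s1; congr EFin; apply: eq_bigr => t _; rewrite indicT mulr1.
pose mu : probability T R := HB.pack (weighted s) (Measure_isProbability.Build _ _ _ (weighted s) w1).
by exists mu.
Qed.

Lemma unif_discrete (s : seq T) :
  discrete_on (unif R s) [seq ((size s)%:R^-1%R, x) | x <- s].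
Proof.
split=> [|A mA]; first by rewrite all_map; apply/allP => x _ /=; rewrite invr_ge0.
rewrite big_map -big_distrr EFinM /=; congr (_ * _).
by rewrite (big_nth point) big_mkord -sumEFin.
Qed.
End DiscreteMeasures.

Lemma prod_discrete d d' (T : measurableType d) (T' : measurableType d') (R : realType)
    (m : {measure set T -> \bar R}) (m' : {sigma_finite_measure set T' -> \bar R}) s s' :
    discrete_on m s -> discrete_on m' s' ->
  discrete_on (m \x m')%E [seq (t.1 * u.1, (t.2, u.2)) | t <- s, u <- s'].
Proof.
move=> ms ms'; split=> [|A mA].
  apply/allP => _ /allpairsP[[t u] /= [ts us ->]] /=.
  by rewrite mulr_ge0 // ?(allP ms.1) // (allP ms'.1).
rewrite [LHS](ge0_integral_discrete ms) //; last exact: measurable_fun_xsection.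
rewrite big_allpairs_dep -sumEFin; apply: eq_bigr => t _.
rewrite indicT mulr1 /= ms'.2 //; last exact: measurable_xsection.
rewrite -EFinM mulr_sumr; congr EFin; apply: eq_bigr => u _ /=.
by rewrite mulrA !indicE mem_xsection.
Qed.

(** * Characters and division points of the torus *)

Section TorusCharacters.
Variable R : realType.
Local Notation zr := (@zr R).
Local Notation T2 := (torus R).

Definition cis (x : R) : R[i]%C := (cos x +i* sin x)%C.

Lemma cisD x y : cis (x + y) = cis x * cis y.
Proof. by rewrite /cis cosD sinD; congr (_ +i* _)%C; ring. Qed.
Lemma cis0 : cis 0 = 1.
Proof. by rewrite /cis cos0 sin0. Qed.
Lemma cis_neq0 x : cis x != 0.
Proof.
apply/eqP => h; have := cisD x (- x).
by rewrite h mul0r subrr cis0 => /eqP; rewrite oner_eq0.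
Qed.
Lemma cisN x : cis (- x) = (cis x)^-1.
Proof. by apply: (mulfI (cis_neq0 x)); rewrite -cisD subrr cis0 divff ?cis_neq0. Qed.

Lemma cisZ a x : cis (zr a * x) = cis x ^ int_of_Z a.
Proof.
have cisn (n : nat) y : cis (n%:R * y) = cis y ^+ n.
  elim: n => [|n IH]; first by rewrite mul0r cis0 expr0.
  by rewrite -natr1 mulrDl mul1r cisD IH exprSr.
rewrite zrE; case: (int_of_Z a) => n; first by rewrite cisn.
by rewrite NegzE mulrNz mulNr cisN cisn.
Qed.

Lemma circle_cis (z : circle R) : cval z = cis (2 * pi * theta z).
Proof. by rewrite -[in LHS](thetaK z). Qed.

Lemma cval_inj : injective (@cval R).
Proof. exact: val_inj. Qed.

(** The angle of the character w1 ^ a * w2 ^ b. *)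
Definition arg a b (w : T2) : R := 2 * pi * (zr a * theta w.1 + zr b * theta w.2).
Definition tcos a b w := cos (arg a b w).

Lemma argN a b w : arg (Z.opp a) (Z.opp b) w = - arg a b w.
Proof. by rewrite /arg !zrN; ring. Qed.

Lemma cis_arg a b w : cis (arg a b w) = cval w.1 ^ int_of_Z a * cval w.2 ^ int_of_Z b.
Proof.
rewrite !circle_cis -!cisZ -cisD; congr cis.
by rewrite /arg; ring.
Qed.

Definition pt (m : Z) : circle R := expi (zr m / 168).
Definition grid (p : Z * Z) : T2 := (pt p.1, pt p.2).

Lemma cval_pt m : cval (pt m) = cis (ang R m).
Proof. by []. Qed.

Lemma cis_arg_grid a b p :
  cis (arg a b (grid p)) = cis (ang R (Z.add (Z.mul a p.1) (Z.mul b p.2))).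
Proof.
rewrite cis_arg !cval_pt -!cisZ -cisD; congr cis.
by rewrite /ang zrD !zrM; field.
Qed.

Lemma tcos_grid a b p : tcos a b (grid p) = cs R (Z.add (Z.mul a p.1) (Z.mul b p.2)).
Proof. by have [] := cis_arg_grid a b p. Qed.

Lemma tsin_grid a b p :
  sin (arg a b (grid p)) = sn R (Z.add (Z.mul a p.1) (Z.mul b p.2)).
Proof. by have [] := cis_arg_grid a b p. Qed.

Lemma pt_mod m : pt (Z.modulo m (Zpos 168)) = pt m.
Proof.
apply: cval_inj; rewrite !cval_pt.
rewrite [in RHS](Z.div_mod m (Zpos 168)) // Z.add_comm.
by rewrite /cis ang_period cos_period sin_period.
Qed.

Definition mod168 (p : Z * Z) := (Z.modulo p.1 (Zpos 168), Z.modulo p.2 (Zpos 168)).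
Lemma grid_mod p : grid (mod168 p) = grid p.
Proof. by rewrite /grid /= !pt_mod. Qed.

Lemma chi1E w : chi1 w =
  ((1 + 2 * tcos (Zpos 1) Z0 w + 2 * tcos Z0 (Zpos 1) w + 2 * tcos (Zpos 1) (Zneg 1) w)%:C)%C.
Proof.
have two a b : ((2 * tcos a b w)%:C)%C = cis (arg a b w) + cis (arg (Z.opp a) (Z.opp b) w).
  by rewrite argN /cis cosN sinN /tcos; apply/eqP; rewrite eq_complex /=; apply/andP; split; apply/eqP; ring.
rewrite !rmorphD /= !two !cis_arg /chi1 /exprz /= !expr0 !expr1 !mulr1 !mul1r.
by ring.
Qed.

Lemma chi2E w : chi2 w =
  ((2 + 2 * tcos (Zpos 1) Z0 w + 2 * tcos Z0 (Zpos 1) w + 2 * tcos (Zpos 1) (Zneg 1) w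
   + 2 * tcos (Zpos 1) (Zpos 1) w + 2 * tcos (Zpos 2) (Zneg 1) w
   + 2 * tcos (Zpos 1) (Zneg 2) w)%:C)%C.
Proof.
have two a b : ((2 * tcos a b w)%:C)%C = cis (arg a b w) + cis (arg (Z.opp a) (Z.opp b) w).
  by rewrite argN /cis cosN sinN /tcos; apply/eqP; rewrite eq_complex /=; apply/andP; split; apply/eqP; ring.
rewrite /chi2 chi1E !rmorphD /= !two !cis_arg /exprz /= !expr0 !expr1 !mulr1 !mul1r.
by ring.
Qed.
End TorusCharacters.

(** * Measurability on the torus, and the Weyl group *)

Section TorusMeasurability.
Variable R : realType.
Local Notation zr := (@zr R).
Local Notation T2 := (torus R).

Lemma measurable_circle_coord : measurable_fun setT (@circle_coord R).
Proof. by move=> _ B mB; rewrite setTI; exists B => //; rewrite setTI. Qed.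

Lemma measurable_to_circle d (T : measurableType d) (f : T -> circle R) :
  measurable_fun setT (fun x => complex.Re (cval (f x))) ->
  measurable_fun setT (fun x => complex.Im (cval (f x))) ->
  measurable_fun setT f.
Proof.
move=> mr mi _ _ [B mB <-]; rewrite !setTI -comp_preimage -[X in measurable X]setTI.
by apply: (measurable_fun_pair mr mi) => //; exact: measurableT.
Qed.

Lemma measurable_cos_theta :
  measurable_fun setT (fun z : circle R => cos (2 * pi * theta z)).
Proof.
rewrite (_ : (fun z => _) = fst \o @circle_coord R).
  by apply: measurableT_comp => //; exact: measurable_circle_coord.
by apply/funext => z; rewrite /= /circle_coord circle_cis.
Qed.

Lemma measurable_sin_theta :
  measurable_fun setT (fun z : circle R => sin (2 * pi * theta z)).
Proof.
rewrite (_ : (fun z => _) = snd \o @circle_coord R).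
  by apply: measurableT_comp => //; exact: measurable_circle_coord.
by apply/funext => z; rewrite /= /circle_coord circle_cis.
Qed.

(** The angle theta itself is awkward, being discontinuous. Its sine and cosine are
    coordinates, and the addition formulas propagate their measurability to
    all integral combinations of angles. *)
Definition measurable_angle (f : T2 -> R) :=
  measurable_fun setT (cos \o f) /\ measurable_fun setT (sin \o f).

Lemma measurable_angleD f g :
  measurable_angle f -> measurable_angle g -> measurable_angle (f \+ g).
Proof.
move=> [cf sf] [cg sg]; split.
  under [X in measurable_fun _ X]eq_fun => w do rewrite /= cosD.
  by apply: measurable_funB; apply: measurable_funM.
under [X in measurable_fun _ X]eq_fun => w do rewrite /= sinD.
by apply: measurable_funD; apply: measurable_funM.
Qed.

Lemma measurable_angleN f : measurable_angle f -> measurable_angle (\- f).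
Proof.
move=> [cf sf]; split.
  by under [X in measurable_fun _ X]eq_fun => w do rewrite /= cosN.
under [X in measurable_fun _ X]eq_fun => w do rewrite /= sinN.
exact: measurable_funN.
Qed.

Lemma measurable_angleZ a f : measurable_angle f -> measurable_angle (fun w => zr a * f w).
Proof.
move=> mf.
have h (n : nat) : measurable_angle (fun w => n%:R * f w).
  elim: n => [|n IH].
    by split; [rewrite (_ : _ \o _ = cst 1)|rewrite (_ : _ \o _ = cst 0)] => //;
       apply/funext => w /=; rewrite mul0r ?cos0 ?sin0.
  rewrite (_ : (fun w => _) = (fun w => n%:R * f w) \+ f); first exact: measurable_angleD.
  by apply/funext => w /=; rewrite -natr1; ring.
rewrite zrE; case: (int_of_Z a) => n; first exact: h.
rewrite (_ : (fun w => _) = \- (fun w => n.+1%:R * f w)); first exact/measurable_angleN/h.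
by apply/funext => w /=; rewrite NegzE mulrNz mulNr.
Qed.

Lemma measurable_arg a b : measurable_angle (@arg R a b).
Proof.
rewrite (_ : @arg R a b = (fun w => zr a * (2 * pi * theta w.1))
                           \+ (fun w => zr b * (2 * pi * theta w.2))); last first.
  by apply/funext => w /=; rewrite /arg; ring.
apply: measurable_angleD; apply: measurable_angleZ; split.
- exact: (measurableT_comp measurable_cos_theta measurable_fst).
- exact: (measurableT_comp measurable_sin_theta measurable_fst).
- exact: (measurableT_comp measurable_cos_theta measurable_snd).
- exact: (measurableT_comp measurable_sin_theta measurable_snd).
Qed.

Lemma measurable_tcos a b : measurable_fun setT (@tcos R a b).
Proof. exact: (measurable_arg a b).1. Qed.

Lemma measurable_tsin a b : measurable_fun setT (fun w => sin (@arg R a b w)).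
Proof. exact: (measurable_arg a b).2. Qed.

(** The matrix with rows q.1 and q.2. *)
Definition zmx (q : (Z * Z) * (Z * Z)) : 'M[int]_2 :=
  \matrix_(i, j) int_of_Z
    (nth Z0 (nth [::] [:: [:: q.1.1; q.1.2]; [:: q.2.1; q.2.2]] i) j).

Lemma zmx_act q (w : T2) :
  (cval (torus_act (zmx q) w).1 = cis (arg q.1.1 q.1.2 w)) *
  (cval (torus_act (zmx q) w).2 = cis (arg q.2.1 q.2.2 w)).
Proof. by rewrite !cis_arg /= !mxE. Qed.

Lemma measurable_zmx_act q : measurable_fun setT (@torus_act R (zmx q)).
Proof.
rewrite (_ : torus_act _ = fun w => ((torus_act (zmx q) w).1, (torus_act (zmx q) w).2)) //.
apply: measurable_fun_pair; apply: measurable_to_circle;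
  under [X in measurable_fun _ X]eq_fun => w do rewrite zmx_act;
  by [exact: (measurable_arg _ _).1 | exact: (measurable_arg _ _).2].
Qed.

Lemma zmx_act_grid q p : torus_act (zmx q) (grid R p) =
  grid R (Z.add (Z.mul q.1.1 p.1) (Z.mul q.1.2 p.2), Z.add (Z.mul q.2.1 p.1) (Z.mul q.2.2 p.2)).
Proof.
rewrite [LHS]surjective_pairing [RHS]surjective_pairing.
by congr (_, _); apply: (@cval_inj R); rewrite zmx_act cis_arg_grid cval_pt.
Qed.

Definition zmul (q r : (Z * Z) * (Z * Z)) : (Z * Z) * (Z * Z) :=
  let: ((a, b), (c, d)) := q in let: ((a', b'), (c', d')) := r in
  ((Z.add (Z.mul a a') (Z.mul b c'), Z.add (Z.mul a b') (Z.mul b d')),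
   (Z.add (Z.mul c a') (Z.mul d c'), Z.add (Z.mul c b') (Z.mul d d'))).

Lemma zmxM q r : zmx q *m zmx r = zmx (zmul q r).
Proof.
case: q r => [[a b] [c d]] [[a' b'] [c' d']]; apply/matrixP => i j.
rewrite !mxE !big_ord_recl big_ord0 !mxE addr0 /=.
by case: i => [[|[|//]] ?]; case: j => [[|[|//]] ?] /=; rewrite rmorphD !rmorphM.
Qed.

Lemma arg_zmx_act a b q (w : T2) : let: ((p, q), (r, s)) := q in
  cis (arg a b (torus_act (zmx ((p, q), (r, s))) w)) =
  cis (arg (Z.add (Z.mul a p) (Z.mul b r)) (Z.add (Z.mul a q) (Z.mul b s)) w).
Proof.
case: q => [[p q] [r s]]; rewrite cis_arg !zmx_act -!cisZ -cisD; congr cis.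
by rewrite /arg /= !zrD !zrM; ring.
Qed.

Lemma zmx_act_comp q r (w : T2) :
  torus_act (zmx q) (torus_act (zmx r) w) = torus_act (zmx (zmul q r)) w.
Proof.
rewrite [LHS]surjective_pairing [RHS]surjective_pairing.
congr (_, _); apply: (@cval_inj R); rewrite !zmx_act;
  case: q r => [[a b] [c d]] [[a' b'] [c' d']] /=.
  exact: (arg_zmx_act a b ((a', b'), (c', d'))).
exact: (arg_zmx_act c d ((a', b'), (c', d'))).
Qed.
End TorusMeasurability.

Definition D12_list : seq ((Z * Z) * (Z * Z)) :=
  let u := Zpos 1 in let n := Zneg 1 in let z := Z0 in
  [:: ((u, z), (z, u)); ((z, u), (n, u)); ((n, u), (n, z));
      ((n, z), (z, n)); ((z, n), (u, n)); ((u, n), (u, z));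
      ((z, n), (n, z)); ((u, n), (z, n)); ((u, z), (u, n));
      ((z, u), (u, z)); ((n, u), (z, u)); ((n, z), (n, u))].

Lemma D12_list_mul :
  all (fun q => all (fun r => zmul q r \in D12_list) D12_list) D12_list.
Proof. by vm_compute. Qed.
Lemma D12_list_inv :
  all (fun q => has (fun r => zmul q r == ((Zpos 1, Z0), (Z0, Zpos 1))) D12_list) D12_list.
Proof. by vm_compute. Qed.

Lemma zmx_1 : zmx ((Zpos 1, Z0), (Z0, Zpos 1)) = 1%:M.
Proof.
apply/matrixP => i j; rewrite !mxE.
by case: i => [[|[|//]] ?]; case: j => [[|[|//]] ?].
Qed.
Lemma zmx_T2 : zmx ((Z0, Zneg 1), (Zneg 1, Z0)) = T2mx.
Proof.
apply/matrixP => i j; rewrite !mxE.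
by case: i => [[|[|//]] ?]; case: j => [[|[|//]] ?].
Qed.
Lemma zmx_T6 : zmx ((Z0, Zpos 1), (Zneg 1, Zpos 1)) = T6mx.
Proof.
apply/matrixP => i j; rewrite !mxE.
by case: i => [[|[|//]] ?]; case: j => [[|[|//]] ?].
Qed.

Lemma D12P A : in_D12 A <-> exists2 q, q \in D12_list & A = zmx q.
Proof.
split.
- elim=> [|||B C _ [q qD ->] _ [r rD ->]|B _ [q qD ->]].
  + by eexists; last exact/esym/zmx_T2.
  + by eexists; last exact/esym/zmx_T6.
  + by eexists; last exact/esym/zmx_1.
  + exists (zmul q r); last by rewrite zmxM.
    by have /allP/(_ q qD)/allP/(_ r rD) := D12_list_mul.
  + have /allP/(_ q qD)/hasP[r rD /eqP e] := D12_list_inv.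
    exists r => //; have h : zmx q *m zmx r = 1%:M by rewrite zmxM e zmx_1.
    have [u _] := mulmx1_unit h.
    by rewrite -[LHS]mulmx1 -h mulKmx.
case=> q + ->; move=> {A}.
have D1 := D12_T6; rewrite -zmx_T6 in D1.
have D2 := D12_mul D1 D1; rewrite zmxM in D2.
have D3 := D12_mul D2 D1; rewrite zmxM in D3.
have D4 := D12_mul D3 D1; rewrite zmxM in D4.
have D5 := D12_mul D4 D1; rewrite zmxM in D5.
have E0 := D12_T2; rewrite -zmx_T2 in E0.
have D0 := D12_1; rewrite -zmx_1 in D0.
have E1 := D12_mul E0 D1; have E2 := D12_mul E0 D2; have E3 := D12_mul E0 D3.
have E4 := D12_mul E0 D4; have E5 := D12_mul E0 D5.
rewrite !zmxM in E1 E2 E3 E4 E5.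
by rewrite !inE; repeat case/orP; move=> /eqP ->.
Qed.

(** * Formal sums of division points *)

(** The pair (k, p) stands for the mass k, an integer, at the division point p.
    Identities between discrete measures become computations with integers. *)
Definition formal : Type := seq (Z * (Z * Z)).

Definition total (l : formal) (p : Z * Z) : Z :=
  foldr (fun t s => if Z.eqb t.2.1 p.1 && Z.eqb t.2.2 p.2 then Z.add t.1 s else s) Z0 l.
Definition normalize (l : formal) : formal := [seq (t.1, mod168 t.2) | t <- l].
Definition formal_eqb (l l' : formal) : bool :=
  let l := normalize l in let l' := normalize l' in
  all (fun t => Z.eqb (total l t.2) (total l' t.2)) (l ++ l').

Definition zact (q : (Z * Z) * (Z * Z)) (p : Z * Z) : Z * Z :=
  (Z.add (Z.mul q.1.1 p.1) (Z.mul q.1.2 p.2), Z.add (Z.mul q.2.1 p.1) (Z.mul q.2.2 p.2)).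

Section FormalSums.
Variable R : realType.
Local Notation zr := (@zr R).
Implicit Types (f : torus R -> R) (l : formal).

Definition fsum f l : R := \sum_(t <- l) zr t.1 * f (grid R t.2).

Lemma fsum_cat f l l' : fsum f (l ++ l') = fsum f l + fsum f l'.
Proof. exact: big_cat. Qed.

Lemma fsum_normalize f l : fsum f (normalize l) = fsum f l.
Proof. by rewrite /fsum big_map; apply: eq_bigr => t _ /=; rewrite grid_mod. Qed.

Lemma fsum_total f l (s : seq (Z * Z)) : uniq s -> {subset map snd l <= s} ->
  fsum f l = \sum_(p <- s) zr (total l p) * f (grid R p).
Proof.
move=> us; elim: l => [|[k q] l IH] sub.
  by rewrite /fsum big_nil big1_seq // => p _; rewrite mul0r.
rewrite /fsum big_cons -/(fsum f l) IH => [|x xl]; last by apply: sub; rewrite inE xl orbT.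
have qs : q \in s by apply: sub; rewrite mem_head.
rewrite !(bigD1_seq q) //= !Z.eqb_refl /= zrD mulrDl -addrA; congr (_ + (_ + _)).
apply: eq_bigr => p /eqP pq; case: ifP => // /andP[/Z.eqb_eq e1 /Z.eqb_eq e2].
by case: pq; rewrite (surjective_pairing p) -e1 -e2 -surjective_pairing.
Qed.

Lemma fsum_eq f l l' : formal_eqb l l' -> fsum f l = fsum f l'.
Proof.
move=> /allP h; rewrite -(fsum_normalize f l) -(fsum_normalize f l').
pose s := undup (map snd (normalize l ++ normalize l')).
have us : uniq s by exact: undup_uniq.
rewrite (@fsum_total _ (normalize l) s us) => [|x xl]; last by rewrite mem_undup map_cat mem_cat xl.
rewrite (@fsum_total _ (normalize l') s us) => [|x xl]; last by rewrite mem_undup map_cat mem_cat xl orbT.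
apply: eq_big_seq => p; rewrite mem_undup => /mapP[t ts ->].
by have /Z.eqb_eq -> := h t ts.
Qed.

Lemma fsum_const c l : fsum (fun=> c) l = zr (foldr (fun t s => Z.add t.1 s) Z0 l) * c.
Proof.
rewrite /fsum; elim: l => [|t l IH]; first by rewrite big_nil mul0r.
by rewrite big_cons IH /= zrD mulrDl.
Qed.
End FormalSums.

(** The integer n stands for the mass n / mass_unit. The unit is 98 * 12 * 6048: the
    first measure of the formula needs the denominator 672 * 49 / 16 = 2058,
    the orbit measure 12 * 6048, and both divide it. *)
Definition mass_unit : Z := Zpos 7112448.

(** For each of the ten classes, in the order of reps, the number of its elements and a
    point of the torus with the eigenvalues of these elements. *)
Definition orbit_points : formal :=
  [:: (Zpos 1, (Z0, Z0)); (Zpos 63, (Z0, Zpos 84)); (Zpos 56, (Zpos 56, Zpos 112));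
      (Zpos 672, (Z0, Zpos 112)); (Zpos 126, (Z0, Zpos 126)); (Zpos 378, (Zpos 42, Zpos 126));
      (Zpos 504, (Zpos 56, Zpos 28)); (Zpos 1728, (Zpos 24, Zpos 120));
      (Zpos 1512, (Zpos 21, Zpos 84)); (Zpos 1008, (Zpos 56, Zpos 70))].
Definition eps_formal : formal :=
  [seq (Z.mul (Zpos 98) t.1, zact q t.2) | t <- orbit_points, q <- D12_list].

Definition square_points (k m : nat) : seq (Z * Z) :=
  [seq (Z.of_nat (m * i), Z.of_nat (m * j)) | i <- iota 0 k, j <- iota 0 k].
Definition sup_points (n m : nat) : seq (Z * Z) :=
  [seq (Z.of_nat (m * q.1), Z.of_nat (m * q.2))
     | q <- [seq (q1, q2) | q1 <- iota 0 (3 * n), q2 <- iota 0 (3 * n)]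
     & (3 %| q.1 + q.2)%N].

(** The formula involves J^2 and K, both squares of sums of cosines. At the points
    that matter each sum is an integer or an integral multiple of sqrt 3, and
    its square is an integer. *)
Definition sq_comb l : option Z :=
  match cos_comb l with
  | Some (k, Z0, Z0, Z0, Z0) => Some (Z.mul k k)
  | Some (Z0, Z0, k, Z0, Z0) => Some (Z.mul (Zpos 3) (Z.mul k k))
  | _ => None
  end.

Definition J_terms (p : Z * Z) : seq (Z * Z) :=
  let: (a, b) := p in
  let comb x y := Z.add (Z.mul x a) (Z.mul y b) in
  [:: (Zpos 1, comb (Zpos 2) (Zpos 1)); (Zpos 1, comb (Zpos 1) (Zneg 3));
      (Zpos 1, comb (Zpos 3) (Zneg 2)); (Zneg 1, comb (Zpos 1) (Zpos 2));
      (Zneg 1, comb (Zpos 3) (Zneg 1)); (Zneg 1, comb (Zpos 2) (Zneg 3))].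
(** A shift by 42, a quarter of a turn, turns sines into cosines. *)
Definition K_terms (p : Z * Z) : seq (Z * Z) :=
  let: (a, b) := p in
  let comb x y := Z.sub (Z.add (Z.mul x a) (Z.mul y b)) (Zpos 42) in
  [:: (Zpos 1, comb (Zpos 1) (Zpos 1)); (Zneg 1, comb (Zpos 2) (Zneg 1));
      (Zneg 1, comb (Zneg 1) (Zpos 2))].

Definition Jz p := odflt Z0 (sq_comb (J_terms p)).
Definition Kz p := odflt Z0 (sq_comb (K_terms p)).

(** The measures of the formula in the same order, in units of mass. For the first
    one, J^2 = 16 pi^4 Jz, and 16 / (672 * 49) is 3456 units; the other
    coefficients are found likewise. The index i says which primitive 8-th
    root of unity mu is. *)
Definition formula (i : nat) : formal :=
  let c k s := [seq (k, p) | p <- s] in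
  [seq (Z.mul (Zpos 3456) (Jz p), p) | p <- square_points 7 24]
  ++ [seq (Z.mul (Zpos 3087) (Z.sub (Zpos 24) (Kz p)), p) | p <- square_points 4 42]
  ++ c (Zpos 131712) (square_points 3 56)
  ++ c (Zneg 148176) (square_points 2 84)
  ++ c (Zpos 42336) (square_points 1 168)
  ++ [seq (Z.mul (Zpos 2058) (Jz p), p) | p <- sup_points 4 14]
  ++ c (Zpos 98784) (sup_points 2 28)
  ++ c (Zneg 197568) (sup_points 1 56)
  ++ [seq (Zpos 148176, zact q (Z.of_nat (21 * i), Zpos 84)) | q <- D12_list].

(** The combinatorial content of the formula: a computation with integers. *)
Lemma formula_eps : all (fun i => formal_eqb eps_formal (formula i)) [:: 1; 3; 5; 7]%N.
Proof. by vm_compute. Qed.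

Lemma Jz_square : all (fun p => isSome (sq_comb (J_terms p))) (square_points 7 24).
Proof. by vm_compute. Qed.
Lemma Jz_sup : all (fun p => isSome (sq_comb (J_terms p))) (sup_points 4 14).
Proof. by vm_compute. Qed.
Lemma Kz_square : all (fun p => isSome (sq_comb (K_terms p))) (square_points 4 42).
Proof. by vm_compute. Qed.

Lemma eps_formal_invariant : all (fun q =>
  formal_eqb [seq (t.1, zact q t.2) | t <- eps_formal] eps_formal) D12_list.
Proof. by vm_compute. Qed.

(** * The measures of the formula as discrete measures *)

Section Densities.
Variable R : realType.
Local Notation zr := (@zr R).
Local Notation T2 := (torus R).
Local Notation fsum := (@fsum R).

Lemma expi_pt k m i : (k * m = 168)%N -> expi (i%:R / k%:R) = pt R (Z.of_nat (m * i)).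
Proof.
move=> km; rewrite /pt zr_nat -km !natrM; congr expi.
have k0 : k%:R != 0 :> R by rewrite pnatr_eq0; apply/eqP => k0; rewrite k0 in km.
have m0 : m%:R != 0 :> R by rewrite pnatr_eq0; apply/eqP => m0; rewrite m0 muln0 in km.
by field; rewrite k0 m0.
Qed.

Lemma droots_discrete k m : (k * m = 168)%N ->
  discrete_on (droots R k) [seq (k%:R^-1, pt R (Z.of_nat (m * i))) | i <- iota 0 k].
Proof.
move=> km; have := unif_discrete R [seq expi (q%:R / k%:R : R) | q <- iota 0 k].
rewrite size_map size_iota -map_comp.
rewrite (eq_map (g := fun i => (k%:R^-1, pt R (Z.of_nat (m * i))))) // => i.
by rewrite /= (expi_pt _ km).
Qed.

Lemma dxd_discrete k m : (k * m = 168)%N ->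
  discrete_on (dxd R k) [seq (k%:R^-1 * k%:R^-1, grid R p) | p <- square_points k m].
Proof.
move=> km; have := prod_discrete (droots_discrete km) (droots_discrete km).
by rewrite /square_points map_allpairs allpairs_mapl allpairs_mapr.
Qed.

Lemma dsup_discrete n m : (3 * n * m = 168)%N ->
  discrete_on (dsup R n)
    [seq ((size (sup_points n m))%:R^-1, grid R p) | p <- sup_points n m].
Proof.
move=> nm; have := unif_discrete R [seq (expi (q.1%:R / (3 * n)%:R : R), expi (q.2%:R / (3 * n)%:R : R))
       | q <- [seq (q1, q2) | q1 <- iota 0 (3 * n), q2 <- iota 0 (3 * n)]
       & (3 %| q.1 + q.2)%N].
rewrite /sup_points !size_map -!map_comp.
set s := [seq x <- _ | _] => h.
refine (eq_ind _ (discrete_on _) h _ _).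
by apply: eq_map => q /=; rewrite /grid /= !(expi_pt _ nm).
Qed.

Lemma JfunE (w : T2) : on_torus (@Jfun R) w = 8 * pi ^+ 2 *
  (tcos (Zpos 2) (Zpos 1) w + tcos (Zpos 1) (Zneg 3) w + tcos (Zpos 3) (Zneg 2) w
   - tcos (Zpos 1) (Zpos 2) w - tcos (Zpos 3) (Zneg 1) w - tcos (Zpos 2) (Zneg 3) w).
Proof.
rewrite /on_torus /Jfun /tcos /arg.
have z1 : zr (Zpos 1) = 1 by []. have z2 : zr (Zpos 2) = 2 by [].
have z3 : zr (Zpos 3) = 3 by []. have n1 : zr (Zneg 1) = -1 by [].
have n2 : zr (Zneg 2) = -2 by []. have n3 : zr (Zneg 3) = -3 by [].
by rewrite z1 z2 z3 n1 n2 n3 !mul1r !mulNr !mul1r.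
Qed.

Lemma KfunE (w : T2) : on_torus (@Kfun R) w = 4 *
  (sin (arg (Zpos 1) (Zpos 1) w) - sin (arg (Zpos 2) (Zneg 1) w)
   - sin (arg (Zneg 1) (Zpos 2) w)) ^+ 2.
Proof.
rewrite /on_torus /Kfun /arg.
have z1 : zr (Zpos 1) = 1 by []. have z2 : zr (Zpos 2) = 2 by [].
have n1 : zr (Zneg 1) = -1 by [].
rewrite z1 z2 n1 !mul1r !mulNr !mul1r.
by rewrite [- theta w.1 + _]addrC.
Qed.

Lemma sq_combP l z : sq_comb l = Some z ->
  (\sum_(t <- l) zr t.1 * (2 * cs R t.2)) ^+ 2 = zr z.
Proof.
rewrite /sq_comb; case E : (cos_comb l) => [[[[[a b] c] d] e]|//].
rewrite (cos_combP R E) /val5.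
have z0 : zr Z0 = 0 by []. have z3 : zr (Zpos 3) = 3 by [].
have h1 (x : Z) : zr x ^+ 2 = zr (Z.mul x x) by rewrite zrM expr2.
have h3 (x : Z) : (zr x * (2 * cs R (Zpos 14))) ^+ 2 = zr (Z.mul (Zpos 3) (Z.mul x x)).
  by rewrite exprMn cs14_sq !zrM z3 mulrC expr2.
by case: a E => [|a|a] E; case: b E => [|b|b] E //; case: c E => [|c|c] E //;
  case: d E => [|d|d] E //; case: e E => [|e|e] E // [<-];
  rewrite z0 !mul0r ?addr0 ?add0r; by [exact: h1 | exact: h3 | rewrite expr2 mulr0].
Qed.

Lemma Jfun_grid p : isSome (sq_comb (J_terms p)) ->
  on_torus (@Jfun R) (grid R p) ^+ 2 = 16 * pi ^+ 4 * zr (Jz p).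
Proof.
rewrite /Jz; case E : (sq_comb (J_terms p)) => [z|//] _ /=.
rewrite -(sq_combP E) JfunE !tcos_grid.
case: p E => a b _; rewrite /J_terms !big_cons big_nil /=.
have z1 : zr (Zpos 1) = 1 by []. have n1 : zr (Zneg 1) = -1 by [].
rewrite z1 n1 -[in LHS]/(Z.mul (Zpos 1) a) -[in LHS]/(Z.mul (Zpos 1) b).
by ring.
Qed.

Lemma Kfun_grid p : isSome (sq_comb (K_terms p)) ->
  on_torus (@Kfun R) (grid R p) = zr (Kz p).
Proof.
rewrite /Kz; case E : (sq_comb (K_terms p)) => [z|//] _ /=.
rewrite -(sq_combP E) KfunE !tsin_grid.
have snE m : sn R m = cs R (Z.sub m (Zpos 42)).
  rewrite /sn /cs /Z.sub angD angN.
  have -> : ang R (Zpos 42) = pi / 2.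
    have := angD R (Zpos 42) (Zpos 42); rewrite -[Z.add _ _]/(Zpos 84) ang84 => ->.
    by field.
  by rewrite cosBpihalf.
case: p E => a b _; rewrite /K_terms !big_cons big_nil !snE /=.
have z1 : zr (Zpos 1) = 1 by []. have n1 : zr (Zneg 1) = -1 by [].
rewrite z1 n1.
by ring.
Qed.

Lemma measurable_Jfun : measurable_fun setT (on_torus (@Jfun R)).
Proof.
rewrite (funext JfunE).
by apply: measurable_funM => //; do ?[apply: measurable_funB | apply: measurable_funD];
  exact: measurable_tcos.
Qed.

Lemma measurable_Kfun : measurable_fun setT (on_torus (@Kfun R)).
Proof.
rewrite (funext KfunE).
by apply: measurable_funM => //; apply: measurable_funX; apply: measurable_funB;
  first apply: measurable_funB; exact: measurable_tsin.
Qed.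

End Densities.

Lemma int_of_Z_inj : injective int_of_Z.
Proof. exact: can_inj int_of_ZK. Qed.

Lemma zmx_inj : injective zmx.
Proof.
move=> [[a b] [c d]] [[a' b'] [c' d']] /matrixP h.
have := h 0 0; have := h 0 1; have := h 1 0; have := h 1 1; rewrite !mxE /=.
by do 4 move=> /int_of_Z_inj ->.
Qed.

Section WeylGroupSums.
Variable R : realType.
Local Notation zr := (@zr R).
Local Notation T2 := (torus R).
Local Notation fsum := (@fsum R).
Local Notation N := (zr mass_unit).

Lemma sum_D12 (F : 'M[int]_2 -> \bar R) :
  (\sum_(g \in D12) F g = \sum_(q <- D12_list) F (zmx q))%E.
Proof.
have u : uniq [seq zmx q | q <- D12_list] by rewrite map_inj_uniq //; exact: zmx_inj.
rewrite -[RHS](big_map zmx xpredT F) (fsbig_seq _ _ u).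
apply: eq_fsbigl; apply/seteqP; split=> A.
  move=> /D12P[q qD ->]. exact: map_f.
by move=> /mapP[q qD ->]; apply/D12P; exists q.
Qed.

(** The four primitive roots are e^(2 pi i 21 k / 168) for k odd. *)
Lemma primitive_8th_root (mu : circle R) : 8.-primitive_root (cval mu) ->
  exists2 i, i \in [:: 1; 3; 5; 7]%N & (mu, circleN1 R) = grid R (Z.of_nat (21 * i), Zpos 84).
Proof.
move=> mu8; pose z := cval (pt R (Zpos 21)).
have zX i : z ^+ i = cval (pt R (Z.of_nat (21 * i))).
  rewrite /z !cval_pt; have <- : cis (zr (Z.of_nat i) * ang R (Zpos 21)) = cis (ang R (Zpos 21)) ^+ i.
    by rewrite cisZ exprnP; congr exprz; case: i => [|i] //=; rewrite SuccNat2Pos.id_succ.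
  by congr cis; rewrite /ang !zr_nat natrM zrE; field.
have zN1 : cval (pt R (Zpos 84)) = -1.
  by rewrite cval_pt ang84 /cis cospi sinpi; apply/eqP; rewrite eq_complex /= oppr0 !eqxx.
have z4 : z ^+ 4 = -1 by rewrite zX.
have z8 : z ^+ 8 = 1 by rewrite (exprM z 4 2) z4 sqrrN expr1n.
have z_prim : 8.-primitive_root z.
  have [m mz m8] := @prim_order_exists _ 8 z isT z8.
  suff -> : 8%N = m by [].
  have : ~~ (m %| 4)%N.
    by rewrite (prim_order_dvd mz) z4 eq_sym -subr_eq0 opprK (pnatr_eq0 _ 2).
  have : (m <= 8)%N by exact: dvdn_leq.
  by move: m8; case: (m) => [|[|[|[|[|[|[|[|[|]]]]]]]]].
have [i ei] := prim_rootP z_prim (prim_expr_order mu8).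
have ci : coprime i 8 by rewrite -(prim_root_exp_coprime i z_prim) -ei.
exists (val i); first by case: i ci {ei} => [[|[|[|[|[|[|[|[|]]]]]]]] ?].
congr (_, _); apply: (@cval_inj R); first by rewrite ei zX.
exact: esym zN1.
Qed.

Lemma sum_fsum (f : T2 -> R) (c : Z * Z -> R) (k : Z * Z -> Z) (s : seq (Z * Z)) :
    {in s, forall p, c p = zr (k p) / N} ->
  \sum_(p <- s) c p * f (grid R p) = fsum f [seq (k p, p) | p <- s] / N.
Proof.
move=> h; rewrite /fsum big_map mulr_suml; apply: eq_big_seq => p /h ->.
by rewrite mulrAC.
Qed.

End WeylGroupSums.

(** * The formula for the measure *)

Lemma Pos2Nat_neq0 p : Pos.to_nat p <> 0%N.
Proof. by have := Pos2Nat.is_pos p; lia. Qed.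

Section JointSpectralFormula.
Variable R : realType.
Local Notation zr := (@zr R).
Local Notation T2 := (torus R).
Local Notation fsum := (@fsum R).
Local Notation N := (zr mass_unit).

Definition realize (l : formal) : seq (R * T2) := [seq (zr t.1 / N, grid R t.2) | t <- l].

Lemma sum_realize (f : T2 -> R) l : \sum_(t <- realize l) t.1 * f t.2 = fsum f l / N.
Proof. by rewrite big_map /fsum mulr_suml; apply: eq_bigr => t _ /=; rewrite mulrAC. Qed.

(** Masses are compared through their denominators, which are small, because
    mass_unit itself is too large for unary arithmetic. *)
Lemma mass_frac k (j : positive) : Z.mul k (Zpos j) = mass_unit ->
  zr k / N = (Pos.to_nat j)%:R^-1.
Proof.
move=> h; have : N != 0 by rewrite zr_pos pnatr_eq0; apply/eqP; exact: Pos2Nat_neq0.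
rewrite -h zrM zr_pos mulf_eq0 negb_or => /andP[k0 _].
by rewrite invfM mulrA divff // mul1r.
Qed.

Lemma fsum_opp (f : T2 -> R) k (s : seq (Z * Z)) :
  fsum f [seq (Z.opp k, p) | p <- s] = - fsum f [seq (k, p) | p <- s].
Proof. by rewrite /fsum !big_map -sumrN; apply: eq_bigr => p _; rewrite zrN mulNr. Qed.

Lemma integral_points (m : {measure set T2 -> \bar R}) (c : R) (s : seq (Z * Z))
    (f : T2 -> R) (A : set T2) (k : Z * Z -> Z) :
    discrete_on m [seq (c, grid R p) | p <- s] -> measurable A ->
    measurable_fun setT f -> {in s, forall p, c * f (grid R p) = zr (k p) / N} ->
  (\int[m]_(w in A) (f w)%:E)%E = (fsum (\1_A) [seq (k p, p) | p <- s] / N)%:E.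
Proof.
move=> ms mA mf h; rewrite (integral_discrete ms mA); last exact: measurable_funTS.
rewrite big_map; congr EFin; rewrite -(@sum_fsum R _ (fun p => c * f (grid R p))) //.
by apply: eq_bigr => p _ /=; rewrite mulrAC.
Qed.

Lemma measure_points (m : {measure set T2 -> \bar R}) (c d : R) (s : seq (Z * Z))
    (A : set T2) (k : Z) :
    discrete_on m [seq (c, grid R p) | p <- s] -> measurable A -> d * c = zr k / N ->
  (d%:E * m A)%E = (fsum (\1_A) [seq (k, p) | p <- s] / N)%:E.
Proof.
move=> ms mA h; rewrite ms.2 // -EFinM big_map mulr_sumr; congr EFin.
rewrite -(@sum_fsum R _ (fun p => d * c)) //.
by apply: eq_bigr => p _ /=; rewrite mulrA.
Qed.

Lemma joint_spectral_formula (eps : probability T2 R) (mu : circle R) (A : set T2) :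
    discrete_on eps (realize eps_formal) -> 8.-primitive_root (cval mu) -> measurable A ->
  (eps A =
     \int[dxd R 7]_(w in A) ((672 * pi ^+ 4)^-1 * on_torus (@Jfun R) w ^+ 2)%:E
     + \int[dxd R 4]_(w in A) (144^-1 * (24 - on_torus (@Kfun R) w))%:E
     + (6^-1)%:E * dxd R 3 A
     - (12^-1)%:E * dxd R 2 A
     + (168^-1)%:E * dxd R 1 A
     + \int[dsup R 4]_(w in A) ((1152 * pi ^+ 4)^-1 * on_torus (@Jfun R) w ^+ 2)%:E
     + (6^-1)%:E * dsup R 2 A
     - (12^-1)%:E * dsup R 1 A
     + (48^-1)%:E * \sum_(g \in D12) (\d_(torus_act g (mu, circleN1 R)) A : \bar R))%E.
Proof.
move=> eps_d mu8 mA; have [i i1 ->] := primitive_8th_root mu8.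
have p0 : pi != 0 :> R by rewrite gt_eqF ?pi_gt0.
have mJ c : measurable_fun setT (fun w => c * on_torus (@Jfun R) w ^+ 2).
  by apply: measurable_funM => //; apply: measurable_funX; exact: measurable_Jfun.
have mK : measurable_fun setT (fun w : T2 => 144^-1 * (24 - on_torus (@Kfun R) w)).
  apply: measurable_funM => //; apply: measurable_funB => //; exact: measurable_Kfun.
rewrite (integral_points (k := fun p => Z.mul (Zpos 3456) (Jz p))
           (dxd_discrete R (erefl : (7 * 24 = 168)%N)) mA (mJ _)); last first.
  move=> p ps; rewrite Jfun_grid; last exact: (allP Jz_square).
  rewrite zrM [RHS]mulrAC (@mass_frac _ 2058) // (_ : Pos.to_nat _ = 2058%N) //.
  move: (zr (Jz p)) p0 => x; move: (pi : R) => y y0. by field.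
have K4 := integral_points (k := fun p => Z.mul (Zpos 3087) (Z.sub (Zpos 24) (Kz p)))
           (dxd_discrete R (erefl : (4 * 42 = 168)%N)) mA mK.
cbv beta in K4; rewrite K4; last first.
  move=> p ps; rewrite Kfun_grid; last exact: (allP Kz_square).
  rewrite zrM zrB [RHS]mulrAC (@mass_frac _ 2304) // (_ : Pos.to_nat 2304 = 2304%N) //.
  by rewrite zr_pos (_ : Pos.to_nat 24 = 24%N) //; move: (zr (Kz p)) => x; field.
rewrite (integral_points (k := fun p => Z.mul (Zpos 2058) (Jz p))
           (dsup_discrete R (erefl : (3 * 4 * 14 = 168)%N)) mA (mJ _)); last first.
  move=> p ps; rewrite Jfun_grid; last exact: (allP Jz_sup).
  rewrite (_ : size _ = 48%N) //.
  rewrite zrM [RHS]mulrAC (@mass_frac _ 3456) // (_ : Pos.to_nat _ = 3456%N) //.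
  move: (zr (Jz p)) p0 => x; move: (pi : R) => y y0; by field.
rewrite (measure_points (k := Zpos 131712) (dxd_discrete R (erefl : (3 * 56 = 168)%N)) mA); last first.
  rewrite (@mass_frac _ 54) // (_ : Pos.to_nat _ = 54%N) //.
  by field.
rewrite (measure_points (k := Zpos 148176) (dxd_discrete R (erefl : (2 * 84 = 168)%N)) mA); last first.
  rewrite (@mass_frac _ 48) // (_ : Pos.to_nat _ = 48%N) //.
  by field.
rewrite (measure_points (k := Zpos 42336) (dxd_discrete R (erefl : (1 * 168 = 168)%N)) mA); last first.
  rewrite (@mass_frac _ 168) // (_ : Pos.to_nat _ = 168%N) //.
  by field.
rewrite (measure_points (k := Zpos 98784) (dsup_discrete R (erefl : (3 * 2 * 28 = 168)%N)) mA); last first.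
  rewrite (_ : size _ = 12%N) //; rewrite (@mass_frac _ 72) // (_ : Pos.to_nat _ = 72%N) //.
  by field.
rewrite (measure_points (k := Zpos 197568) (dsup_discrete R (erefl : (3 * 1 * 56 = 168)%N)) mA); last first.
  rewrite (_ : size _ = 3%N) //; rewrite (@mass_frac _ 36) // (_ : Pos.to_nat _ = 36%N) //.
  by field.
rewrite sum_D12.
have -> : (\sum_(q <- D12_list) (\d_(torus_act (zmx q) (grid R (Z.of_nat (21 * i), Zpos 84))) A : \bar R)
     = (\sum_(q <- D12_list) \1_A (grid R (zact q (Z.of_nat (21 * i), Zpos 84))))%:E)%E.
  by rewrite -sumEFin; apply: eq_bigr => q _; rewrite zmx_act_grid.
rewrite eps_d.2 // sum_realize -EFinM -!EFinN -!EFinD; congr EFin.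
have /allP/(_ i i1) := formula_eps; move/(@fsum_eq R (\1_A)) ->.
rewrite /formula !fsum_cat -[Zneg 148176]/(Z.opp (Zpos 148176)).
rewrite -[Zneg 197568]/(Z.opp (Zpos 197568)) !fsum_opp.
set l7 := fsum _ _; set l4 := fsum _ _; set l3 := fsum _ _; set l2 := fsum _ _.
set l1 := fsum _ _; set k4 := fsum _ _; set k2 := fsum _ _; set k1 := fsum _ _.
set m8 := fsum _ _.
have -> : \sum_(q <- D12_list) \1_A (grid R (zact q (Z.of_nat (21 * i), Zpos 84))) = 48 * m8 / N.
  have h48 : 48 * (zr (Zpos 148176) / N) = 1.
    rewrite (@mass_frac _ 48) // (_ : Pos.to_nat 48 = 48%N) //; by field.
  rewrite /m8 /fsum big_map /= -mulr_sumr -[LHS]mul1r -[in LHS]h48.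
  by move: (N^-1) (zr _) (\sum_(q <- _) _) => n k S; ring.
by move: (N^-1) (l7) (l4) (l3) (l2) (l1) (k4) (k2) (k1) (m8) => *; field.
Qed.
End JointSpectralFormula.

(** * The spectral measure and its moments *)

Definition chi1_terms (p : Z * Z) : seq (Z * Z) :=
  [:: (Zpos 1, p.1); (Zpos 1, p.2); (Zpos 1, Z.sub p.1 p.2)].
Definition chi2_terms (p : Z * Z) : seq (Z * Z) :=
  chi1_terms p ++
  [:: (Zpos 1, Z.add p.1 p.2); (Zpos 1, Z.sub (Z.mul (Zpos 2) p.1) p.2);
      (Zpos 1, Z.sub p.1 (Z.mul (Zpos 2) p.2))].

(** The values of the two characters at the points of orbit_points; they agree with
    the traces vals7 and vals14 of the group elements. *)
Definition orbit_values : seq (Z * Z) :=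
  [:: (Zpos 7, Zpos 14); (Zneg 1, Zneg 2); (Zneg 2, Zpos 5); (Zpos 1, Zneg 1);
      (Zpos 3, Zpos 2); (Zneg 1, Zpos 2); (Zpos 2, Zpos 1); (Z0, Z0); (Zneg 1, Z0);
      (Z0, Zneg 1)].

Definition const_comb (k : Z) l : bool :=
  if cos_comb l is Some (a, Z0, Z0, Z0, Z0) then Z.eqb a k else false.

Lemma orbit_valuesP : all (fun t => all (fun q =>
    let p := zact q (nth (Z0, (Z0, Z0)) orbit_points t).2 in
    let v := nth (Z0, Z0) orbit_values t in
    const_comb (Z.sub v.1 (Zpos 1)) (chi1_terms p)
    && const_comb (Z.sub v.2 (Zpos 2)) (chi2_terms p)) D12_list) (iota 0 10).
Proof. by vm_compute. Qed.

Section SpectralMeasure.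
Variable R : realType.
Local Notation zr := (@zr R).
Local Notation T2 := (torus R).
Local Notation fsum := (@fsum R).
Local Notation N := (zr mass_unit).

Definition rchi1 (w : T2) : R :=
  1 + 2 * tcos (Zpos 1) Z0 w + 2 * tcos Z0 (Zpos 1) w + 2 * tcos (Zpos 1) (Zneg 1) w.
Definition rchi2 (w : T2) : R :=
  2 + 2 * tcos (Zpos 1) Z0 w + 2 * tcos Z0 (Zpos 1) w + 2 * tcos (Zpos 1) (Zneg 1) w
   + 2 * tcos (Zpos 1) (Zpos 1) w + 2 * tcos (Zpos 2) (Zneg 1) w
   + 2 * tcos (Zpos 1) (Zneg 2) w.

Lemma chi1_rchi1 w : chi1 w = ((rchi1 w)%:C)%C. Proof. exact: chi1E. Qed.
Lemma chi2_rchi2 w : chi2 w = ((rchi2 w)%:C)%C. Proof. exact: chi2E. Qed.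

Lemma const_combP k l : const_comb k l -> \sum_(t <- l) zr t.1 * (2 * cs R t.2) = zr k.
Proof.
rewrite /const_comb; case E : (cos_comb l) => [[[[[a b] c] d] e]|//].
case: b E => // E; case: c E => // E; case: d E => // E; case: e E => // E /Z.eqb_eq <-.
by rewrite (cos_combP R E) /val5 -[zr Z0]/(0 : R) !mul0r !addr0.
Qed.

Lemma rchi1_grid k p : const_comb (Z.sub k (Zpos 1)) (chi1_terms p) -> rchi1 (grid R p) = zr k.
Proof.
move=> /const_combP; rewrite /chi1_terms !big_cons big_nil zrB -[zr (Zpos 1)]/(1 : R).
have e1 : Z.add (Z.mul (Zpos 1) p.1) (Z.mul Z0 p.2) = p.1 by lia.
have e2 : Z.add (Z.mul Z0 p.1) (Z.mul (Zpos 1) p.2) = p.2 by lia.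
have e3 : Z.add (Z.mul (Zpos 1) p.1) (Z.mul (Zneg 1) p.2) = Z.sub p.1 p.2 by lia.
by rewrite /rchi1 !tcos_grid e1 e2 e3 /= !mul1r; lra.
Qed.

Lemma rchi2_grid k p : const_comb (Z.sub k (Zpos 2)) (chi2_terms p) -> rchi2 (grid R p) = zr k.
Proof.
move=> /const_combP; rewrite /chi2_terms /chi1_terms !big_cons big_nil zrB.
rewrite -[zr (Zpos 1)]/(1 : R) -[zr (Zpos 2)]/(2 : R).
have e1 : Z.add (Z.mul (Zpos 1) p.1) (Z.mul Z0 p.2) = p.1 by lia.
have e2 : Z.add (Z.mul Z0 p.1) (Z.mul (Zpos 1) p.2) = p.2 by lia.
have e3 : Z.add (Z.mul (Zpos 1) p.1) (Z.mul (Zneg 1) p.2) = Z.sub p.1 p.2 by lia.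
have e4 : Z.add (Z.mul (Zpos 1) p.1) (Z.mul (Zpos 1) p.2) = Z.add p.1 p.2 by lia.
have e5 : Z.add (Z.mul (Zpos 2) p.1) (Z.mul (Zneg 1) p.2) = Z.sub (Z.mul (Zpos 2) p.1) p.2 by lia.
have e6 : Z.add (Z.mul (Zpos 1) p.1) (Z.mul (Zneg 2) p.2) = Z.sub p.1 (Z.mul (Zpos 2) p.2) by lia.
by rewrite /rchi2 !tcos_grid e1 e2 e3 e4 e5 e6 /= !mul1r; lra.
Qed.

Lemma nth_orbit_values t : (t < 10)%N ->
  (zr (nth (Z0, Z0) orbit_values t).1 = nth 0 (vals7 R) t) *
  (zr (nth (Z0, Z0) orbit_values t).2 = nth 0 (vals14 R) t).
Proof.
by move=> t10; split; move: t10; do 10 (case: t => [|t] //).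
Qed.

Lemma orbit_chi t q : (t < 10)%N -> q \in D12_list ->
  let w := grid R (zact q (nth (Z0, (Z0, Z0)) orbit_points t).2) in
  (rchi1 w = nth 0 (vals7 R) t) * (rchi2 w = nth 0 (vals14 R) t).
Proof.
move=> t10 qD w; have ti : t \in iota 0 10 by rewrite mem_iota.
have /allP/(_ t ti)/allP/(_ q qD)/andP[h1 h2] := orbit_valuesP.
by rewrite /w (rchi1_grid h1) (rchi2_grid h2) !nth_orbit_values.
Qed.

Lemma sum_orbits (f : T2 -> R) (F : nat -> R) :
  (forall t q, (t < 10)%N -> q \in D12_list ->
     f (grid R (zact q (nth (Z0, (Z0, Z0)) orbit_points t).2)) = F t) ->
  fsum f eps_formal / N = 6048%:R^-1 * \sum_(t < 10) (nth 0%N class_sizes t)%:R * F t.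
Proof.
move=> hF; rewrite /fsum /eps_formal big_allpairs_dep (big_nth (Z0, (Z0, Z0))) big_mkord.
rewrite mulr_suml mulr_sumr; apply: eq_bigr => t _.
rewrite (eq_big_seq (fun=> zr (Z.mul (Zpos 98) (nth (Z0, (Z0, Z0)) orbit_points t).1) * F t)); last first.
  by move=> q qD /=; rewrite hF // ltn_ord.
have -> : zr (Z.mul (Zpos 98) (nth (Z0, (Z0, Z0)) orbit_points t).1) = 98%:R * (nth 0%N class_sizes t)%:R.
  by rewrite zrM; congr (_ * _); case: t => [t]; do 10 (case: t => [|t] //).
rewrite big_const_seq count_predT (_ : size _ = 12%N) // iter_addr_0.
have h : 98%:R * 12%:R / N = 6048%:R^-1 :> R.
  rewrite -[98%:R]/(zr (Zpos 98)) -[12%:R]/(zr (Zpos 12)) -zrM.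
  by rewrite (@mass_frac _ _ 6048) // (_ : Pos.to_nat 6048 = 6048%N).
transitivity (98%:R * 12%:R / N * ((nth 0%N class_sizes t)%:R * F t)).
  by move: (N^-1) ((nth 0%N class_sizes t)%:R) (F t) => x y z; ring.
exact: (congr1 (fun k => k * _) h).
Qed.

Lemma spectral_measure_exists : exists eps : probability T2 R, discrete_on eps (realize R eps_formal).
Proof.
apply: weighted_prob.
  apply/allP => _ /mapP[t te ->] /=; rewrite divr_ge0 ?(zr_pos, ler0n) //.
  have : all (fun t => Z.leb Z0 t.1) eps_formal by vm_compute.
  by move=> /allP/(_ t te); case: (t.1) => //= p _; rewrite zr_pos ler0n.
have -> : \sum_(t <- realize R eps_formal) t.1 = fsum (fun=> 1) eps_formal / N.
  by rewrite -sum_realize; apply: eq_bigr => t _; rewrite mulr1.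
rewrite fsum_const mulr1 (_ : foldr _ _ _ = mass_unit); last by vm_compute.
apply: divff; rewrite zr_pos pnatr_eq0; apply/eqP; exact: Pos2Nat_neq0.
Qed.

Section Properties.
Variable eps : probability T2 R.
Hypothesis eps_d : discrete_on eps (realize R eps_formal).

Lemma spectral_measure_invariant : D12_invariant eps.
Proof.
move=> _ /D12P[q qD ->] A mA.
have mqA : measurable (torus_act (zmx q) @^-1` A).
  by rewrite -[X in measurable X]setTI; exact: measurable_zmx_act.
rewrite !eps_d.2 // !sum_realize; congr (_ / _)%:E.
have /allP/(_ q qD) := eps_formal_invariant; move/(@fsum_eq R (\1_A)) <-.
rewrite /fsum big_map; apply: eq_bigr => t _ /=; rewrite -zmx_act_grid.
by rewrite !indicE; congr (_ * (_ : bool)%:R); apply/idP/idP; rewrite !inE.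
Qed.

Lemma integral_spectral_measure (F : R -> R -> R) :
  measurable_fun setT (fun w => F (rchi1 w) (rchi2 w)) ->
  (\int[eps]_w (F (rchi1 w) (rchi2 w))%:E =
   (6048%:R^-1 * \sum_(t < 10) (nth 0%N class_sizes t)%:R *
      F (nth 0 (vals7 R) t) (nth 0 (vals14 R) t))%:E)%E.
Proof.
move=> mF; rewrite (integral_discrete eps_d) //; congr EFin.
rewrite -(@sum_orbits (fun w => F (rchi1 w) (rchi2 w))
            (fun t => F (nth 0 (vals7 R) t) (nth 0 (vals14 R) t))); last first.
  by move=> t q t10 qD /=; rewrite !orbit_chi.
by rewrite -sum_realize; apply: eq_bigr => t _; rewrite indicT mulr1.
Qed.
End Properties.
End SpectralMeasure.

(** * The characters separate the orbits of the Weyl group *)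

Section OrbitSeparation.

Lemma two_roots (F : fieldType) (a b c d : F) : a + b = c + d -> a * b = c * d ->
  (a = c /\ b = d) \/ (a = d /\ b = c).
Proof.
move=> s p; have : (a - c) * (a - d) = 0.
  transitivity (a ^+ 2 - a * (c + d) + c * d); first by ring.
  by rewrite -s -p; ring.
move=> /eqP; rewrite mulf_eq0 !subr_eq0 => /orP[] /eqP e; [left | right]; split=> //.
  by apply: (addrI a); rewrite s e.
by apply: (addrI a); rewrite s e addrC.
Qed.

Lemma three_roots (F : fieldType) (x y z x' y' z' : F) :
    x * y * z = 1 -> x' * y' * z' = 1 -> x + y + z = x' + y' + z' ->
    x * y + y * z + z * x = x' * y' + y' * z' + z' * x' ->
  (x = x' /\ (y = y' \/ y = z')) \/ (x = y' /\ (y = x' \/ y = z')) \/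
  (x = z' /\ (y = x' \/ y = y')).
Proof.
move=> e3 e3' e1 e2; have x0 : x != 0.
  by apply: contra_eq_neq e3 => ->; rewrite !mul0r eq_sym oner_eq0.
have : (x - x') * (x - y') * (x - z') = 0.
  rewrite (_ : _ * _ = x ^+ 3 - (x' + y' + z') * x ^+ 2
      + (x' * y' + y' * z' + z' * x') * x - x' * y' * z'); last by ring.
  by rewrite -e1 -e2 e3' -e3; ring.
have pair a b : x * a * b = 1 -> x + a + b = x + y + z -> y = a \/ y = b.
  move=> p s; have [||[]|[]] := @two_roots _ y z a b; try by [left | right].
    by apply: (addrI x); rewrite !addrA.
  by apply: (mulfI x0); rewrite !mulrA p.
move=> /eqP; rewrite !mulf_eq0 !subr_eq0 => /orP[/orP[]|] /eqP e.
- by left; split=> //; apply: pair; [rewrite e | rewrite e1 e].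
- by right; left; split=> //; apply: pair; [rewrite e -e3' | rewrite e1 e]; ring.
- by right; right; split=> //; apply: pair; [rewrite e -e3' | rewrite e1 e]; ring.
Qed.

Variable R : realType.
Local Notation T2 := (torus R).

Lemma cval_neq0 (z : circle R) : cval z != 0.
Proof. by rewrite circle_cis cis_neq0. Qed.

Lemma D12_orbit_witness (w w' : T2) q : q \in D12_list ->
    cval w.1 = cval w'.1 ^ int_of_Z q.1.1 * cval w'.2 ^ int_of_Z q.1.2 ->
    cval w.2 = cval w'.1 ^ int_of_Z q.2.1 * cval w'.2 ^ int_of_Z q.2.2 ->
  exists2 r, r \in D12_list & w = torus_act (zmx r) w'.
Proof.
move=> qD h1 h2; exists q => //; rewrite [LHS]surjective_pairing [RHS]surjective_pairing.
by congr (_, _); apply: (@cval_inj R); rewrite zmx_act cis_arg.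
Qed.

(** Put x = w1, y = w2^-1 and z = w2 / w1, so that x y z = 1, and let s = x + y + z and
    s' = 1/x + 1/y + 1/z = x y + y z + z x. Then chi1 = 1 + s + s' and
    chi2 = chi1 + s s' - 2, so the characters determine the pair {s, s'}. The
    order (s, s') determines x, y and z up to permutation. The six
    permutations and the exchange of s and s', which inverts x, y and z, give
    the twelve elements of the Weyl group. *)
Lemma chi_separates_orbits (w w' : T2) : chi1 w = chi1 w' -> chi2 w = chi2 w' ->
  exists2 q, q \in D12_list & w = torus_act (zmx q) w'.
Proof.
have := cval_neq0 w.1; have := cval_neq0 w.2; have := cval_neq0 w'.1; have := cval_neq0 w'.2.
move=> v0 u0 b0 a0.
have hq := @D12_orbit_witness w w'; move: hq a0 b0 u0 v0; rewrite /chi2 /chi1.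
set a := cval w.1; set b := cval w.2; set u := cval w'.1; set v := cval w'.2.
move=> hq a0 b0 u0 v0 h1 h2.
pose s := a + b^-1 + b / a; pose s' := a^-1 + b + a / b.
pose t := u + v^-1 + v / u; pose t' := u^-1 + v + u / v.
have [||[e1 e2]|[e1 e2]] := @two_roots _ s s' t t'.
- apply: (addrI 1); move: h1; rewrite /s /s' /t /t' => h1.
  by transitivity (1 + a + a^-1 + b + b^-1 + a / b + a^-1 * b); [|rewrite h1]; ring.
- have pr (c d : R[i]%C) : c != 0 -> d != 0 -> (c + d^-1 + d / c) * (c^-1 + d + c / d) =
    3 + (c * d + c^-1 / d + c ^+ 2 / d + c ^- 2 * d + c / d ^+ 2 + c^-1 * d ^+ 2).
    by move=> c0 d0; field; rewrite c0 d0.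
  rewrite /s /s' /t /t' !pr //; congr (_ + _).
  move: h2; rewrite h1 => h2; move: h2; set P := 1 + u + u^-1 + v + v^-1 + u / v + u^-1 * v + 1.
  by move=> h2; apply: (addrI P); rewrite !addrA.
- have [||||[ea [eb|eb]]|[[ea [eb|eb]]|[ea [eb|eb]]]] := @three_roots _ a b^-1 (b / a) u v^-1 (v / u).
  + by field; rewrite a0 b0.
  + by field; rewrite u0 v0.
  + exact: e1.
  + transitivity s'; first by rewrite /s'; field; rewrite a0 b0.
    by rewrite e2 /t'; field; rewrite u0 v0.
  + by apply: (hq ((Zpos 1, Z0), (Z0, Zpos 1))) => //;
    rewrite ?ea -1?[b]invrK ?eb /exprz /= ?expr0 ?expr1; field; rewrite ?u0 ?v0.
  + by apply: (hq ((Zpos 1, Z0), (Zpos 1, Zneg 1))) => //;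
    rewrite ?ea -1?[b]invrK ?eb /exprz /= ?expr0 ?expr1; field; rewrite ?u0 ?v0.
  + by apply: (hq ((Z0, Zneg 1), (Zneg 1, Z0))) => //;
    rewrite ?ea -1?[b]invrK ?eb /exprz /= ?expr0 ?expr1; field; rewrite ?u0 ?v0.
  + by apply: (hq ((Z0, Zneg 1), (Zpos 1, Zneg 1))) => //;
    rewrite ?ea -1?[b]invrK ?eb /exprz /= ?expr0 ?expr1; field; rewrite ?u0 ?v0.
  + by apply: (hq ((Zneg 1, Zpos 1), (Zneg 1, Z0))) => //;
    rewrite ?ea -1?[b]invrK ?eb /exprz /= ?expr0 ?expr1; field; rewrite ?u0 ?v0.
  + by apply: (hq ((Zneg 1, Zpos 1), (Z0, Zpos 1))) => //;
    rewrite ?ea -1?[b]invrK ?eb /exprz /= ?expr0 ?expr1; field; rewrite ?u0 ?v0.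
- have [||||[ea [eb|eb]]|[[ea [eb|eb]]|[ea [eb|eb]]]] := @three_roots _ a b^-1 (b / a) u^-1 v (u / v).
  + by field; rewrite a0 b0.
  + by field; rewrite u0 v0.
  + exact: e1.
  + transitivity s'; first by rewrite /s'; field; rewrite a0 b0.
    by rewrite e2 /t; field; rewrite u0 v0.
  + by apply: (hq ((Zneg 1, Z0), (Z0, Zneg 1))) => //;
    rewrite ?ea -1?[b]invrK ?eb /exprz /= ?expr0 ?expr1; field; rewrite ?u0 ?v0.
  + by apply: (hq ((Zneg 1, Z0), (Zneg 1, Zpos 1))) => //;
    rewrite ?ea -1?[b]invrK ?eb /exprz /= ?expr0 ?expr1; field; rewrite ?u0 ?v0.
  + by apply: (hq ((Z0, Zpos 1), (Zpos 1, Z0))) => //;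
    rewrite ?ea -1?[b]invrK ?eb /exprz /= ?expr0 ?expr1; field; rewrite ?u0 ?v0.
  + by apply: (hq ((Z0, Zpos 1), (Zneg 1, Zpos 1))) => //;
    rewrite ?ea -1?[b]invrK ?eb /exprz /= ?expr0 ?expr1; field; rewrite ?u0 ?v0.
  + by apply: (hq ((Zpos 1, Zneg 1), (Zpos 1, Z0))) => //;
    rewrite ?ea -1?[b]invrK ?eb /exprz /= ?expr0 ?expr1; field; rewrite ?u0 ?v0.
  + by apply: (hq ((Zpos 1, Zneg 1), (Z0, Zneg 1))) => //;
    rewrite ?ea -1?[b]invrK ?eb /exprz /= ?expr0 ?expr1; field; rewrite ?u0 ?v0.
Qed.
End OrbitSeparation.

(** * Polynomials in the two characters *)

Section BoundedMeasurable.
Context d (T : measurableType d) (R : realType).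
Implicit Types f g : T -> R.

Definition bounded_measurable f := measurable_fun setT f /\ exists M, forall x, `|f x| <= M.

Lemma bounded_measurable_cst c : bounded_measurable (fun=> c).
Proof. by split=> //; exists `|c|. Qed.
Lemma bounded_measurableD f g : bounded_measurable f -> bounded_measurable g ->
  bounded_measurable (fun x => f x + g x).
Proof.
move=> [mf [M fM]] [mg [N gN]]; split; first exact: measurable_funD.
by exists (M + N) => x; rewrite (le_trans (ler_normD _ _)) // lerD.
Qed.
Lemma bounded_measurableM f g : bounded_measurable f -> bounded_measurable g ->
  bounded_measurable (fun x => f x * g x).
Proof.
move=> [mf [M fM]] [mg [N gN]]; split; first exact: measurable_funM.
by exists (M * N) => x; rewrite normrM ler_pM.
Qed.
Lemma bounded_measurableX f n : bounded_measurable f -> bounded_measurable (fun x => f x ^+ n).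
Proof.
move=> bf; elim: n => [|n IH]; first exact: bounded_measurable_cst.
under [X in bounded_measurable X]eq_fun => x do rewrite exprS.
exact: bounded_measurableM.
Qed.
Lemma bounded_measurable_sum I (s : seq I) (F : I -> T -> R) :
  (forall i, bounded_measurable (F i)) -> bounded_measurable (fun x => \sum_(i <- s) F i x).
Proof.
move=> bF; elim: s => [|i s IH].
  under [X in bounded_measurable X]eq_fun => x do rewrite big_nil.
  exact: bounded_measurable_cst.
under [X in bounded_measurable X]eq_fun => x do rewrite big_cons.
exact: bounded_measurableD.
Qed.
Lemma bounded_measurable_indic A : measurable A -> bounded_measurable (\1_A : T -> R).
Proof.
move=> mA; split; first exact: measurable_indic.
by exists 1 => x; rewrite indicE; case: (_ \in _); rewrite ?normr1 ?normr0.
Qed.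

Lemma bounded_measurable_integrable (mu : probability T R) f :
  bounded_measurable f -> mu.-integrable setT (EFin \o f).
Proof.
move=> [mf [M fM]]; apply: (le_integrable measurableT _ _ (finite_measure_integrable_cst mu M measurableT)).
  exact/measurable_EFinP.
by move=> x _ /=; rewrite lee_fin (le_trans (fM x)) // ler_norm.
Qed.
End BoundedMeasurable.

Definition poly2 (R : realType) (f : R -> R -> R) : Prop :=
  exists l : seq (R * (nat * nat)), forall x y,
    f x y = \sum_(t <- l) t.1 * (x ^+ t.2.1 * y ^+ t.2.2).

Section Poly2.
Variable R : realType.
Implicit Types f g : R -> R -> R.

Lemma poly2_cst c : poly2 (fun _ _ : R => c).
Proof. by exists [:: (c, (0, 0)%N)] => x y; rewrite big_seq1 !expr0 !mulr1. Qed.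
Lemma poly2_fst : poly2 (fun x _ : R => x).
Proof. by exists [:: (1, (1, 0)%N)] => x y; rewrite big_seq1 expr0 mul1r mulr1. Qed.
Lemma poly2_snd : poly2 (fun _ y : R => y).
Proof. by exists [:: (1, (0, 1)%N)] => x y; rewrite big_seq1 expr0 !mul1r. Qed.
Lemma poly2D f g : poly2 f -> poly2 g -> poly2 (fun x y => f x y + g x y).
Proof. by move=> [l hl] [k hk]; exists (l ++ k) => x y; rewrite big_cat hl hk. Qed.
Lemma poly2M f g : poly2 f -> poly2 g -> poly2 (fun x y => f x y * g x y).
Proof.
move=> [l hl] [k hk].
exists [seq (t.1 * u.1, ((t.2.1 + u.2.1)%N, (t.2.2 + u.2.2)%N)) | t <- l, u <- k] => x y.
rewrite hl hk big_allpairs_dep mulr_suml; apply: eq_bigr => t _.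
rewrite mulr_sumr; apply: eq_bigr => u _ /=.
by rewrite !exprD; ring.
Qed.
Lemma poly2X f n : poly2 f -> poly2 (fun x y => f x y ^+ n).
Proof.
move=> pf; elim: n => [|n IH]; first exact: poly2_cst.
have [l hl] := poly2M pf IH; exists l => x y.
by rewrite exprS hl.
Qed.
Lemma poly2_sum I (s : seq I) (F : I -> R -> R -> R) :
  (forall i, poly2 (F i)) -> poly2 (fun x y => \sum_(i <- s) F i x y).
Proof.
move=> pF; elim: s => [|i s IH].
  by exists [::] => x y; rewrite !big_nil.
have [l hl] := poly2D (pF i) IH; exists l => x y; by rewrite big_cons hl.
Qed.
Lemma poly2_prod I (s : seq I) (P : pred I) (F : I -> R -> R -> R) :
  (forall i, poly2 (F i)) -> poly2 (fun x y => \prod_(i <- s | P i) F i x y).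
Proof.
move=> pF; elim: s => [|i s IH].
  have [l hl] := poly2_cst 1; by exists l => x y; rewrite big_nil (hl x y).
case Pi : (P i); last by case: IH => l hl; exists l => x y; rewrite big_cons Pi hl.
have [l hl] := poly2M (pF i) IH; exists l => x y; by rewrite big_cons Pi hl.
Qed.
Lemma poly2_dist a b : poly2 (fun x y : R => (x - a) ^+ 2 + (y - b) ^+ 2).
Proof.
apply: poly2D; apply: poly2X; apply: poly2D;
  by [exact: poly2_fst | exact: poly2_snd | exact: poly2_cst].
Qed.
End Poly2.

Section Moments.
Variable R : realType.
Local Notation T2 := (torus R).
Local Notation zr := (@zr R).

Lemma bounded_measurable_tcos a b : bounded_measurable (@tcos R a b).
Proof.
split; first exact: measurable_tcos.
by exists 1 => w; rewrite ler_norml cos_geN1 cos_le1.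
Qed.
Lemma bounded_measurable_rchi1 : bounded_measurable (@rchi1 R).
Proof.
by do ?apply: bounded_measurableD; try exact: bounded_measurable_cst;
  apply: bounded_measurableM; by [exact: bounded_measurable_cst | exact: bounded_measurable_tcos].
Qed.
Lemma bounded_measurable_rchi2 : bounded_measurable (@rchi2 R).
Proof.
by do ?apply: bounded_measurableD; try exact: bounded_measurable_cst;
  apply: bounded_measurableM; by [exact: bounded_measurable_cst | exact: bounded_measurable_tcos].
Qed.

Lemma bounded_measurable_monomial m n :
  bounded_measurable (fun w : T2 => rchi1 w ^+ m * rchi2 w ^+ n).
Proof.
by apply: bounded_measurableM; apply: bounded_measurableX;
  [exact: bounded_measurable_rchi1 | exact: bounded_measurable_rchi2].
Qed.

Lemma bounded_measurable_poly2 f : poly2 f ->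
  bounded_measurable (fun w : T2 => f (rchi1 w) (rchi2 w)).
Proof.
move=> [l hl]; under [X in bounded_measurable X]eq_fun => w do rewrite hl.
apply: bounded_measurable_sum => t; apply: bounded_measurableM.
  exact: bounded_measurable_cst.
exact: bounded_measurable_monomial.
Qed.

(** The average over the group of F (tr7 g) (tr14 g). *)
Definition class_average (F : R -> R -> R) : R :=
  6048%:R^-1 * \sum_(t < 10) (nth 0%N class_sizes t)%:R *
      F (nth 0 (vals7 R) t) (nth 0 (vals14 R) t).

Definition real_moments (nu : probability T2 R) := forall m n,
  (\int[nu]_w (rchi1 w ^+ m * rchi2 w ^+ n)%:E =
   (class_average (fun x y => x ^+ m * y ^+ n))%:E)%E.

Lemma integral_poly2 (nu : probability T2 R) f : real_moments nu -> poly2 f ->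
  (\int[nu]_w (f (rchi1 w) (rchi2 w))%:E = (class_average f)%:E)%E.
Proof.
move=> hnu [l hl].
under eq_integral => w _ do rewrite hl -sumEFin.
rewrite integral_sum // => [|t]; last first.
  apply: (bounded_measurable_integrable nu); apply: bounded_measurableM.
    exact: bounded_measurable_cst.
  exact: bounded_measurable_monomial.
rewrite (eq_bigr (fun t => (t.1 * class_average (fun x y => x ^+ t.2.1 * y ^+ t.2.2))%:E)) => [|t _].
  rewrite sumEFin; congr EFin; rewrite /class_average.
  under eq_bigr => t _ do rewrite mulrCA mulr_sumr.
  rewrite -mulr_sumr exchange_big; congr (_ * _); apply: eq_bigr => t _.
  by rewrite hl mulr_sumr; apply: eq_bigr => u _; ring.
under eq_integral => w _ do rewrite EFinM.
rewrite integralZl // ?hnu //.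
exact: (bounded_measurable_integrable nu (bounded_measurable_monomial _ _)).
Qed.
End Moments.

(** * Uniqueness *)

Section Uniqueness.
Variable R : realType.
Local Notation T2 := (torus R).
Local Notation zr := (@zr R).

Definition orbit_pt (t : nat) : T2 := grid R (nth (Z0, (Z0, Z0)) orbit_points t).2.
Definition val7 t : R := nth 0 (vals7 R) t.
Definition val14 t : R := nth 0 (vals14 R) t.

Lemma zr_inj : injective zr.
Proof. by move=> a b /intr_inj /int_of_Z_inj. Qed.

Lemma orbit_values_inj t s : (t < 10)%N -> (s < 10)%N ->
  val7 t = val7 s -> val14 t = val14 s -> t = s.
Proof.
move=> t10 s10; rewrite /val7 /val14 -!nth_orbit_values // => /zr_inj e1 /zr_inj e2.
have u : uniq orbit_values by [].
apply/eqP; rewrite -(nth_uniq (Z0, Z0) _ _ u) //; apply/eqP.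
by rewrite [LHS]surjective_pairing [RHS]surjective_pairing e1 e2.
Qed.

Definition sqdist (t : nat) (x y : R) := (x - val7 t) ^+ 2 + (y - val14 t) ^+ 2.
Lemma sqdist_ge0 t x y : 0 <= sqdist t x y.
Proof. by rewrite addr_ge0 ?sqr_ge0. Qed.
Lemma sqdist_eq0 t x y : sqdist t x y = 0 -> x = val7 t /\ y = val14 t.
Proof.
move=> /eqP; rewrite paddr_eq0 ?sqr_ge0 // !sqrf_eq0 !subr_eq0.
by move=> /andP[/eqP -> /eqP ->].
Qed.

(** Nonnegative, and zero exactly at the ten values: a measure that integrates it to
    0 lives on the ten orbits. *)
Definition vanishing (x y : R) := \prod_(s < 10) sqdist s x y.
Definition lagrange (t : 'I_10) (x y : R) :=
  \prod_(s < 10 | s != t) (sqdist s x y / sqdist s (val7 t) (val14 t)).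

Lemma poly2_vanishing : poly2 vanishing.
Proof. by apply: poly2_prod => s; exact: poly2_dist. Qed.
Lemma poly2_lagrange t : poly2 (lagrange t).
Proof.
by apply: poly2_prod => s; apply: poly2M; [exact: poly2_dist | exact: poly2_cst].
Qed.

Lemma lagrangeE (t s : 'I_10) : lagrange t (val7 s) (val14 s) = (s == t)%:R.
Proof.
have [->|st] := eqVneq.
  rewrite /lagrange big1 // => r rt; rewrite divff //; apply/eqP => /sqdist_eq0 [e1 e2].
  by move/eqP: rt; apply; apply: val_inj; apply: orbit_values_inj; rewrite ?ltn_ord.
by rewrite /lagrange (bigD1 s) //= /sqdist !subrr expr0n /= addr0 mul0r mul0r.
Qed.

Lemma vanishing_values (t : 'I_10) : vanishing (val7 t) (val14 t) = 0.
Proof.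
by rewrite /vanishing (bigD1 t) //= /sqdist !subrr expr0n /= addr0 mul0r.
Qed.

Lemma vanishing_orbit (w : T2) : vanishing (rchi1 w) (rchi2 w) = 0 ->
  exists t : 'I_10, exists2 q, q \in D12_list & w = torus_act (zmx q) (orbit_pt t).
Proof.
move=> /eqP; rewrite prodf_seq_eq0 => /hasP[t _ /= /eqP /sqdist_eq0 [e1 e2]].
exists t; have one : ((Zpos 1, Z0), (Z0, Zpos 1)) \in D12_list by [].
have [h1 h2] := orbit_chi R (ltn_ord t) one.
have e : torus_act (zmx ((Zpos 1, Z0), (Z0, Zpos 1))) (orbit_pt t) = orbit_pt t.
  rewrite zmx_act_grid /orbit_pt; congr grid; move: (nth _ _ _).2 => [a b].
  have a1 : Z.add (Z.mul (Zpos 1) a) (Z.mul Z0 b) = a by lia.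
  have b1 : Z.add (Z.mul Z0 a) (Z.mul (Zpos 1) b) = b by lia.
  exact: congr2 a1 b1.
rewrite -zmx_act_grid -/(orbit_pt t) e in h1 h2.
by apply: chi_separates_orbits; rewrite ?chi1_rchi1 ?chi2_rchi2 ?e1 ?e2 ?h1 ?h2.
Qed.

Lemma D12_list_translate :
  all (fun q => perm_eq [seq zmul r q | r <- D12_list] D12_list) D12_list.
Proof. by vm_compute. Qed.

Definition orbit_average (f : T2 -> R) (w : T2) : R :=
  12%:R^-1 * \sum_(q <- D12_list) f (torus_act (zmx q) w).

Lemma orbit_average_act f q w : q \in D12_list ->
  orbit_average f (torus_act (zmx q) w) = orbit_average f w.
Proof.
move=> qD; congr (_ * _); have /allP/(_ q qD) h := D12_list_translate.
rewrite -[RHS](perm_big _ h) big_map; apply: eq_bigr => r _.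
by rewrite zmx_act_comp.
Qed.

Lemma vanishing_ge0 x y : 0 <= vanishing x y.
Proof. by apply: prodr_ge0 => s _; exact: sqdist_ge0. Qed.

Lemma bounded_measurable_average A : measurable A ->
  bounded_measurable (orbit_average (\1_A)).
Proof.
move=> mA; apply: bounded_measurableM; first exact: bounded_measurable_cst.
apply: bounded_measurable_sum => q; have [mf [M fM]] := bounded_measurable_indic R mA.
split; last by exists M => w; exact: fM.
exact: (measurableT_comp mf (measurable_zmx_act q)).
Qed.

Lemma integral_orbit_average (nu : probability T2 R) A : D12_invariant nu -> measurable A ->
  (\int[nu]_w (orbit_average (\1_A) w)%:E = nu A)%E.
Proof.
move=> nuI mA; have mqA q : measurable (torus_act (zmx q) @^-1` A : set T2).
  by rewrite -[X in measurable X]setTI; exact: measurable_zmx_act.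
have aE w : (orbit_average (\1_A) w)%:E =
    (\sum_(q <- D12_list) (12%:R^-1)%:E * (\1_(torus_act (zmx q) @^-1` A) w)%:E)%E.
  by rewrite /orbit_average EFinM -sumEFin ge0_sume_distrr // => q _; rewrite lee_fin.
under eq_integral => w _ do rewrite aE.
have bI q := bounded_measurable_integrable nu (bounded_measurable_indic R (mqA q)).
rewrite integral_sum // => [|q]; last by apply: integrableZl => //; exact: bI.
have nA : nu A \is a fin_num by exact: fin_num_measure.
rewrite (eq_big_seq (fun=> (12%:R^-1 * fine (nu A))%:E)) => [|q qD]; last first.
  rewrite EFinM fineK // integralZl //; last exact: bI.
  congr (_ * _)%E; rewrite integral_indic // setIT; apply: nuI => //.
  by apply/D12P; exists q.
rewrite sumEFin big_const_seq count_predT (_ : size _ = 12%N) // iter_addr_0.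
rewrite -[RHS](fineK nA); congr EFin.
by rewrite -[LHS]mulr_natl mulrA mulfV ?mul1r // pnatr_eq0.
Qed.

(** By invariance, nu A is the integral of the average of the indicator of A over
    the Weyl group. Almost everywhere the point is in one of the ten orbits,
    and there this average equals its Lagrange interpolation, a polynomial in
    the two characters, whose integral the moments determine. *)
Lemma measure_determined (nu : probability T2 R) A :
    D12_invariant nu -> real_moments nu -> measurable A ->
  nu A = (class_average (fun x y => \sum_(t < 10) orbit_average (\1_A) (orbit_pt t) * lagrange t x y))%:E.
Proof.
move=> nuI nuM mA.
have pH : poly2 (fun x y => \sum_(t < 10) orbit_average (\1_A) (orbit_pt t) * lagrange t x y).
  by apply: poly2_sum => t; apply: poly2M; [exact: poly2_cst | exact: poly2_lagrange].
have bV := bounded_measurable_poly2 poly2_vanishing.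
have v0 : ae_eq nu setT (fun w : T2 => (vanishing (rchi1 w) (rchi2 w))%:E) (cst 0%E).
  apply/(ae_eq_integral_abs _ measurableT); first by apply/measurable_EFinP; exact: bV.1.
  rewrite -[RHS](_ : (class_average vanishing)%:E = 0%E); last first.
    rewrite /class_average big1 ?mulr0 // => t _.
    by rewrite -/(val7 t) -/(val14 t) vanishing_values mulr0.
  rewrite -(integral_poly2 nuM poly2_vanishing); apply: eq_integral => w _ /=.
  by rewrite ger0_norm ?vanishing_ge0.
rewrite -(integral_poly2 nuM pH).
transitivity (\int[nu]_w (orbit_average (\1_A) w)%:E)%E.
  exact/esym/integral_orbit_average.
apply: ae_eq_integral => //.
- by apply/measurable_EFinP; exact: (bounded_measurable_average mA).1.
- by apply/measurable_EFinP; exact: (bounded_measurable_poly2 pH).1.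
apply: filterS v0 => w h _; congr EFin; case: (h Logic.I) => /vanishing_orbit [t [q qD ->]].
rewrite orbit_average_act //.
have [c1 c2] := orbit_chi R (ltn_ord t) qD; rewrite -zmx_act_grid -/(orbit_pt t) in c1 c2.
rewrite c1 c2 (bigD1 t) //= lagrangeE eqxx mulr1 big1 ?addr0 // => s st.
by rewrite lagrangeE eq_sym (negbTE st) mulr0.
Qed.
End Uniqueness.

(** * The joint spectral measure *)

Section JointSpectralMeasureOfPU33.
Variables (R : realType) (gT : finGroupType) (Gam : {group gT}) (iota : G2_embedding R Gam).
Hypothesis hGam : Gam \isog PU33.
Local Notation T2 := (torus R).

Lemma natCV (k : nat) : ((k%:R^-1 : R)%:C)%C = k%:R^-1.
Proof. by rewrite fmorphV rmorph_nat. Qed.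

(** The right-hand side does not involve the embedding, whence a single measure for
    all embeddings. *)
Lemma mckay_moment_average m n :
  mckay_moment iota m n = ((class_average (fun x y : R => x ^+ m * y ^+ n))%:C)%C.
Proof.
rewrite mckay_momentE.
pose F (x y : R) : R[i]%C := (x%:C%C) ^+ m * (y%:C%C) ^+ n.
rewrite (sum_Gam_values iota hGam F) (card_PU33_isog hGam) /class_average.
rewrite rmorphM rmorph_sum; congr (_ * _); first exact/esym/natCV.
apply: eq_bigr => t _.
by rewrite /F !rmorphM !rmorphXn rmorph_nat /= mulr_natl.
Qed.

Lemma integralC_chi (nu : probability T2 R) m n :
  integralC nu (fun w => chi1 w ^+ m * chi2 w ^+ n) =
  ((fine (\int[nu]_w (rchi1 w ^+ m * rchi2 w ^+ n)%:E)%E)%:C)%C.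
Proof.
have chiE w : chi1 w ^+ m * chi2 w ^+ n = ((rchi1 w ^+ m * rchi2 w ^+ n)%:C)%C.
  by rewrite chi1_rchi1 chi2_rchi2 rmorphM !rmorphXn.
rewrite /integralC /Rintegral; congr (fine _ +i* _)%C.
  by apply: eq_integral => w _; rewrite chiE.
under eq_integral => w _ do rewrite chiE /=.
by rewrite integral0.
Qed.

Lemma spectral_momentsP (nu : probability T2 R) :
  has_spectral_moments iota nu <-> real_moments nu.
Proof.
split=> h m n.
  have [+ _] := h m n; rewrite integralC_chi mckay_moment_average => -[<-].
  rewrite fineK // integrable_fin_num //.
  exact: (bounded_measurable_integrable nu (bounded_measurable_monomial _ m n)).
split; last by rewrite mckay_momentE class_momentE.
by rewrite integralC_chi h mckay_moment_average.
Qed.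
End JointSpectralMeasureOfPU33.

Theorem theorem4p7 (R : realType) (gT : finGroupType) (Gam : {group gT})
    (hGam : Gam \isog PU33) (iota : G2_embedding R Gam)
    (mu : circle R) (hmu : 8.-primitive_root (cval mu)) :
  exists2 eps : probability (torus R) R,
    joint_spectral_measure iota eps &
    forall A : set (torus R), measurable A ->
      (eps A =
         \int[dxd R 7]_(w in A) ((672 * pi ^+ 4)^-1 * on_torus (@Jfun R) w ^+ 2)%:E
         + \int[dxd R 4]_(w in A) (144^-1 * (24 - on_torus (@Kfun R) w))%:E
         + (6^-1)%:E * dxd R 3 A
         - (12^-1)%:E * dxd R 2 A
         + (168^-1)%:E * dxd R 1 A
         + \int[dsup R 4]_(w in A) ((1152 * pi ^+ 4)^-1 * on_torus (@Jfun R) w ^+ 2)%:E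
         + (6^-1)%:E * dsup R 2 A
         - (12^-1)%:E * dsup R 1 A
         + (48^-1)%:E * \sum_(g \in D12) (\d_(torus_act g (mu, circleN1 R)) A : \bar R))%E.
Proof.
have [eps eps_d] := spectral_measure_exists R.
have eps_inv := spectral_measure_invariant eps_d.
have eps_mom : real_moments eps.
  move=> m n; rewrite (integral_spectral_measure eps_d (F := fun x y => x ^+ m * y ^+ n)) //.
  exact: (bounded_measurable_monomial _ m n).1.
exists eps; last by move=> A mA; exact: joint_spectral_formula.
split=> //; first exact/(spectral_momentsP iota hGam).
move=> nu nu_inv /(spectral_momentsP iota hGam) nu_mom A mA.
by rewrite !measure_determined.
Qed.
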